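(* Let $A$ be a commutative ring and $I\subseteq A$ an ideal such that the pair $(A,I)$ is quasiregular, and let $(B,J,\gamma)$ denote the PD-envelope of $(A,I)$. Then the canonical map $$\Gamma^*_{A/I}(I/I^2)\longrightarrow\bigoplus_{n\ge0} J^{[n]}/J^{[n+1]}$$ of graded rings induced by the divided powers $\gamma_n$ is an isomorphism.
   Context: A pair $(A,I)$ is quasiregular if the shifted cotangent complex $L_{(A/I)/A}[-1]\in D(A/I)$ is a flat $A/I$-module (in particular concentrated in degree $0$). The PD-envelope $(B,J,\gamma)$ is the value at $(A,I)$ of the left adjoint to the forgetful functor from divided power rings $(B,J,\gamma)$ to ring-ideal pairs; one has $B/J\cong A/I$. $J^{[n]}\subseteq B$ is the ideal generated by the elements $\gamma_{i_1}(x_1)\cdots\gamma_{i_k}(x_k)$ with $x_1,\ldots,x_k\in J$ and $i_1+\cdots+i_k\ge n$. $\Gamma^*_{A/I}(I/I^2)$ is the divided power algebra of the $A/I$-module $I/I^2$; the canonical map sends the $n$-th divided power of the class of $x\in I$ to the class of $\gamma_n(x)$, where $x$ also denotes its image in $J$. *)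

(* Defs.v *)
From HB Require Import structures.
From mathcomp Require Import all_boot ssralg generic_quotient ring_quotient.
From mathcomp Require Import boolp.

Set Implicit Arguments.
Unset Strict Implicit.
Unset Printing Implicit Defensive.

Import GRing.Theory.
Local Open Scope ring_scope.
Local Open Scope quotient_scope.

(* Rings are [comPzRingType]s throughout: the zero ring is allowed, and it    *)
(* does occur, as A/I when I = A.                                             *)

Record ideal (R : comPzRingType) := Ideal {
  ideal_pred :> {pred R};
  ideal0 : 0 \in ideal_pred;
  idealD : forall x y, x \in ideal_pred -> y \in ideal_pred ->
    x + y \in ideal_pred;
  idealMl : forall a x, x \in ideal_pred -> a * x \in ideal_pred }.

Section IdealTheory.
Variables (R : comPzRingType) (I : ideal R).

Lemma ideal_zmod_closed : zmod_closed I.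
Proof.
split=> [|x y Ix Iy]; first exact: ideal0.
by apply: idealD => //; rewrite -mulN1r; apply: idealMl.
Qed.
HB.instance Definition _ := GRing.isZmodClosed.Build R (ideal_pred I)
  ideal_zmod_closed.

Lemma idealMr a x : x \in I -> x * a \in I.
Proof. by move=> Ix; rewrite mulrC idealMl. Qed.

Lemma idealX n x : x \in I -> x ^+ n.+1 \in I.
Proof. by move=> Ix; rewrite exprS idealMr. Qed.

Definition quot_ring : Type := {ideal_quot I}.
HB.instance Definition _ := GRing.Zmodule.on quot_ring.

Definition quot_proj (x : R) : quot_ring := \pi_({ideal_quot I}) x.

Lemma quot_projP x y : quot_proj x = quot_proj y <-> x - y \in I.
Proof.
rewrite /quot_proj; split=> [/eqP|].
  by rewrite -Quotient.idealrBE.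
by rewrite Quotient.idealrBE => /eqP.
Qed.

Lemma quot_proj_surj (x : quot_ring) : exists y, x = quot_proj y.
Proof. by exists (repr x); rewrite /quot_proj reprK. Qed.

Lemma repr_quot_proj x : repr (quot_proj x) - x \in I.
Proof. by apply/quot_projP; rewrite /quot_proj reprK. Qed.

Lemma quot_proj_zmod : zmod_morphism quot_proj.
Proof. by move=> x y; rewrite /quot_proj raddfB. Qed.
HB.instance Definition _ := GRing.isZmodMorphism.Build R quot_ring quot_proj
  quot_proj_zmod.

Definition quot_mul (x y : quot_ring) : quot_ring :=
  quot_proj (repr x * repr y).

Lemma quot_projM x y :
  quot_mul (quot_proj x) (quot_proj y) = quot_proj (x * y).
Proof.
apply/quot_projP; set x' := repr _; set y' := repr _.
have -> : x' * y' - x * y = (x' - x) * y' + x * (y' - y).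
  by rewrite mulrBl mulrBr addrA subrK.
by apply: idealD; [apply: idealMr|apply: idealMl]; apply: repr_quot_proj.
Qed.

Fact quot_mulA : associative quot_mul.
Proof.
move=> x y z; have [a ->] := quot_proj_surj x; have [b ->] := quot_proj_surj y.
by have [c ->] := quot_proj_surj z; rewrite !quot_projM mulrA.
Qed.
Fact quot_mulC : commutative quot_mul.
Proof.
move=> x y; have [a ->] := quot_proj_surj x; have [b ->] := quot_proj_surj y.
by rewrite !quot_projM mulrC.
Qed.
Fact quot_mul1 : left_id (quot_proj 1) quot_mul.
Proof. by move=> x; have [a ->] := quot_proj_surj x; rewrite quot_projM mul1r. Qed.
Fact quot_mulD : left_distributive quot_mul +%R.
Proof.
move=> x y z; have [a ->] := quot_proj_surj x; have [b ->] := quot_proj_surj y.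
have [c ->] := quot_proj_surj z.
by rewrite -raddfD !quot_projM -raddfD mulrDl.
Qed.
HB.instance Definition _ := GRing.Zmodule_isComPzRing.Build quot_ring
  quot_mulA quot_mulC quot_mul1 quot_mulD.

Fact quot_proj_monoid : monoid_morphism quot_proj.
Proof. by split=> // x y; rewrite -quot_projM. Qed.
HB.instance Definition _ := GRing.isMonoidMorphism.Build R quot_ring quot_proj
  quot_proj_monoid.

End IdealTheory.

Section IdealSpan.
Variables (R : comPzRingType) (S : R -> Prop).

Definition ideal_span_pred : {pred R} :=
  fun x => `[< forall K : ideal R, (forall y, S y -> y \in K) -> x \in K >].

Fact ideal_span0 : 0 \in ideal_span_pred.
Proof. by apply/asboolP => K _; apply: ideal0. Qed.
Fact ideal_spanD x y : x \in ideal_span_pred -> y \in ideal_span_pred ->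
  x + y \in ideal_span_pred.
Proof.
move=> /asboolP Kx /asboolP Ky; apply/asboolP => K SK.
by apply: idealD; [apply: Kx|apply: Ky].
Qed.
Fact ideal_spanM a x : x \in ideal_span_pred -> a * x \in ideal_span_pred.
Proof. by move=> /asboolP Kx; apply/asboolP => K SK; apply/idealMl/Kx. Qed.

Definition ideal_span := Ideal ideal_span0 ideal_spanD ideal_spanM.

Lemma mem_ideal_span x : S x -> x \in ideal_span.
Proof. by move=> Sx; apply/asboolP => K; apply. Qed.

Lemma ideal_span_min (K : ideal R) x :
  (forall y, S y -> y \in K) -> x \in ideal_span -> x \in K.
Proof. by move=> SK /asboolP; apply. Qed.

End IdealSpan.

Definition ideal_sqr (R : comPzRingType) (I : ideal R) : ideal R :=
  ideal_span (fun z => exists x y, [/\ x \in I, y \in I & z = x * y]).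

(* I/I^2 as a module over R/I. *)
Section Conormal.
Variables (R : comPzRingType) (I : ideal R).

Definition ideal_elt := {x : R | x \in I}.
HB.instance Definition _ := SubChoice.on ideal_elt.
HB.instance Definition _ :=
  [SubChoice_isSubZmodule of ideal_elt by <:].

Definition ideal_sqr_in : {pred ideal_elt} := fun x => val x \in ideal_sqr I.

Fact ideal_sqr_in_closed : zmod_closed ideal_sqr_in.
Proof.
split=> [|x y] /=; first exact: (ideal0 (ideal_sqr I)).
exact: (@rpredB _ (ideal_pred (ideal_sqr I))).
Qed.
HB.instance Definition _ := GRing.isZmodClosed.Build ideal_elt ideal_sqr_in
  ideal_sqr_in_closed.

Definition conormal : Type := {ideal_quot ideal_sqr_in}.
HB.instance Definition _ := GRing.Zmodule.on conormal.

Definition conormal_class (x : ideal_elt) : conormal :=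
  \pi_({ideal_quot ideal_sqr_in}) x.

Lemma conormal_classP x y :
  conormal_class x = conormal_class y <-> val x - val y \in ideal_sqr I.
Proof.
rewrite /conormal_class -raddfB; split=> [/eqP|h]; last apply/eqP.
  by rewrite -Quotient.idealrBE.
by rewrite -Quotient.idealrBE.
Qed.

Lemma conormal_class_surj (m : conormal) : exists x, m = conormal_class x.
Proof. by exists (repr m); rewrite /conormal_class reprK. Qed.

Lemma repr_conormal_class x :
  val (repr (conormal_class x)) - val x \in ideal_sqr I.
Proof. by apply/conormal_classP; rewrite /conormal_class reprK. Qed.

Lemma conormal_class_zmod : zmod_morphism conormal_class.
Proof. by move=> x y; rewrite /conormal_class raddfB. Qed.
HB.instance Definition _ := GRing.isZmodMorphism.Build ideal_elt conormal
  conormal_class conormal_class_zmod.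

Definition ideal_elt_scale (a : R) (x : ideal_elt) : ideal_elt :=
  exist _ (a * val x) (idealMl a (valP x)).

Definition conormal_scale (r : quot_ring I) (m : conormal) : conormal :=
  conormal_class (ideal_elt_scale (repr r) (repr m)).

Lemma conormal_scaleE a x :
  conormal_scale (quot_proj I a) (conormal_class x) =
  conormal_class (ideal_elt_scale a x).
Proof.
apply/conormal_classP; set a' := repr _; set x' := repr _.
rewrite ![val _]/=; have -> : a' * val x' - a * val x = (a' - a) * val x' + a * (val x' - val x).
  by rewrite mulrBl mulrBr addrA subrK.
apply: idealD; last exact/idealMl/repr_conormal_class.
apply: mem_ideal_span; exists (a' - a), (val x').
by split=> //; [apply: repr_quot_proj|apply: valP].
Qed.

Fact conormal_scaleA a b v :
  conormal_scale a (conormal_scale b v) = conormal_scale (a * b) v.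
Proof.
have [a' ->] := quot_proj_surj a; have [b' ->] := quot_proj_surj b.
have [x ->] := conormal_class_surj v; rewrite -rmorphM !conormal_scaleE.
by congr conormal_class; apply: val_inj; rewrite /= mulrA.
Qed.
Fact conormal_scale1 : left_id 1 conormal_scale.
Proof.
move=> v; have [x ->] := conormal_class_surj v.
rewrite -(rmorph1 (quot_proj I)) conormal_scaleE.
by congr conormal_class; apply: val_inj; rewrite /= mul1r.
Qed.
Fact conormal_scaleDr : right_distributive conormal_scale +%R.
Proof.
move=> a v w; have [a' ->] := quot_proj_surj a.
have [x ->] := conormal_class_surj v; have [y ->] := conormal_class_surj w.
rewrite -raddfD !conormal_scaleE -raddfD.
by congr conormal_class; apply: val_inj; rewrite /= mulrDr.
Qed.
Fact conormal_scaleDl v : {morph conormal_scale^~ v : a b / a + b}.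
Proof.
move=> a b; have [a' ->] := quot_proj_surj a; have [b' ->] := quot_proj_surj b.
have [x ->] := conormal_class_surj v.
rewrite -raddfD !conormal_scaleE -raddfD.
by congr conormal_class; apply: val_inj; rewrite /= mulrDl.
Qed.
HB.instance Definition _ := GRing.Zmodule_isLmodule.Build (quot_ring I) conormal
  conormal_scaleA conormal_scale1 conormal_scaleDr conormal_scaleDl.

End Conormal.

(* The module generated by S subject to a condition P on maps out of S:       *)
(* formal R-linear expressions in S, two of them being identified when they   *)
(* agree under every map f : S -> N satisfying P. So every such f extends     *)
(* uniquely to a linear map (univ_mod_lift). When P is equational, as in all  *)
(* uses below, univ_mod_gen satisfies P and is the universal such map.        *)
Section UnivMod.
Variables (R : comPzRingType) (S : Type).

Inductive mod_term :=
  | MGen of S | MZero | MAdd of mod_term & mod_term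
  | MOpp of mod_term | MScale of R & mod_term.

Fixpoint mod_eval (N : lmodType R) (f : S -> N) (t : mod_term) : N :=
  match t with
  | MGen s => f s
  | MZero => 0
  | MAdd t u => mod_eval f t + mod_eval f u
  | MOpp t => - mod_eval f t
  | MScale a t => a *: mod_eval f t
  end.

HB.instance Definition _ := gen_eqMixin mod_term.
HB.instance Definition _ := gen_choiceMixin mod_term.

Variable P : forall N : lmodType R, (S -> N) -> Prop.

Definition mod_equiv (t u : mod_term) : bool :=
  `[< forall (N : lmodType R) (f : S -> N), P f -> mod_eval f t = mod_eval f u >].

Fact mod_equiv_class : equiv_class_of mod_equiv.
Proof.
split=> [t|t u|u t v].
- exact/asboolP.
- by apply/asboolP/asboolP => h N f Pf; rewrite h.
- by move=> /asboolP h1 /asboolP h2; apply/asboolP => N f Pf; rewrite h1 ?h2.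
Qed.
Canonical mod_equiv_rel := EquivRelPack mod_equiv_class.

Definition univ_mod : Type := {eq_quot mod_equiv}.
HB.instance Definition _ := Choice.on univ_mod.

Definition mod_class (t : mod_term) : univ_mod := \pi_({eq_quot mod_equiv}) t.

Lemma mod_classP t u : mod_class t = mod_class u <->
  forall (N : lmodType R) (f : S -> N), P f -> mod_eval f t = mod_eval f u.
Proof.
rewrite /mod_class; split=> [/eqmodP/asboolP //|h].
exact/eqmodP/asboolP.
Qed.

Lemma mod_class_repr x : mod_class (repr x) = x.
Proof. exact: reprK. Qed.

Lemma mod_eval_repr (N : lmodType R) (f : S -> N) t :
  P f -> mod_eval f (repr (mod_class t)) = mod_eval f t.
Proof. by move=> Pf; have /mod_classP := mod_class_repr (mod_class t); apply. Qed.

Definition univ_mod_add (x y : univ_mod) := mod_class (MAdd (repr x) (repr y)).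
Definition univ_mod_opp (x : univ_mod) := mod_class (MOpp (repr x)).
Definition univ_mod_scale (a : R) (x : univ_mod) := mod_class (MScale a (repr x)).

Fact univ_mod_addA : associative univ_mod_add.
Proof.
by move=> x y z; apply/mod_classP => N f Pf /=; rewrite !mod_eval_repr //= addrA.
Qed.
Fact univ_mod_addC : commutative univ_mod_add.
Proof. by move=> x y; apply/mod_classP => N f Pf /=; rewrite addrC. Qed.
Fact univ_mod_add0 : left_id (mod_class MZero) univ_mod_add.
Proof.
move=> x; rewrite -[RHS]mod_class_repr; apply/mod_classP => N f Pf /=.
by rewrite mod_eval_repr //= add0r.
Qed.
Fact univ_mod_addN : left_inverse (mod_class MZero) univ_mod_opp univ_mod_add.
Proof.
by move=> x; apply/mod_classP => N f Pf /=; rewrite mod_eval_repr //= addNr.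
Qed.
HB.instance Definition _ := GRing.isZmodule.Build univ_mod
  univ_mod_addA univ_mod_addC univ_mod_add0 univ_mod_addN.

Fact univ_mod_scaleA a b x :
  univ_mod_scale a (univ_mod_scale b x) = univ_mod_scale (a * b) x.
Proof.
by apply/mod_classP => N f Pf /=; rewrite mod_eval_repr //= scalerA.
Qed.
Fact univ_mod_scale1 : left_id 1 univ_mod_scale.
Proof.
move=> x; rewrite -[RHS]mod_class_repr.
by apply/mod_classP => N f Pf /=; rewrite scale1r.
Qed.
Fact univ_mod_scaleDr : right_distributive univ_mod_scale +%R.
Proof.
move=> a x y; apply/mod_classP => N f Pf /=.
by rewrite !mod_eval_repr //= scalerDr.
Qed.
Fact univ_mod_scaleDl x : {morph univ_mod_scale^~ x : a b / a + b}.
Proof.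
move=> a b; apply/mod_classP => N f Pf /=.
by rewrite !mod_eval_repr //= scalerDl.
Qed.
HB.instance Definition _ := GRing.Zmodule_isLmodule.Build R univ_mod
  univ_mod_scaleA univ_mod_scale1 univ_mod_scaleDr univ_mod_scaleDl.

Definition univ_mod_gen (s : S) : univ_mod := mod_class (MGen s).

Lemma mod_classE t : mod_class t = mod_eval univ_mod_gen t.
Proof.
elim: t => //= [t <- u <-|t <-|a t <-];
  by apply/mod_classP => N f Pf /=; rewrite !mod_eval_repr.
Qed.

(* Identities between expressions that follow from P hold in univ_mod. *)
Lemma univ_mod_eq t u :
  (forall (N : lmodType R) (f : S -> N), P f -> mod_eval f t = mod_eval f u) ->
  mod_eval univ_mod_gen t = mod_eval univ_mod_gen u.
Proof. by move=> h; rewrite -!mod_classE; apply/mod_classP. Qed.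

Section Lift.
Variables (N : lmodType R) (f : S -> N) (Pf : P f).

Definition univ_mod_lift (_ : P f) (x : univ_mod) : N := mod_eval f (repr x).

Lemma univ_mod_lift_class t : univ_mod_lift Pf (mod_class t) = mod_eval f t.
Proof. exact: mod_eval_repr. Qed.

Lemma univ_mod_liftE s : univ_mod_lift Pf (univ_mod_gen s) = f s.
Proof. exact: univ_mod_lift_class. Qed.

Fact univ_mod_lift_linear : linear (univ_mod_lift Pf).
Proof.
move=> a x y; rewrite -[x]mod_class_repr -[y]mod_class_repr.
set t := repr x; set u := repr y.
have -> : a *: mod_class t + mod_class u = mod_class (MAdd (MScale a t) u).
  by rewrite !mod_classE.
by rewrite !univ_mod_lift_class.
Qed.
HB.instance Definition _ := GRing.isLinear.Build R univ_mod N *:%R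
  (univ_mod_lift Pf) univ_mod_lift_linear.

Lemma univ_mod_lift_unique (g : {linear univ_mod -> N}) :
  (forall s, g (univ_mod_gen s) = f s) -> g =1 univ_mod_lift Pf.
Proof.
move=> gE x; rewrite -[x]mod_class_repr mod_classE.
elim: (repr x) => /= [s||t IHt u IHu|t IHt|a t IHt].
- by rewrite gE univ_mod_liftE.
- by rewrite !raddf0.
- by rewrite !raddfD /= IHt IHu.
- by rewrite !raddfN /= IHt.
- by rewrite !linearZ /= IHt.
Qed.

End Lift.
End UnivMod.

(* The commutative A-algebra generated by S subject to a condition P on pairs *)
(* (structure map A -> C, map S -> C), constructed in the same way.           *)
Section UnivAlg.
Variables (A : comPzRingType) (S : Type).

Inductive alg_term :=
  | AGen of S | ACst of A | AAdd of alg_term & alg_term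
  | AOpp of alg_term | AMul of alg_term & alg_term.

Fixpoint alg_eval (C : comPzRingType) (h : A -> C) (f : S -> C)
    (t : alg_term) : C :=
  match t with
  | AGen s => f s
  | ACst a => h a
  | AAdd t u => alg_eval h f t + alg_eval h f u
  | AOpp t => - alg_eval h f t
  | AMul t u => alg_eval h f t * alg_eval h f u
  end.

HB.instance Definition _ := gen_eqMixin alg_term.
HB.instance Definition _ := gen_choiceMixin alg_term.

Variable P : forall C : comPzRingType, (A -> C) -> (S -> C) -> Prop.

Definition alg_equiv (t u : alg_term) : bool :=
  `[< forall (C : comPzRingType) (h : {rmorphism A -> C}) (f : S -> C),
        P h f -> alg_eval h f t = alg_eval h f u >].

Fact alg_equiv_class : equiv_class_of alg_equiv.
Proof.
split=> [t|t u|u t v].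
- exact/asboolP.
- by apply/asboolP/asboolP => e C h f Pf; rewrite e.
- by move=> /asboolP e1 /asboolP e2; apply/asboolP => C h f Pf; rewrite e1 ?e2.
Qed.
Canonical alg_equiv_rel := EquivRelPack alg_equiv_class.

Definition univ_alg : Type := {eq_quot alg_equiv}.
HB.instance Definition _ := Choice.on univ_alg.

Definition alg_class (t : alg_term) : univ_alg := \pi_({eq_quot alg_equiv}) t.

Lemma alg_classP t u : alg_class t = alg_class u <->
  forall (C : comPzRingType) (h : {rmorphism A -> C}) (f : S -> C),
    P h f -> alg_eval h f t = alg_eval h f u.
Proof.
rewrite /alg_class; split=> [/eqmodP/asboolP //|e].
exact/eqmodP/asboolP.
Qed.

Lemma alg_class_repr x : alg_class (repr x) = x.
Proof. exact: reprK. Qed.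

Lemma alg_eval_repr (C : comPzRingType) (h : {rmorphism A -> C}) (f : S -> C) t :
  P h f -> alg_eval h f (repr (alg_class t)) = alg_eval h f t.
Proof. by move=> Pf; have /alg_classP := alg_class_repr (alg_class t); apply. Qed.

Definition univ_alg_add (x y : univ_alg) := alg_class (AAdd (repr x) (repr y)).
Definition univ_alg_opp (x : univ_alg) := alg_class (AOpp (repr x)).
Definition univ_alg_mul (x y : univ_alg) := alg_class (AMul (repr x) (repr y)).
Definition univ_alg_cst (a : A) : univ_alg := alg_class (ACst a).
Definition univ_alg_gen (s : S) : univ_alg := alg_class (AGen s).

Fact univ_alg_addA : associative univ_alg_add.
Proof.
by move=> x y z; apply/alg_classP => C h f Pf /=; rewrite !alg_eval_repr //= addrA.
Qed.
Fact univ_alg_addC : commutative univ_alg_add.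
Proof. by move=> x y; apply/alg_classP => C h f Pf /=; rewrite addrC. Qed.
Fact univ_alg_add0 : left_id (univ_alg_cst 0) univ_alg_add.
Proof.
move=> x; rewrite -[RHS]alg_class_repr; apply/alg_classP => C h f Pf /=.
by rewrite alg_eval_repr //= rmorph0 add0r.
Qed.
Fact univ_alg_addN : left_inverse (univ_alg_cst 0) univ_alg_opp univ_alg_add.
Proof.
move=> x; apply/alg_classP => C h f Pf /=.
by rewrite alg_eval_repr //= rmorph0 addNr.
Qed.
HB.instance Definition _ := GRing.isZmodule.Build univ_alg
  univ_alg_addA univ_alg_addC univ_alg_add0 univ_alg_addN.

Fact univ_alg_mulA : associative univ_alg_mul.
Proof.
by move=> x y z; apply/alg_classP => C h f Pf /=; rewrite !alg_eval_repr //= mulrA.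
Qed.
Fact univ_alg_mulC : commutative univ_alg_mul.
Proof. by move=> x y; apply/alg_classP => C h f Pf /=; rewrite mulrC. Qed.
Fact univ_alg_mul1 : left_id (univ_alg_cst 1) univ_alg_mul.
Proof.
move=> x; rewrite -[RHS]alg_class_repr; apply/alg_classP => C h f Pf /=.
by rewrite alg_eval_repr //= rmorph1 mul1r.
Qed.
Fact univ_alg_mulD : left_distributive univ_alg_mul +%R.
Proof.
move=> x y z; apply/alg_classP => C h f Pf /=.
by rewrite !alg_eval_repr //= mulrDl.
Qed.
HB.instance Definition _ := GRing.Zmodule_isComPzRing.Build univ_alg
  univ_alg_mulA univ_alg_mulC univ_alg_mul1 univ_alg_mulD.

Fact univ_alg_cst_zmod : zmod_morphism univ_alg_cst.
Proof.
move=> a b; apply/alg_classP => C h f Pf /=.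
by rewrite !alg_eval_repr //= alg_eval_repr //= rmorphB.
Qed.
HB.instance Definition _ := GRing.isZmodMorphism.Build A univ_alg univ_alg_cst
  univ_alg_cst_zmod.
Fact univ_alg_cst_monoid : monoid_morphism univ_alg_cst.
Proof.
split=> // a b; apply/alg_classP => C h f Pf /=.
by rewrite !alg_eval_repr //= rmorphM.
Qed.
HB.instance Definition _ := GRing.isMonoidMorphism.Build A univ_alg univ_alg_cst
  univ_alg_cst_monoid.

Lemma alg_classE t : alg_class t = alg_eval univ_alg_cst univ_alg_gen t.
Proof.
elim: t => //= [t <- u <-|t <-|t <- u <-];
  by apply/alg_classP => C h f Pf /=; rewrite !alg_eval_repr.
Qed.

Lemma univ_alg_eq t u :
  (forall (C : comPzRingType) (h : {rmorphism A -> C}) (f : S -> C),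
     P h f -> alg_eval h f t = alg_eval h f u) ->
  alg_eval univ_alg_cst univ_alg_gen t = alg_eval univ_alg_cst univ_alg_gen u.
Proof. by move=> e; rewrite -!alg_classE; apply/alg_classP. Qed.

Section Lift.
Variables (C : comPzRingType) (h : {rmorphism A -> C}) (f : S -> C).
Variable Pf : P h f.

Definition univ_alg_lift (_ : P h f) (x : univ_alg) : C := alg_eval h f (repr x).

Lemma univ_alg_lift_class t : univ_alg_lift Pf (alg_class t) = alg_eval h f t.
Proof. exact: alg_eval_repr. Qed.

Lemma univ_alg_liftE s : univ_alg_lift Pf (univ_alg_gen s) = f s.
Proof. exact: univ_alg_lift_class. Qed.

Lemma univ_alg_lift_cst a : univ_alg_lift Pf (univ_alg_cst a) = h a.
Proof. exact: univ_alg_lift_class. Qed.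

Fact univ_alg_lift_zmod : zmod_morphism (univ_alg_lift Pf).
Proof.
move=> x y; rewrite -[x]alg_class_repr -[y]alg_class_repr.
set t := repr x; set u := repr y.
have -> : alg_class t - alg_class u = alg_class (AAdd t (AOpp u)).
  by rewrite !alg_classE.
by rewrite !univ_alg_lift_class.
Qed.
HB.instance Definition _ := GRing.isZmodMorphism.Build univ_alg C
  (univ_alg_lift Pf) univ_alg_lift_zmod.
Fact univ_alg_lift_monoid : monoid_morphism (univ_alg_lift Pf).
Proof.
split=> [|x y]; first by rewrite univ_alg_lift_cst rmorph1.
rewrite -[x]alg_class_repr -[y]alg_class_repr.
set t := repr x; set u := repr y.
have -> : alg_class t * alg_class u = alg_class (AMul t u).
  by rewrite !alg_classE.
by rewrite !univ_alg_lift_class.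
Qed.
HB.instance Definition _ := GRing.isMonoidMorphism.Build univ_alg C
  (univ_alg_lift Pf) univ_alg_lift_monoid.

Lemma univ_alg_lift_unique (g : {rmorphism univ_alg -> C}) :
  (forall a, g (univ_alg_cst a) = h a) ->
  (forall s, g (univ_alg_gen s) = f s) -> g =1 univ_alg_lift Pf.
Proof.
move=> gc gE x; rewrite -[x]alg_class_repr alg_classE.
elim: (repr x) => /= [s|a|t IHt u IHu|t IHt|t IHt u IHu].
- by rewrite gE univ_alg_liftE.
- by rewrite gc univ_alg_lift_cst.
- by rewrite !raddfD /= IHt IHu.
- by rewrite !raddfN /= IHt.
- by rewrite !rmorphM /= IHt IHu.
Qed.

End Lift.
End UnivAlg.

Record submodule (R : comPzRingType) (M : lmodType R) := Submodule {
  submod_pred :> {pred M};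
  submod_predP : submod_closed submod_pred }.

Section QuotMod.
Variables (R : comPzRingType) (M : lmodType R) (W : submodule M).

HB.instance Definition _ := GRing.isSubmodClosed.Build R M (submod_pred W)
  (submod_predP W).
HB.instance Definition _ := GRing.isZmodClosed.Build M (submod_pred W)
  (GRing.submod_closedB (submod_predP W)).

Definition quot_mod : Type := {ideal_quot W}.
HB.instance Definition _ := GRing.Zmodule.on quot_mod.

Definition quot_mod_proj (x : M) : quot_mod := \pi_({ideal_quot W}) x.

Lemma quot_mod_projP x y : quot_mod_proj x = quot_mod_proj y <-> x - y \in W.
Proof.
rewrite /quot_mod_proj; split=> [/eqP|h]; last apply/eqP.
  by rewrite -Quotient.idealrBE.
by rewrite -Quotient.idealrBE.
Qed.

Lemma quot_mod_proj_surj (x : quot_mod) : exists y, x = quot_mod_proj y.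
Proof. by exists (repr x); rewrite /quot_mod_proj reprK. Qed.

Fact quot_mod_proj_zmod : zmod_morphism quot_mod_proj.
Proof. by move=> x y; rewrite /quot_mod_proj raddfB. Qed.
HB.instance Definition _ := GRing.isZmodMorphism.Build M quot_mod quot_mod_proj
  quot_mod_proj_zmod.

Definition quot_mod_scale (a : R) (x : quot_mod) : quot_mod :=
  quot_mod_proj (a *: repr x).

Lemma quot_mod_scaleE a x :
  quot_mod_scale a (quot_mod_proj x) = quot_mod_proj (a *: x).
Proof.
apply/quot_mod_projP; rewrite -scalerBr rpredZ //.
by apply/quot_mod_projP; rewrite /quot_mod_proj reprK.
Qed.

Fact quot_mod_scaleA a b x :
  quot_mod_scale a (quot_mod_scale b x) = quot_mod_scale (a * b) x.
Proof.
by have [y ->] := quot_mod_proj_surj x; rewrite !quot_mod_scaleE scalerA.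
Qed.
Fact quot_mod_scale1 : left_id 1 quot_mod_scale.
Proof.
by move=> x; have [y ->] := quot_mod_proj_surj x; rewrite quot_mod_scaleE scale1r.
Qed.
Fact quot_mod_scaleDr : right_distributive quot_mod_scale +%R.
Proof.
move=> a x y; have [u ->] := quot_mod_proj_surj x.
have [v ->] := quot_mod_proj_surj y.
by rewrite -raddfD !quot_mod_scaleE scalerDr raddfD.
Qed.
Fact quot_mod_scaleDl x : {morph quot_mod_scale^~ x : a b / a + b}.
Proof.
move=> a b; have [y ->] := quot_mod_proj_surj x.
by rewrite !quot_mod_scaleE scalerDl raddfD.
Qed.
HB.instance Definition _ := GRing.Zmodule_isLmodule.Build R quot_mod
  quot_mod_scaleA quot_mod_scale1 quot_mod_scaleDr quot_mod_scaleDl.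

End QuotMod.

(* Tensor products and flatness *)

Section Tensor.
Variable R : comPzRingType.

Definition bilinear_rel (M N : lmodType R) (Q : lmodType R) (b : M * N -> Q) :=
  [/\ forall m m' n, b (m + m', n) = b (m, n) + b (m', n),
      forall m n n', b (m, n + n') = b (m, n) + b (m, n'),
      forall a m n, b (a *: m, n) = a *: b (m, n) &
      forall a m n, b (m, a *: n) = a *: b (m, n)].

Definition tensor (M N : lmodType R) : lmodType R :=
  univ_mod (@bilinear_rel M N).

Definition tensor_mk (M N : lmodType R) (m : M) (n : N) : tensor M N :=
  univ_mod_gen (@bilinear_rel M N) (m, n).

Lemma tensor_mk_bilinear (M N : lmodType R) :
  bilinear_rel (fun mn : M * N => tensor_mk mn.1 mn.2).
Proof.
split=> *.
- apply: (@univ_mod_eq _ _ _ (MGen _ _) (MAdd (MGen _ _) (MGen _ _))).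
  by move=> Q f [+ _ _ _] /=; apply.
- apply: (@univ_mod_eq _ _ _ (MGen _ _) (MAdd (MGen _ _) (MGen _ _))).
  by move=> Q f [_ + _ _] /=; apply.
- apply: (@univ_mod_eq _ _ _ (MGen _ _) (MScale _ (MGen _ _))).
  by move=> Q f [_ _ + _] /=; apply.
- apply: (@univ_mod_eq _ _ _ (MGen _ _) (MScale _ (MGen _ _))).
  by move=> Q f [_ _ _] /=; apply.
Qed.

Fact tensor_map_subproof (M N N' : lmodType R) (i : {linear N -> N'}) :
  bilinear_rel (fun mn : M * N => tensor_mk mn.1 (i mn.2)).
Proof.
have [b1 b2 b3 b4] := tensor_mk_bilinear M N'.
split=> [m m' n|m n n'|a m n|a m n] /=.
- exact: (b1 m m' (i n)).
- by rewrite raddfD; apply: (b2 m (i n) (i n')).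
- exact: (b3 a m (i n)).
- by rewrite linearZ; apply: (b4 a m (i n)).
Qed.

Definition tensor_map (M N N' : lmodType R) (i : {linear N -> N'}) :
    {linear tensor M N -> tensor M N'} :=
  univ_mod_lift (tensor_map_subproof M i).

Definition flat (M : lmodType R) : Prop :=
  forall (N N' : lmodType R) (i : {linear N -> N'}),
    injective i -> injective (tensor_map M i).

End Tensor.

(* For A -> P -> B, the B-module Omega_{P/A} (x)_P B. It is presented by      *)
(* generators dp = dp (x) 1 for p in P, i.e. B-linear maps out of it are      *)
(* the A-derivations of P into B-modules regarded as P-modules via e.         *)
Section Kaehler.
Variables (A : comPzRingType).

Definition derivation_rel (P B : comPzRingType) (s : A -> P) (e : P -> B)
    (N : lmodType B) (d : P -> N) :=
  [/\ forall x y, d (x + y) = d x + d y,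
      forall x y, d (x * y) = e x *: d y + e y *: d x &
      forall a, d (s a) = 0].

Definition kaehler (P B : comPzRingType) (s : A -> P) (e : P -> B) : lmodType B :=
  univ_mod (@derivation_rel P B s e).

Definition kaehler_d (P B : comPzRingType) (s : A -> P) (e : P -> B) :
  P -> kaehler s e := univ_mod_gen (@derivation_rel P B s e).

Lemma kaehler_d_derivation (P B : comPzRingType) (s : A -> P) (e : P -> B) :
  derivation_rel s e (kaehler_d s e).
Proof.
split=> *.
- apply: (@univ_mod_eq _ _ _ (MGen _ _) (MAdd (MGen _ _) (MGen _ _))).
  by move=> Q f [+ _ _] /=; apply.
- apply: (@univ_mod_eq _ _ _ (MGen _ _)
    (MAdd (MScale _ (MGen _ _)) (MScale _ (MGen _ _)))).
  by move=> Q f [_ + _] /=; apply.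
- apply: (@univ_mod_eq _ _ _ (MGen _ _) (MZero _ _)).
  by move=> Q f [_ _] /=; apply.
Qed.

Section Map.
Variables (P P' B : comPzRingType) (s : A -> P) (e : P -> B).
Variables (s' : A -> P') (e' : P' -> B) (g : {rmorphism P -> P'}).
Hypotheses (gs : forall a, g (s a) = s' a) (e'g : forall x, e' (g x) = e x).

Fact kaehler_map_subproof : derivation_rel s e (fun x => kaehler_d s' e' (g x)).
Proof.
have [dD dM dc] := kaehler_d_derivation s' e'.
split=> [x y|x y|a]; first by rewrite rmorphD dD.
- by rewrite rmorphM dM !e'g.
- by rewrite gs dc.
Qed.

Definition kaehler_map : {linear kaehler s e -> kaehler s' e'} :=
  univ_mod_lift kaehler_map_subproof.
End Map.
End Kaehler.

(* The free commutative A-algebra A[S]. *)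
Section FreeAlg.
Variable A : comPzRingType.

Definition free_rel (S : Type) (C : comPzRingType) (h : A -> C) (f : S -> C) :=
  True.

Definition free_alg (S : Type) : comPzRingType := univ_alg (@free_rel S).

Definition free_cst (S : Type) : {rmorphism A -> free_alg S} :=
  univ_alg_cst (@free_rel S).

Definition free_gen (S : Type) (x : S) : free_alg S :=
  univ_alg_gen (@free_rel S) x.

Definition free_lift (S : Type) (C : comPzRingType) (h : {rmorphism A -> C})
    (f : S -> C) : {rmorphism free_alg S -> C} :=
  univ_alg_lift (I : free_rel h f).

Lemma free_lift_gen S (C : comPzRingType) (h : {rmorphism A -> C}) (f : S -> C) x :
  free_lift h f (free_gen x) = f x.
Proof. exact: univ_alg_liftE. Qed.

Lemma free_lift_cst S (C : comPzRingType) (h : {rmorphism A -> C}) (f : S -> C) a :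
  free_lift h f (free_cst S a) = h a.
Proof. exact: univ_alg_lift_cst. Qed.

Lemma free_alg_ext S (C : comPzRingType) (g g' : {rmorphism free_alg S -> C}) :
  (forall a, g (free_cst S a) = g' (free_cst S a)) ->
  (forall x, g (free_gen x) = g' (free_gen x)) -> g =1 g'.
Proof.
move=> gc gg x.
rewrite (@univ_alg_lift_unique _ _ _ _ (g' \o free_cst S)
           (fun x => g' (free_gen x)) I g) //.
by rewrite -(@univ_alg_lift_unique _ _ _ _ (g' \o free_cst S)
           (fun x => g' (free_gen x)) I g').
Qed.

Definition free_map (S T : Type) (f : S -> T) :
    {rmorphism free_alg S -> free_alg T} :=
  free_lift (free_cst T) (fun x => free_gen (f x)).

End FreeAlg.

(* The cotangent complex of h : A -> B, as the complex attached to the        *)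
(* simplicial B-module Omega_{P_n/A} (x)_{P_n} B, where P_. -> B is the       *)
(* standard simplicial resolution P_n = A[-]^(n+1)(B).                        *)
Section Cotangent.
Variables (A B : comPzRingType) (h : {rmorphism A -> B}).

(* Indices are shifted by one: bar 0 = B and P_n = bar n.+1. *)
Fixpoint bar_alg (n : nat) : {C : comPzRingType & {rmorphism A -> C}} :=
  if n is n'.+1 then
    existT _ (free_alg A (projT1 (bar_alg n'))) (free_cst A (projT1 (bar_alg n')))
  else existT _ B h.

Definition bar (n : nat) : comPzRingType := projT1 (bar_alg n).
Definition bar_cst (n : nat) : {rmorphism A -> bar n} := projT2 (bar_alg n).

(* [x] |-> x *)
Definition bar_counit (n : nat) : {rmorphism bar n.+1 -> bar n} :=
  free_lift (bar_cst n) id.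

(* The i-th face P_n -> P_(n-1), for i <= n; the remaining values are unused. *)
Fixpoint bar_face (n i : nat) : {rmorphism bar n.+1 -> bar n} :=
  match i, n with
  | 0, n => bar_counit n
  | i'.+1, 0 => bar_counit 0
  | i'.+1, n'.+1 => free_map A (bar_face n' i')
  end.

Fixpoint bar_aug (n : nat) : {rmorphism bar n -> B} :=
  if n is n'.+1 then (bar_aug n' \o bar_counit n')%FUN else idfun.

Lemma bar_face_cst n i a : bar_face n i (bar_cst n.+1 a) = bar_cst n a.
Proof. by case: n i => [|n] [|i]; apply: free_lift_cst. Qed.

Lemma bar_counit_nat n (g : {rmorphism bar n.+1 -> bar n}) x :
  (forall a, g (bar_cst n.+1 a) = bar_cst n a) ->
  bar_counit n (free_map A g x) = g (bar_counit n.+1 x).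
Proof.
move=> gc; apply: (@free_alg_ext A _ _ (bar_counit n \o free_map A g)
  (g \o bar_counit n.+1)) => [a|y] /=.
- transitivity (bar_cst n a).
    by rewrite [X in bar_counit n X]free_lift_cst; apply: free_lift_cst.
  by rewrite [X in g X]free_lift_cst gc.
- transitivity (g y); last first.
    by congr (g _); rewrite [RHS]free_lift_gen.
  by rewrite [X in bar_counit n X]free_lift_gen; apply: free_lift_gen.
Qed.

Lemma bar_aug_face n i x : bar_aug n (bar_face n i x) = bar_aug n.+1 x.
Proof.
elim: n i x => [|n IHn] [|i] x //=.
rewrite bar_counit_nat; first exact: IHn.
by move=> a; apply: bar_face_cst.
Qed.

Lemma bar_faceC n i j x : (i <= j <= n)%N ->
  bar_face n i (bar_face n.+1 j.+1 x) = bar_face n j (bar_face n.+1 i x).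
Proof.
have face0 m k y : bar_face m 0 (bar_face m.+1 k.+1 y) =
    bar_face m k (bar_face m.+1 0 y).
  by case: m k y => [|m] k y; apply: bar_counit_nat => a; apply: bar_face_cst.
elim: n i j x => [|n IHn] [|i] j x hij; try exact: face0.
  by case/andP: hij; case: j.
case: j hij => // j hij.
apply: (@free_alg_ext A _ _
  (free_map A (bar_face n i) \o free_map A (bar_face n.+1 j.+1))
  (free_map A (bar_face n j) \o free_map A (bar_face n.+1 i))) => [a|y] /=.
- by rewrite 4!free_lift_cst.
- by rewrite 4!free_lift_gen IHn.
Qed.

Definition cotangent (n : nat) : lmodType B :=
  kaehler (bar_cst n.+1) (bar_aug n.+1).

Definition cotangent_face (n i : nat) :
    {linear cotangent n.+1 -> cotangent n} :=
  kaehler_map (bar_face_cst n.+1 i) (@bar_aug_face n.+1 i).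

Definition cotangent_diff (n : nat) (x : cotangent n.+1) : cotangent n :=
  \sum_(i < n.+2) (-1) ^+ i *: cotangent_face n i x.

Fact cotangent_diff_linear n : linear (@cotangent_diff n).
Proof.
move=> a x y; rewrite /cotangent_diff scaler_sumr -big_split /=.
apply: eq_bigr => i _; rewrite linearP scalerDr; congr (_ + _).
by rewrite !scalerA mulrC.
Qed.
HB.instance Definition _ n := GRing.isLinear.Build B (cotangent n.+1)
  (cotangent n) *:%R (@cotangent_diff n) (@cotangent_diff_linear n).

Lemma cotangent_faceC n i j x : (i <= j <= n.+1)%N ->
  cotangent_face n i (cotangent_face n.+1 j.+1 x) =
  cotangent_face n j (cotangent_face n.+1 i x).
Proof.
move=> hij; pose d y := kaehler_d (bar_cst n.+1) (bar_aug n.+1)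
  (bar_face n.+1 i (bar_face n.+2 j.+1 y)).
have faceE m k y : cotangent_face m k (kaehler_d _ _ y) =
  kaehler_d (bar_cst m.+1) (bar_aug m.+1) (bar_face m.+1 k y).
  exact: univ_mod_liftE.
have dP : derivation_rel (bar_cst n.+3) (bar_aug n.+3) d.
  have [dD dM dc] := kaehler_d_derivation (bar_cst n.+1) (bar_aug n.+1).
  split=> [y z|y z|a]; rewrite /d.
  - by rewrite !rmorphD dD.
  - by rewrite !rmorphM dM !bar_aug_face.
  - by rewrite !bar_face_cst dc.
transitivity (univ_mod_lift dP x).
  apply: (univ_mod_lift_unique dP
    (g := (cotangent_face n i \o cotangent_face n.+1 j.+1)%FUN)) => y.
  transitivity (cotangent_face n i (kaehler_d (bar_cst n.+2) (bar_aug n.+2)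
    (bar_face n.+2 j.+1 y))); last exact: faceE.
  by congr (cotangent_face n i _); apply: faceE.
symmetry; apply: (univ_mod_lift_unique dP
  (g := (cotangent_face n j \o cotangent_face n.+1 i)%FUN)) => y.
transitivity (cotangent_face n j (kaehler_d (bar_cst n.+2) (bar_aug n.+2)
  (bar_face n.+2 i y))); first by congr (cotangent_face n j _); apply: faceE.
by rewrite [LHS]faceE /d bar_faceC.
Qed.

Lemma cotangent_diff_diff n (x : cotangent n.+2) :
  cotangent_diff (cotangent_diff x) = 0.
Proof.
pose c j i : cotangent n :=
  (-1) ^+ (i + j) *: cotangent_face n j (cotangent_face n.+1 i x).
have cN i j : (i <= j <= n.+1)%N -> c i j.+1 = - c j i.
  by move=> hij; rewrite /c cotangent_faceC // addSn addnC exprS mulN1r scaleNr.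
transitivity (\sum_(j < n.+2) \sum_(i < n.+3) c j i).
  apply: eq_bigr => j _; rewrite linear_sum scaler_sumr; apply: eq_bigr => i _.
  by rewrite linearZ /= scalerA -exprD addnC.
transitivity (\sum_(j < n.+2) (\sum_(i < n.+2 | (i <= j)%N) c j i +
    \sum_(i < n.+2 | (j <= i)%N) c j i.+1)).
  apply: eq_bigr => j _; rewrite (bigID (fun i : 'I_n.+3 => (i <= j)%N)) /=.
  congr (_ + _).
    by rewrite big_mkcond big_ord_recr /= leqNgt ltn_ord addr0 -big_mkcond.
  rewrite big_mkcond big_ord_recl /= add0r -big_mkcond /=.
  by apply: eq_bigl => i; rewrite -ltnNge ltnS.
rewrite big_split /= [X in _ + X](exchange_big_dep predT) //= -big_split.
apply: big1 => j _; rewrite -big_split /=; apply: big1 => i hij.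
by rewrite cN ?subrr // hij /= -ltnS ltn_ord.
Qed.

Definition cotangent_cycle (n : nat) : {pred cotangent n} :=
  match n with
  | 0 => fun _ => true
  | n'.+1 => fun x => cotangent_diff x == 0
  end.

Arguments cotangent_cycle : clear implicits.

Fact cotangent_cycle_closed n : submod_closed (cotangent_cycle n).
Proof.
case: n => [|n]; split=> //.
  by rewrite unfold_in /= raddf0.
move=> a x y; rewrite !unfold_in /= => /eqP dx /eqP dy.
by rewrite [X in X == 0]linearP /= dx dy scaler0 addr0.
Qed.
HB.instance Definition _ n := GRing.isSubmodClosed.Build B (cotangent n)
  (cotangent_cycle n) (cotangent_cycle_closed n).

Definition cycle_type n : Type := {x : cotangent n | x \in cotangent_cycle n}.
HB.instance Definition _ n := SubChoice.on (cycle_type n).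
HB.instance Definition _ n :=
  [SubChoice_isSubLmodule of cycle_type n by <:].

Definition cotangent_boundary (n : nat) : {pred cycle_type n} :=
  fun x => `[< exists y, cotangent_diff y = val x >].

Arguments cotangent_boundary : clear implicits.

Fact cotangent_boundary_closed n : submod_closed (cotangent_boundary n).
Proof.
split=> [|a x y /asboolP[x' dx] /asboolP[y' dy]]; apply/asboolP.
  by exists 0; rewrite !raddf0.
by exists (a *: x' + y'); rewrite [LHS]linearP /= dx dy.
Qed.

Definition cotangent_homology (n : nat) : lmodType B :=
  quot_mod (Submodule (@cotangent_boundary_closed n)).

End Cotangent.

(* L_{(A/I)/A}[-1] is a flat A/I-module: H_1(L) is flat, and it is the only   *)
(* homology.                                                                  *)
Definition quasiregular (A : comPzRingType) (I : ideal A) : Prop :=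
  let H := cotangent_homology (quot_proj I) in
  (forall n : nat, n != 1%N -> forall x : H n, x = 0) /\ flat (H 1%N).

(* Gamma_R(M): generators m^[n] = dp n m and the usual relations. *)
Section DivPowAlg.
Variables (R : comPzRingType) (M : lmodType R).

Definition dp_rel (C : comPzRingType) (h : R -> C) (f : nat * M -> C) : Prop :=
  [/\ forall m, f (0%N, m) = 1,
      forall n a m, f (n, a *: m) = h a ^+ n * f (n, m),
      forall n m m', f (n, m + m') = \sum_(i < n.+1) f (i : nat, m) * f ((n - i)%N, m') &
      forall i j m, f (i, m) * f (j, m) = f ((i + j)%N, m) *+ 'C(i + j, i)].

Definition divpow_alg : comPzRingType := univ_alg dp_rel.

Definition dp_cst : {rmorphism R -> divpow_alg} := univ_alg_cst dp_rel.

Definition dp (n : nat) (m : M) : divpow_alg := univ_alg_gen dp_rel (n, m).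

Lemma dp_relP : dp_rel dp_cst (fun nm => dp nm.1 nm.2).
Proof.
split=> [m|n a m|n m m'|i j m] /=.
- apply: (@univ_alg_eq _ _ dp_rel (AGen _ _) (ACst _ 1)) => C h f [f0 _ _ _] /=.
  by rewrite f0 rmorph1.
- rewrite -rmorphXn.
  apply: (@univ_alg_eq _ _ dp_rel (AGen _ _) (AMul (ACst _ (a ^+ n)) (AGen _ _))).
  by move=> C h f [_ fZ _ _] /=; rewrite fZ rmorphXn.
- pose t := \big[@AAdd R (nat * M)%type/ACst _ 0]_(i < n.+1)
    AMul (AGen R (i : nat, m)) (AGen R ((n - i)%N, m')).
  have tE (C : comPzRingType) (h : {rmorphism R -> C}) f :
      alg_eval h f t = \sum_(i < n.+1) f (i : nat, m) * f ((n - i)%N, m').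
    exact: (@big_morph _ _ (alg_eval h f) 0 +%R (ACst _ 0) (@AAdd _ _)
      (fun _ _ => erefl) (rmorph0 h)).
  rewrite -(tE divpow_alg dp_cst (univ_alg_gen dp_rel)).
  apply: (@univ_alg_eq _ _ dp_rel (AGen _ _)) => C h f ff.
  by rewrite tE; case: ff => /=.
- rewrite -mulr_natl -(rmorph_nat dp_cst).
  apply: (@univ_alg_eq _ _ dp_rel (AMul (AGen _ _) (AGen _ _))
    (AMul (ACst _ _) (AGen _ _))) => C h f [_ _ _ fM] /=.
  by rewrite fM rmorph_nat mulr_natl.
Qed.

(* The degree n part: the R-span of the products of total degree n. *)
Definition dp_homog (n : nat) (u : divpow_alg) : Prop :=
  exists2 s : seq (R * seq (nat * M)),
    all (fun t => sumn [seq p.1 | p <- t.2] == n) s &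
    u = \sum_(t <- s) dp_cst t.1 * \prod_(p <- t.2) dp p.1 p.2.

End DivPowAlg.

(* The graded ring (+)_n F_n / F_(n+1) of a filtration, as the finitely       *)
(* supported sequences b with b n \in F_n for all n, with the Cauchy product, *)
(* modulo those with b n \in F_(n+1) for all n.                               *)

Record filtration (B : comPzRingType) := Filtration {
  filt :> nat -> ideal B;
  filt1 : 1 \in filt 0;
  filtM : forall m n x y, x \in filt m -> y \in filt n -> x * y \in filt (m + n)%N }.

Section CauchyRing.
Variable B : comPzRingType.

Definition cauchy : Type := nat -> B.
HB.instance Definition _ := gen_eqMixin cauchy.
HB.instance Definition _ := gen_choiceMixin cauchy.

Definition cauchy_add (f g : cauchy) : cauchy := fun n => f n + g n.
Definition cauchy_zero : cauchy := fun=> 0.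
Definition cauchy_opp (f : cauchy) : cauchy := fun n => - f n.
Definition cauchy_homog (n : nat) (b : B) : cauchy :=
  fun k => if k == n then b else 0.
Definition cauchy_mul (f g : cauchy) : cauchy :=
  fun n => \sum_(i < n.+1) f i * g (n - i)%N.

Fact cauchy_addA : associative cauchy_add.
Proof. by move=> f g k; apply/funext => n; rewrite /cauchy_add addrA. Qed.
Fact cauchy_addC : commutative cauchy_add.
Proof. by move=> f g; apply/funext => n; rewrite /cauchy_add addrC. Qed.
Fact cauchy_add0 : left_id cauchy_zero cauchy_add.
Proof.
by move=> f; apply/funext => n; rewrite /cauchy_add add0r.
Qed.
Fact cauchy_addN : left_inverse cauchy_zero cauchy_opp cauchy_add.
Proof.
by move=> f; apply/funext => n; rewrite /cauchy_add addNr.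
Qed.
HB.instance Definition _ := GRing.isZmodule.Build cauchy
  cauchy_addA cauchy_addC cauchy_add0 cauchy_addN.

Lemma cauchy_mul_rev (f g : cauchy) n :
  cauchy_mul f g n = \sum_(i < n.+1) f (n - i)%N * g i.
Proof.
rewrite /cauchy_mul (reindex_inj rev_ord_inj) /=.
by apply: eq_bigr => i _; rewrite subSS subKn // -ltnS.
Qed.
Fact cauchy_mulA : associative cauchy_mul.
Proof.
move=> p q r; apply/funext => i; rewrite [RHS]cauchy_mul_rev.
pose coef3 j k := p j * (q (i - j - k)%N * r k).
transitivity (\sum_(j < i.+1) \sum_(k < i.+1 | (k <= i - j)%N) coef3 j k).
  apply: eq_bigr => /= j _; rewrite cauchy_mul_rev big_distrr /=.
  by rewrite (big_ord_narrow_leq (leq_subr _ _)).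
rewrite (exchange_big_dep predT) //=; apply: eq_bigr => k _.
transitivity (\sum_(j < i.+1 | (j <= i - k)%N) coef3 j k).
  apply: eq_bigl => j; rewrite -ltnS -(ltnS j) -!subSn ?leq_ord //.
  by rewrite -subn_gt0 -(subn_gt0 j) -!subnDA addnC.
rewrite (big_ord_narrow_leq (leq_subr _ _)) big_distrl /=.
by apply: eq_bigr => j _; rewrite /coef3 -!subnDA addnC mulrA.
Qed.
Fact cauchy_mulC : commutative cauchy_mul.
Proof.
move=> f g; apply/funext => n; rewrite [RHS]cauchy_mul_rev.
by apply: eq_bigr => i _; rewrite mulrC.
Qed.
Fact cauchy_mul1 : left_id (cauchy_homog 0 1) cauchy_mul.
Proof.
move=> f; apply/funext => n; rewrite /cauchy_mul big_ord_recl /=.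
rewrite mul1r subn0 big1 ?addr0 // => i _.
by rewrite /cauchy_homog mul0r.
Qed.
Fact cauchy_mulD : left_distributive cauchy_mul +%R.
Proof.
move=> f g k; apply/funext => n; rewrite [RHS]/GRing.add /= /cauchy_add -big_split.
by apply: eq_bigr => i _; rewrite mulrDl.
Qed.
HB.instance Definition _ := GRing.Zmodule_isComPzRing.Build cauchy
  cauchy_mulA cauchy_mulC cauchy_mul1 cauchy_mulD.

Lemma cauchyM_homog m n a b :
  cauchy_homog m a * cauchy_homog n b = cauchy_homog (m + n)%N (a * b).
Proof.
apply/funext => k; rewrite [LHS]/(cauchy_mul _ _ _) /cauchy_homog.
case: (eqVneq k (m + n)%N) => [->|kmn]; last first.
  apply: big1 => i _; case: eqP => [im|_]; last by rewrite mul0r.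
  case: eqP => [jn|_]; last by rewrite mulr0.
  by case/eqP: kmn; rewrite -im -jn subnKC // -ltnS.
have mlt : m < (m + n).+1 by rewrite ltnS leq_addr.
rewrite (bigD1 (Ordinal mlt)) //= addKn !eqxx big1 ?addr0 // => i /negPf im.
by rewrite -val_eqE /= in im; rewrite im mul0r.
Qed.

End CauchyRing.

Section Graded.
Variables (B : comPzRingType) (F : filtration B).

Lemma filt0T x : x \in F 0.
Proof. by rewrite -[x]mulr1 idealMl ?filt1. Qed.

Lemma filtM_eq m n k x y :
  (m + n = k)%N -> x \in F m -> y \in F n -> x * y \in F k.
Proof. by move=> <-; apply: filtM. Qed.

Definition filt_seq : {pred cauchy B} := fun f =>
  `[< (exists N, forall n, N <= n -> f n = 0) /\ forall n, f n \in F n >].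

Fact filt_seq_closed : subring_closed filt_seq.
Proof.
split.
- apply/asboolP; split=> [|[|n]]; last exact: (ideal0 (F n.+1)).
    by exists 1; case.
  exact: filt1.
- move=> f g /asboolP[[N fN] fF] /asboolP[[N' gN'] gF]; apply/asboolP.
  split=> [|n]; last by apply: (@rpredB _ (ideal_pred (F n))).
  exists (maxn N N') => n; rewrite geq_max => /andP[Nn N'n].
  by transitivity (f n - g n); rewrite // fN ?gN' ?subrr.
- move=> f g /asboolP[[N fN] fF] /asboolP[[N' gN'] gF]; apply/asboolP.
  split=> [|n]; last first.
    change (\sum_(i < n.+1) f i * g (n - i)%N \in F n).
    apply: (@rpred_sum _ (ideal_pred (F n))) => i _.
    by rewrite -[X in F X](@subnKC i n); [apply: filtM|rewrite -ltnS].
  exists (N + N')%N => n Nn.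
  change (\sum_(i < n.+1) f i * g (n - i)%N = 0); apply: big1 => i _.
  have [/fN->|iN] := leqP N i; first by rewrite mul0r.
  rewrite gN' ?mulr0 // leq_subRL; last by rewrite -ltnS.
  by apply: leq_trans Nn; rewrite leq_add2r ltnW.
Qed.
HB.instance Definition _ := GRing.isSubringClosed.Build (cauchy B) filt_seq
  filt_seq_closed.

Definition filt_ring : Type := {f : cauchy B | f \in filt_seq}.
HB.instance Definition _ := SubChoice.on filt_ring.
HB.instance Definition _ := GRing.SubChoice_isSubComPzRing.Build (cauchy B)
  filt_seq filt_ring filt_seq_closed.

Definition filt_shift : {pred filt_ring} :=
  fun f => `[< forall n, val f n \in F n.+1 >].

Lemma filt_ringP (f : filt_ring) :
  (exists N, forall n, N <= n -> val f n = 0) /\ forall n, val f n \in F n.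
Proof. exact/asboolP/(valP f). Qed.

Fact filt_shift0 : 0 \in filt_shift.
Proof. by apply/asboolP => n; apply: (ideal0 (F n.+1)). Qed.
Fact filt_shiftD f g : f \in filt_shift -> g \in filt_shift ->
  f + g \in filt_shift.
Proof.
by move=> /asboolP hf /asboolP hg; apply/asboolP => n; apply: (idealD (hf n)).
Qed.
Fact filt_shiftM a f : f \in filt_shift -> a * f \in filt_shift.
Proof.
move=> /asboolP hf; apply/asboolP => n.
change (\sum_(i < n.+1) val a i * val f (n - i)%N \in F n.+1).
apply: (@rpred_sum _ (ideal_pred (F n.+1))) => i _.
apply: (@filtM_eq i (n - i).+1); [by rewrite addnS subnKC // -ltnS| |exact: hf].
by case: (filt_ringP a).
Qed.

Definition graded_ideal : ideal filt_ring :=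
  Ideal filt_shift0 filt_shiftD filt_shiftM.

Definition graded : comPzRingType := quot_ring graded_ideal.

Fact filt_seq_homog n b : b \in F n -> cauchy_homog n b \in filt_seq.
Proof.
move=> Fb; apply/asboolP; split=> [|k].
  by exists n.+1 => k nk; rewrite /cauchy_homog gtn_eqF.
by rewrite /cauchy_homog; case: eqP => [->|_] //; apply: ideal0.
Qed.

(* The class in F_n / F_(n+1) of an element of F_n. *)
Definition gr_class n b (Fb : b \in F n) : graded :=
  quot_proj graded_ideal (exist _ (cauchy_homog n b) (filt_seq_homog Fb)).

Definition gr_homog (n : nat) (u : graded) : Prop :=
  exists b (Fb : b \in F n), u = gr_class Fb.

Lemma gr_classP n a b (Fa : a \in F n) (Fb : b \in F n) :
  gr_class Fa = gr_class Fb <-> a - b \in F n.+1.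
Proof.
rewrite /gr_class quot_projP; split=> [/asboolP/(_ n)|Fab].
  have -> // : forall x y : filt_ring, val (x - y) n = val x n - val y n by [].
  by rewrite /= /cauchy_homog eqxx.
apply/asboolP => k.
have -> // : forall x y : filt_ring, val (x - y) k = val x k - val y k by [].
rewrite /= /cauchy_homog; case: eqP => [->|_] //.
by rewrite subrr; apply: (ideal0 (F k.+1)).
Qed.

Lemma gr_classD n a b (Fa : a \in F n) (Fb : b \in F n) :
  gr_class Fa + gr_class Fb = gr_class (idealD Fa Fb).
Proof.
rewrite /gr_class -raddfD; congr quot_proj; apply/val_inj/funext => k.
transitivity (cauchy_homog n a k + cauchy_homog n b k) => //.
by rewrite /= /cauchy_homog; case: eqP => // _; rewrite addr0.
Qed.

Lemma gr_class_irr n a b (Fa : a \in F n) (Fb : b \in F n) :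
  a = b -> gr_class Fa = gr_class Fb.
Proof.
by move=> ab; apply/gr_classP; rewrite ab subrr; apply: (ideal0 (F n.+1)).
Qed.

Lemma gr_class0 n (F0 : 0 \in F n) : gr_class F0 = 0.
Proof.
apply: (addrI (gr_class F0)); rewrite gr_classD [RHS]addr0.
by apply: gr_class_irr; rewrite addr0.
Qed.

Lemma gr_class_sum n (K : Type) (r : seq K) (b : K -> B)
    (Fb : forall k, b k \in F n) (Fs : \sum_(k <- r) b k \in F n) :
  \sum_(k <- r) gr_class (Fb k) = gr_class Fs.
Proof.
elim: r Fs => [|k r IHr] Fs.
  by rewrite big_nil -(gr_class0 (ideal0 (F n))); apply: gr_class_irr; rewrite big_nil.
have Fs' : \sum_(k <- r) b k \in F n by apply: (@rpred_sum _ (ideal_pred (F n))).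
by rewrite big_cons (IHr Fs') gr_classD; apply: gr_class_irr; rewrite big_cons.
Qed.

Lemma gr_classM m n a b (Fa : a \in F m) (Fb : b \in F n) :
  gr_class Fa * gr_class Fb = gr_class (filtM Fa Fb).
Proof.
rewrite /gr_class -rmorphM; congr quot_proj; apply: val_inj.
exact: cauchyM_homog.
Qed.

End Graded.

(* Divided power rings. The divided powers live on the ideal: the values of   *)
(* pd_gamma outside pd_ideal carry no information.                            *)

Record divided_powers (B : comPzRingType) (J : ideal B) (g : nat -> B -> B) :
    Prop := DividedPowers {
  divp0 : forall x, x \in J -> g 0%N x = 1;
  divp1 : forall x, x \in J -> g 1%N x = x;
  divp_in : forall n x, x \in J -> g n.+1 x \in J;
  divpD : forall n x y, x \in J -> y \in J ->
    g n (x + y) = \sum_(i < n.+1) g i x * g (n - i)%N y;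
  divpZ : forall n a x, x \in J -> g n (a * x) = a ^+ n * g n x;
  divpM : forall m n x, x \in J -> g m x * g n x = g (m + n)%N x *+ 'C(m + n, m);
  divp_comp : forall m n x, x \in J ->
    g m (g n.+1 x) =
    g (m * n.+1)%N x *+ ((m * n.+1)`! %/ (m`! * n.+1`! ^ m))%N }.

Record pdRing := PDRing {
  pd_sort :> comPzRingType;
  pd_ideal : ideal pd_sort;
  pd_gamma : nat -> pd_sort -> pd_sort;
  pd_gammaP : divided_powers pd_ideal pd_gamma }.

Arguments pd_ideal : clear implicits.
Arguments pd_gamma : clear implicits.

Definition pd_morphism (B C : pdRing) (f : B -> C) : Prop :=
  (forall x, x \in pd_ideal B -> f x \in pd_ideal C) /\
  (forall n x, x \in pd_ideal B -> f (pd_gamma B n x) = pd_gamma C n (f x)).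

(* Morphism of pairs from (A, I) to the pair underlying B. *)
Definition pair_morphism (A : comPzRingType) (I : ideal A) (B : pdRing)
    (f : A -> B) : Prop :=
  forall x, x \in I -> f x \in pd_ideal B.

(* The unit iota : (A, I) -> (B, J) is a universal arrow to the forgetful     *)
(* functor, i.e., B is the value at (A, I) of its left adjoint.               *)
Definition pd_envelope (A : comPzRingType) (I : ideal A) (B : pdRing)
    (iota : {rmorphism A -> B}) : Prop :=
  pair_morphism I iota /\
  forall (C : pdRing) (f : {rmorphism A -> C}), pair_morphism I f ->
  exists g : {rmorphism B -> C},
    [/\ pd_morphism g, forall a, g (iota a) = f a &
        forall g' : {rmorphism B -> C}, pd_morphism g' ->
          (forall a, g' (iota a) = f a) -> g' =1 g].

Section PDFiltration.
Variable B : pdRing.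
Local Notation J := (pd_ideal B).
Local Notation gamma := (pd_gamma B).

Definition pd_power_gen (n : nat) (b : B) : Prop :=
  exists s : seq (nat * B),
    [/\ all (fun p => p.2 \in J) s, n <= sumn [seq p.1 | p <- s] &
        b = \prod_(p <- s) gamma p.1 p.2].

(* J^[n] *)
Definition pd_power (n : nat) : ideal B := ideal_span (pd_power_gen n).

Lemma gamma_pd_power n x : x \in J -> gamma n x \in pd_power n.
Proof.
move=> Jx; apply: mem_ideal_span; exists [:: (n, x)].
by rewrite /= Jx addn0 big_seq1.
Qed.

Fact pd_power1 : 1 \in pd_power 0.
Proof. by apply: mem_ideal_span; exists [::]; rewrite big_nil. Qed.

Section Colon.
Variables (K : ideal B) (y : B).
Definition colon_pred : {pred B} := fun x => x * y \in K.
Fact colon0 : 0 \in colon_pred.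
Proof. by rewrite unfold_in mul0r ideal0. Qed.
Fact colonD u v : u \in colon_pred -> v \in colon_pred -> u + v \in colon_pred.
Proof. by rewrite !unfold_in mulrDl => hu hv; apply: idealD. Qed.
Fact colonM a u : u \in colon_pred -> a * u \in colon_pred.
Proof. by rewrite !unfold_in -mulrA => hu; apply: idealMl. Qed.
Definition colon : ideal B := Ideal colon0 colonD colonM.
End Colon.

Fact pd_powerM m n x y :
  x \in pd_power m -> y \in pd_power n -> x * y \in pd_power (m + n)%N.
Proof.
move=> mx ny; suff: x \in colon (pd_power (m + n)) y by [].
apply: ideal_span_min mx => {}x [s [sJ ms ->]].
suff: y \in colon (pd_power (m + n)) (\prod_(p <- s) gamma p.1 p.2).
  by rewrite !unfold_in /= /colon_pred mulrC.
apply: ideal_span_min ny => {}y [t [tJ nt ->]].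
suff: \prod_(p <- t) gamma p.1 p.2 * \prod_(p <- s) gamma p.1 p.2
  \in pd_power (m + n) by [].
apply: mem_ideal_span; exists (s ++ t); split.
- by rewrite all_cat sJ.
- by rewrite map_cat sumn_cat leq_add.
- by rewrite big_cat mulrC.
Qed.

Definition pd_filtration : filtration B := Filtration pd_power1 pd_powerM.

End PDFiltration.

(* The canonical map Gamma_{A/I}(I/I^2) -> (+)_n J^[n]/J^[n+1] attached to a  *)
(* morphism of pairs (A, I) -> (B, J).                                        *)
Section CanonicalMap.
Variables (A : comPzRingType) (I : ideal A) (B : pdRing).
Variables (iota : {rmorphism A -> B}) (IJ : pair_morphism I iota).
Local Notation J := (pd_ideal B).
Local Notation gamma := (pd_gamma B).
Local Notation F := (pd_filtration B).
Let gP := pd_gammaP B.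

Definition gr_base (a : A) : graded F := gr_class (filt0T F (iota a)).

Definition gr_gamma (n : nat) (x : ideal_elt I) : graded F :=
  gr_class (gamma_pd_power n (IJ (valP x)) : gamma n (iota (val x)) \in F n).

Fact gr_base_zmod : zmod_morphism gr_base.
Proof.
move=> a b; apply/eqP; rewrite eq_sym subr_eq; apply/eqP.
rewrite /gr_base gr_classD; apply/gr_classP.
by rewrite rmorphB subrK subrr; apply: ideal0.
Qed.
HB.instance Definition _ := GRing.isZmodMorphism.Build A (graded F) gr_base
  gr_base_zmod.
Fact gr_base_monoid : monoid_morphism gr_base.
Proof.
split=> [|a b].
  rewrite /gr_base /gr_class -[RHS](rmorph1 (quot_proj _)); congr quot_proj.
  by apply: val_inj; rewrite /= rmorph1.
rewrite /gr_base gr_classM; apply/gr_classP.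
by rewrite rmorphM subrr; apply: ideal0.
Qed.
HB.instance Definition _ := GRing.isMonoidMorphism.Build A (graded F) gr_base
  gr_base_monoid.

Lemma iota_pd_power1 x : x \in I -> iota x \in F 1.
Proof. by move=> /IJ Jx; rewrite -(divp1 gP Jx); apply: gamma_pd_power. Qed.

(* Elements z of A with iota z in J and gamma_n (iota z) in J^[n+1], n >= 1. *)
Definition small_pred : {pred A} := fun z =>
  (iota z \in J) && `[< forall n, gamma n.+1 (iota z) \in F n.+2 >].

Fact small0 : 0 \in small_pred.
Proof.
rewrite unfold_in rmorph0 ideal0 /=; apply/asboolP => n.
rewrite -[X in gamma _ X](mul0r 0) (divpZ gP); last exact: ideal0.
by rewrite expr0n mul0r; apply: (ideal0 (F n.+2)).
Qed.
Lemma gamma_add_small n x z : x \in J -> z \in small_pred ->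
  gamma n (x + iota z) - gamma n x \in F n.+1.
Proof.
move=> Jx /andP[Jz /asboolP hz]; rewrite (divpD gP) // big_ord_recr /= subnn.
rewrite (divp0 gP) // mulr1 addrK.
apply: (@rpred_sum _ (ideal_pred (F n.+1))) => i _.
have ni : (n - i = (n - i).-1.+1)%N by rewrite prednK // subn_gt0.
rewrite ni; apply: (@filtM_eq _ F i (n - i).-1.+2); last exact: hz.
  by rewrite -ni addnS subnKC // ltnW.
exact: gamma_pd_power.
Qed.
Fact smallD x y : x \in small_pred -> y \in small_pred -> x + y \in small_pred.
Proof.
move=> sx sy; have /andP[Jx /asboolP hx] := sx; have /andP[Jy _] := sy.
rewrite unfold_in /small_pred rmorphD idealD //=; apply/asboolP => n.
rewrite -[X in X \in _](subrK (gamma n.+1 (iota x))); apply: idealD (hx n).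
exact: gamma_add_small.
Qed.
Fact smallM a x : x \in small_pred -> a * x \in small_pred.
Proof.
move=> /andP[Jx /asboolP hx]; rewrite unfold_in /small_pred rmorphM idealMl //=.
apply/asboolP => n; rewrite (divpZ gP) //.
exact: (@idealMl _ (F n.+2)).
Qed.
Definition small : ideal A := Ideal small0 smallD smallM.

Lemma ideal_sqr_small z : z \in ideal_sqr I -> z \in small_pred.
Proof.
move=> Iz; suff: z \in small by [].
apply: ideal_span_min Iz => {}z [x [y [Ix Iy ->]]].
suff: x * y \in small_pred by [].
rewrite unfold_in /small_pred rmorphM idealMl ?IJ //=; apply/asboolP => n.
rewrite (divpZ gP) ?IJ // exprS -mulrA.
apply: (@filtM_eq _ F 1 n.+1) => //; first exact: iota_pd_power1.
by apply: (@idealMl _ (F n.+1)); apply: gamma_pd_power; apply: IJ.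
Qed.

Lemma gr_gamma_class n x y :
  conormal_class x = conormal_class y -> gr_gamma n x = gr_gamma n y.
Proof.
move=> /conormal_classP /ideal_sqr_small sxy; apply/gr_classP.
have -> : iota (val x) = iota (val y) + iota (val x - val y).
  by rewrite rmorphB addrC subrK.
by apply: gamma_add_small => //; apply/IJ/valP.
Qed.

Fact gr_base_ideal a b :
  quot_proj I a = quot_proj I b -> gr_base a = gr_base b.
Proof.
move=> /quot_projP Iab; apply/gr_classP.
by rewrite -rmorphB iota_pd_power1.
Qed.

(* Degree 0: A/I -> B/J^[1] *)
Definition gr_scalar (r : quot_ring I) : graded F := gr_base (repr r).

Lemma gr_scalarE a : gr_scalar (quot_proj I a) = gr_base a.
Proof. by apply: gr_base_ideal; rewrite /quot_proj reprK. Qed.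

Fact gr_scalar_zmod : zmod_morphism gr_scalar.
Proof.
move=> r s; have [a ->] := quot_proj_surj r; have [b ->] := quot_proj_surj s.
by rewrite -raddfB !gr_scalarE raddfB.
Qed.
HB.instance Definition _ := GRing.isZmodMorphism.Build (quot_ring I) (graded F)
  gr_scalar gr_scalar_zmod.
Fact gr_scalar_monoid : monoid_morphism gr_scalar.
Proof.
split=> [|r s].
  by rewrite -(rmorph1 (quot_proj I)) gr_scalarE rmorph1.
have [a ->] := quot_proj_surj r; have [b ->] := quot_proj_surj s.
by rewrite -rmorphM !gr_scalarE rmorphM.
Qed.
HB.instance Definition _ := GRing.isMonoidMorphism.Build (quot_ring I) (graded F)
  gr_scalar gr_scalar_monoid.

Definition gr_divpow (nm : nat * conormal I) : graded F :=
  gr_gamma nm.1 (repr nm.2).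

Lemma gr_divpowE n x : gr_divpow (n, conormal_class x) = gr_gamma n x.
Proof. by apply: gr_gamma_class; rewrite /conormal_class reprK. Qed.

Fact gr_divpow_rel : dp_rel gr_scalar gr_divpow.
Proof.
split=> [m|n a m|n m m'|i j m].
- have [x ->] := conormal_class_surj m; rewrite gr_divpowE -(rmorph1 gr_base).
  by apply: gr_class_irr; rewrite (divp0 gP) ?rmorph1 //; apply/IJ/valP.
- have [x ->] := conormal_class_surj m; have [b ->] := quot_proj_surj a.
  rewrite [_ *: _]conormal_scaleE !gr_divpowE gr_scalarE -rmorphXn.
  rewrite [RHS]gr_classM; apply: gr_class_irr.
  by rewrite rmorphM (divpZ gP) ?rmorphXn //; apply/IJ/valP.
- have [x ->] := conormal_class_surj m; have [y ->] := conormal_class_surj m'.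
  rewrite -raddfD gr_divpowE.
  have Fi (i : 'I_n.+1) :
      gamma i (iota (val x)) * gamma (n - i)%N (iota (val y)) \in F n.
    by apply: (@filtM_eq _ F i (n - i)%N); first (by rewrite subnKC // -ltnS);
      exact/gamma_pd_power/IJ/valP.
  rewrite (eq_bigr (fun i => gr_class (Fi i))) => [|i _]; last first.
    rewrite !gr_divpowE [LHS]gr_classM.
    have iE : (i + (n - i) = n)%N by rewrite subnKC // -ltnS.
    by move: (filtM _ _) (Fi i); rewrite iE => F1 F2; apply: gr_class_irr.
  have Fs : \sum_(i < n.+1) gamma i (iota (val x)) * gamma (n - i)%N (iota (val y))
    \in F n by apply: (@rpred_sum _ (ideal_pred (F n))).
  rewrite (gr_class_sum _ Fs); apply: gr_class_irr.
  by rewrite rmorphD (divpD gP) //; apply/IJ/valP.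
- have [x ->] := conormal_class_surj m; rewrite !gr_divpowE [LHS]gr_classM.
  have Fx : gamma (i + j)%N (iota (val x)) \in F (i + j)%N.
    exact/gamma_pd_power/IJ/valP.
  rewrite [RHS](_ : _ = \sum_(k < 'C(i + j, i)) gr_class Fx); last first.
    by rewrite sumr_const card_ord; congr (_ *+ _); apply: gr_class_irr.
  have Fs : \sum_(k < 'C(i + j, i)) gamma (i + j)%N (iota (val x)) \in F (i + j)%N.
    exact: (@rpred_sum _ (ideal_pred (F (i + j)%N))).
  rewrite (gr_class_sum (fun=> Fx) Fs); apply: gr_class_irr.
  by rewrite sumr_const card_ord (divpM gP) //; apply/IJ/valP.
Qed.

Definition canonical_map : {rmorphism divpow_alg (conormal I) -> graded F} :=
  univ_alg_lift gr_divpow_rel.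

Lemma canonical_map_cst a :
  canonical_map (dp_cst (conormal I) (quot_proj I a)) = gr_base a.
Proof. by rewrite -gr_scalarE; apply: univ_alg_lift_cst. Qed.

Lemma canonical_map_dp n x :
  canonical_map (dp n (conormal_class x)) = gr_gamma n x.
Proof. by rewrite -gr_divpowE; apply: univ_alg_liftE. Qed.


End CanonicalMap.

(* Main.v *)
(** Let F be the free A-module on the elements of I, phi : F -> I the evaluation,
    U = ker phi and G = Gamma_A(F). The envelope is B = G/K, where K is generated by
    the q_f = f^[1] - phi f and the u^[m] for u in U, m > 0. To see that G and G/K are
    divided power rings, embed G in the shuffle algebra of functions on words, whose
    divided powers are determined by D_x gamma_(n+1)(f) = gamma_n(f) D_x f for the
    derivations D_x f = f (x :: _); the embedding also shows that G is free on monomials.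

    The theorem then says that an element of K of degree >= n is a combination of q_f's
    with coefficients of degree >= n and of u^[m]'s with coefficients of degree >= n - m.
    One passes from degree k to degree k + 1 using two consequences of quasiregularity.
    As H_1(L) = I/I^2 is flat, for finitely many u in U there is an endomorphism eta of F
    with phi eta = phi and eta u in U /\ IF; as H_2(L) = 0, U /\ IF is spanned by the
    phi(x) y - phi(y) x = x q_y - y q_x. For s in the ideal of the u^[m]
    and a suitable eta, Gamma(eta) s is a combination of q_f's; if moreover the leading
    term of s is divisible by I, then s - Gamma(eta) s has leading term in I times that
    ideal. *)

Require Import Defs.
From HB Require Import structures.
From mathcomp Require Import all_boot ssralg ssrAC.
From mathcomp Require Import boolp.
From mathcomp Require Import ring zify.

Set Implicit Arguments.
Unset Strict Implicit.
Unset Printing Implicit Defensive.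

Import GRing.Theory.
Local Open Scope ring_scope.

(** * Shuffle algebras *)

(** Surjectivity is easy; injectivity says that an element of Gamma(I/I^2) of degree n vanishes as
    soon as its image lies in J^[n+1]. Gamma(I/I^2) and B are both quotients of G, and J^[n] is the
    image of the elements of degree >= n. The danger is K: its generators q_f mix the degrees 0 and
    1, so that a combination of them may cancel in low degrees and leave an unexpected element of
    degree n. The bound on the coefficients excludes this: q_f maps to the degree 1 class of phi f
    in Gamma(I/I^2), because phi f lies in I, and u^[m] maps to 0, so an element of K of degree >= n
    maps to degree >= n + 1. The induction on the degree rests on the identity phi(f) s = f^[1] s -
    s q_f: modulo the q's, a coefficient in I can be traded for one more degree. This is what makes
    a leading term in I times the ideal of the u^[m] harmless. Flatness enters as the equational
    criterion over A/I, applied to the relation phi u = 0; it handles finitely many u, and one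
    expression of one element involves no more. *)

Section Shuffle.
Variables (A : comPzRingType) (X : Type).

Definition shuffle : Type := seq X -> A.
HB.instance Definition _ := gen_eqMixin shuffle.
HB.instance Definition _ := gen_choiceMixin shuffle.

Implicit Types (f g h : shuffle) (x : X) (w : seq X).

Definition shuffle_der x f : shuffle := fun w => f (x :: w).
Definition shuffle_add f g : shuffle := fun w => f w + g w.
Definition shuffle_zero : shuffle := fun=> 0.
Definition shuffle_opp f : shuffle := fun w => - f w.
Definition shuffle_cst (a : A) : shuffle := fun w => if w is [::] then a else 0.
(** The Leibniz rule for the derivations [shuffle_der x], read as a recursion on the word. It yields
    the shuffle product, and [shuffle_derM] holds by computation. *)
Fixpoint shuffle_eval w f g : A :=
  if w is x :: w' then
    shuffle_eval w' (shuffle_der x f) g + shuffle_eval w' f (shuffle_der x g)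
  else f [::] * g [::].
Definition shuffle_mul f g : shuffle := fun w => shuffle_eval w f g.

Fact shuffle_addA : associative shuffle_add.
Proof. by move=> f g h; apply/funext => w; rewrite /shuffle_add addrA. Qed.
Fact shuffle_addC : commutative shuffle_add.
Proof. by move=> f g; apply/funext => w; rewrite /shuffle_add addrC. Qed.
Fact shuffle_add0 : left_id shuffle_zero shuffle_add.
Proof. by move=> f; apply/funext => w; rewrite /shuffle_add add0r. Qed.
Fact shuffle_addN : left_inverse shuffle_zero shuffle_opp shuffle_add.
Proof. by move=> f; apply/funext => w; rewrite /shuffle_add addNr. Qed.
HB.instance Definition _ := GRing.isZmodule.Build shuffle
  shuffle_addA shuffle_addC shuffle_add0 shuffle_addN.

Fact shuffle_der_zmod x : zmod_morphism (shuffle_der x).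
Proof. by []. Qed.
HB.instance Definition _ x := GRing.isZmodMorphism.Build shuffle shuffle
  (shuffle_der x) (shuffle_der_zmod x).

Fact shuffle_mulC : commutative shuffle_mul.
Proof.
move=> f g; apply/funext => w; rewrite /shuffle_mul.
elim: w f g => [|x w IHw] f g /=; first by rewrite mulrC.
by rewrite addrC IHw [X in _ + X]IHw.
Qed.

Fact shuffle_mulD : left_distributive shuffle_mul +%R.
Proof.
move=> f g h; apply/funext => w.
change (shuffle_eval w (f + g) h = shuffle_eval w f h + shuffle_eval w g h).
elim: w f g h => [|x w IHw] f g h /=; first by rewrite -mulrDl.
by rewrite raddfD !IHw /= addrACA.
Qed.

Fact shuffle_mulA : associative shuffle_mul.
Proof.
move=> f g h; apply/funext => w.
have distr := shuffle_mulD.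
elim: w f g h => [|x w IHw] f g h; first by rewrite /shuffle_mul /= mulrA.
have dM u v : shuffle_der x (shuffle_mul u v) =
  shuffle_mul (shuffle_der x u) v + shuffle_mul u (shuffle_der x v) by [].
have step u v : shuffle_mul u v (x :: w) =
  shuffle_mul (shuffle_der x u) v w + shuffle_mul u (shuffle_der x v) w by [].
have addE u v : (u + v : shuffle) w = u w + v w by [].
rewrite !step !dM distr [X in _ + X w]shuffle_mulC distr !addE.
by rewrite -![shuffle_mul (shuffle_mul _ _) f]shuffle_mulC !IHw addrA.
Qed.

Lemma shuffle_cstM a f w : shuffle_mul (shuffle_cst a) f w = a * f w.
Proof.
have der0 x c : shuffle_der x (shuffle_cst c) = shuffle_cst 0.
  by apply/funext; case.
elim: w a f => [|x w IHw] a f //.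
have -> : shuffle_mul (shuffle_cst a) f (x :: w) =
    shuffle_mul (shuffle_der x (shuffle_cst a)) f w +
    shuffle_mul (shuffle_cst a) (shuffle_der x f) w by [].
by rewrite der0 !IHw mul0r add0r.
Qed.

Fact shuffle_mul1 : left_id (shuffle_cst 1) shuffle_mul.
Proof. by move=> f; apply/funext => w; rewrite shuffle_cstM mul1r. Qed.
HB.instance Definition _ := GRing.Zmodule_isComPzRing.Build shuffle
  shuffle_mulA shuffle_mulC shuffle_mul1 shuffle_mulD.

Lemma shuffle_derM x f g :
  shuffle_der x (f * g) = shuffle_der x f * g + f * shuffle_der x g.
Proof. by []. Qed.

Lemma shuffle_der1 x : shuffle_der x 1 = 0.
Proof. by []. Qed.

Definition shuffle_const (f : shuffle) : A := f [::].
Fact shuffle_const_zmod : zmod_morphism shuffle_const.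
Proof. by []. Qed.
HB.instance Definition _ := GRing.isZmodMorphism.Build shuffle A shuffle_const
  shuffle_const_zmod.
Fact shuffle_const_monoid : monoid_morphism shuffle_const.
Proof. by []. Qed.
HB.instance Definition _ := GRing.isMonoidMorphism.Build shuffle A shuffle_const
  shuffle_const_monoid.

Definition shuffle_aug_pred : {pred shuffle} := fun f => shuffle_const f == 0.
Fact shuffle_aug0 : 0 \in shuffle_aug_pred.
Proof. exact: eqxx. Qed.
Fact shuffle_augD f g : f \in shuffle_aug_pred -> g \in shuffle_aug_pred ->
  f + g \in shuffle_aug_pred.
Proof.
move=> /eqP f0 /eqP g0; change (shuffle_const (f + g) == 0).
by rewrite raddfD /= f0 g0 addr0.
Qed.
Fact shuffle_augM f g : g \in shuffle_aug_pred -> f * g \in shuffle_aug_pred.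
Proof.
move=> /eqP g0; change (shuffle_const (f * g) == 0).
by rewrite rmorphM /= g0 mulr0.
Qed.
Definition shuffle_aug : ideal shuffle :=
  Ideal shuffle_aug0 shuffle_augD shuffle_augM.

(** Only the derivatives of [f] enter, so the constant term of [f] has no influence. Hence the rules
    for products and sums hold for all [f], while [shuffle_gamma1], [shuffle_gammaZ] and
    [shuffle_gamma_comp] ask for constant term 0. *)
Fixpoint shuffle_gamma (n : nat) f : shuffle :=
  if n is n'.+1 then
    fun w => if w is x :: w' then (shuffle_gamma n' f * shuffle_der x f) w' else 0
  else 1.

Arguments shuffle_gamma : simpl never.

Lemma shuffle_constM f g :
  shuffle_const (f * g) = shuffle_const f * shuffle_const g.
Proof. exact: rmorphM. Qed.

Lemma shuffle_constMn f n : shuffle_const (f *+ n) = shuffle_const f *+ n.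
Proof. exact: raddfMn. Qed.

Lemma shuffle_derMn x f n : shuffle_der x (f *+ n) = shuffle_der x f *+ n.
Proof. exact: raddfMn. Qed.

Lemma shuffle_gammaS0 n f : shuffle_const (shuffle_gamma n.+1 f) = 0.
Proof. by []. Qed.

Lemma shuffle_der_gamma n x f :
  shuffle_der x (shuffle_gamma n.+1 f) = shuffle_gamma n f * shuffle_der x f.
Proof. by []. Qed.

(** In any characteristic a function with zero derivatives is constant. The identities between
    divided powers below are proved by comparing constant terms and derivatives, by induction on the
    degree. *)
Lemma shuffle_constP f g : shuffle_const f = shuffle_const g ->
  (forall x, shuffle_der x f = shuffle_der x g) -> f = g.
Proof.
move=> fg0 fgd; apply/funext => -[|x w] //.
exact: (congr1 (fun h : shuffle => h w) (fgd x)).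
Qed.

Lemma shuffle_gamma1 f : f \in shuffle_aug -> shuffle_gamma 1 f = f.
Proof.
move=> /eqP f0; apply: shuffle_constP => [|x]; first by rewrite f0.
by rewrite shuffle_der_gamma mul1r.
Qed.

Lemma shuffle_gammaM m n f : shuffle_gamma m f * shuffle_gamma n f =
  shuffle_gamma (m + n)%N f *+ 'C(m + n, m)%N.
Proof.
elim: m n => [|m IHm] n; first by rewrite mul1r bin0.
elim: n => [|n IHn]; first by rewrite addn0 mulr1 binn.
apply: shuffle_constP => [|x].
  by rewrite shuffle_constM shuffle_constMn addnS !shuffle_gammaS0 mul0r mul0rn.
rewrite shuffle_derM shuffle_derMn [in RHS]addSn !shuffle_der_gamma.
have -> : shuffle_gamma m f * shuffle_der x f * shuffle_gamma n.+1 f =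
  shuffle_gamma m f * shuffle_gamma n.+1 f * shuffle_der x f by rewrite mulrAC.
rewrite [X in _ + X]mulrA IHm IHn -mulrDl -mulrnAl; congr (_ * _).
by rewrite addSnnS -mulrnDr binS; congr (_ *+ _); apply: addnC.
Qed.

Lemma shuffle_gammaD n f g : shuffle_gamma n (f + g) =
  \sum_(i < n.+1) shuffle_gamma i f * shuffle_gamma (n - i)%N g.
Proof.
elim: n => [|n IHn]; first by rewrite big_ord1 mulr1.
apply: shuffle_constP => [|x].
  rewrite shuffle_gammaS0 raddf_sum big1 //= => -[[|i] hi] _.
    by rewrite shuffle_constM subn0 shuffle_gammaS0 mulr0.
  by rewrite shuffle_constM shuffle_gammaS0 mul0r.
rewrite shuffle_der_gamma IHn raddfD mulrDr raddf_sum.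
rewrite (eq_bigr (fun i : 'I_n.+2 =>
  shuffle_der x (shuffle_gamma i f) * shuffle_gamma (n.+1 - i)%N g +
  shuffle_gamma i f * shuffle_der x (shuffle_gamma (n.+1 - i)%N g))) //.
rewrite big_split /=; congr (_ + _).
  rewrite [RHS]big_ord_recl (_ : shuffle_der x (shuffle_gamma _ f) = 0) //.
  rewrite mul0r add0r mulr_suml; apply: eq_bigr => i _.
  by rewrite shuffle_der_gamma subSS mulrAC.
rewrite [RHS]big_ord_recr /= subnn (_ : shuffle_der x (shuffle_gamma 0 g) = 0) //.
rewrite mulr0 addr0 mulr_suml; apply: eq_bigr => i _.
by rewrite subSn -1?ltnS // shuffle_der_gamma mulrA.
Qed.

Lemma shuffle_gammaZ n a f : f \in shuffle_aug ->
  shuffle_gamma n (a * f) = a ^+ n * shuffle_gamma n f.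
Proof.
move=> f0; have g1 := shuffle_gamma1 f0.
elim: n => [|n IHn]; first by rewrite mul1r.
apply: shuffle_constP => [|x].
  by rewrite shuffle_constM !shuffle_gammaS0 mulr0.
have derX m : shuffle_der x (a ^+ m.+1) = a ^+ m * shuffle_der x a *+ m.+1.
  elim: m => [|m IHm]; first by rewrite expr1 mul1r.
  rewrite exprS shuffle_derM IHm mulrnAr mulrA -exprS mulrC.
  by rewrite [RHS]mulrS.
rewrite shuffle_derM !shuffle_der_gamma IHn shuffle_derM derX.
(* This absorbs the factor n + 1 that comes from the derivative of [a ^+ n.+1]. *)
have fg : shuffle_gamma n.+1 f *+ n.+1 = f * shuffle_gamma n f.
  by rewrite -[X in _ = X * _]g1 shuffle_gammaM add1n bin1.
rewrite mulrDr mulrnAl -mulrnAr fg; congr (_ + _).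
  by rewrite -!mulrA; congr (_ * _); rewrite mulrCA [f * _]mulrC.
by rewrite exprSr -!mulrA; congr (_ * _); rewrite mulrCA.
Qed.

End Shuffle.

(** The recursion in m of the constant in [divp_comp]. The derivative of gamma_(m+1)(gamma_(n+1) f)
    contains the product of gamma_(m(n+1)) f and gamma_n f, which contributes the binomial
    coefficient. *)
Lemma fact_comp_div m n :
  ((m.+1 * n.+1)`! %/ (m.+1`! * n.+1`! ^ m.+1) =
  (m * n.+1)`! %/ (m`! * n.+1`! ^ m) * 'C(m * n.+1 + n, m * n.+1))%N.
Proof.
(* The quotients are truncated, so divisibility has to be carried along: the factorization at k.+1
   both proves it there and gives the recursion. *)
suff dvd k : (k`! * n.+1`! ^ k %| (k * n.+1)`!)%N ->
    (k.+1 * n.+1)`! = ((k * n.+1)`! %/ (k`! * n.+1`! ^ k) *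
      'C(k * n.+1 + n, k * n.+1) * (k.+1`! * n.+1`! ^ k.+1))%N.
  have dv : (m`! * n.+1`! ^ m %| (m * n.+1)`!)%N.
    elim: m => [|m IHm]; first by [].
    by rewrite (dvd m IHm) dvdn_mull.
  by rewrite (dvd m dv) mulnK // muln_gt0 expn_gt0 !fact_gt0.
move=> dk; set q := (_ %/ _)%N.
have qE : (k * n.+1)`! = (q * (k`! * n.+1`! ^ k))%N by rewrite divnK.
have := @bin_fact (k * n.+1 + n) (k * n.+1) (leq_addr _ _).
rewrite addKn => bE.
rewrite mulSnr addnS factS -bE qE -addnS -mulSnr (factS k) expnS (factS n).
move: ('C(_, _)) => b.
by rewrite -!mulnA; ring.
Qed.

Section ShufflePD.
Variables (A : comPzRingType) (X : Type).

Lemma shuffle_gamma_comp m n (f : shuffle A X) : f \in shuffle_aug A X ->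
  shuffle_gamma m (shuffle_gamma n.+1 f) =
  shuffle_gamma (m * n.+1)%N f *+ ((m * n.+1)`! %/ (m`! * n.+1`! ^ m))%N.
Proof.
move=> f0; elim: m => [|m IHm]; first by [].
rewrite fact_comp_div; apply: shuffle_constP => [|x].
  by rewrite shuffle_constMn mul0rn.
rewrite shuffle_derMn mulSnr addnS !shuffle_der_gamma IHm mulrA.
rewrite [_ *+ _ * _]mulrnAl shuffle_gammaM -mulrnA mulrnAl. congr (_ *+ _); exact: mulnC.
Qed.

Lemma shuffle_divided_powers :
  divided_powers (shuffle_aug A X) (@shuffle_gamma A X).
Proof.
split=> //; first exact: shuffle_gamma1.
- by move=> n x _; apply/eqP.
- by move=> n x y _ _; apply: shuffle_gammaD.
- by move=> n a x; apply: shuffle_gammaZ.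
- by move=> m n x _; apply: shuffle_gammaM.
- by move=> m n x; apply: shuffle_gamma_comp.
Qed.

Definition shuffle_pd : pdRing := PDRing shuffle_divided_powers.

End ShufflePD.

(** * Constructions of divided power rings *)

Lemma ideal_sum (R : comPzRingType) (K : ideal R) (T : Type) (r : seq T)
    (P : pred T) (f : T -> R) :
  (forall i, P i -> f i \in K) -> \sum_(i <- r | P i) f i \in K.
Proof. exact: (@rpred_sum _ (ideal_pred K)). Qed.

Lemma idealB (R : comPzRingType) (K : ideal R) x y :
  x \in K -> y \in K -> x - y \in K.
Proof. exact: (@rpredB _ (ideal_pred K)). Qed.

Lemma quot_proj0 (R : comPzRingType) (K : ideal R) x :
  quot_proj K x = 0 <-> x \in K.
Proof. by rewrite -(raddf0 (quot_proj K)) quot_projP subr0. Qed.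

Section PreimageIdeal.
Variables (R S : comPzRingType) (f : {rmorphism R -> S}) (K : ideal S).
Definition preim_pred : {pred R} := fun x => f x \in K.
Fact preim0 : 0 \in preim_pred.
Proof. by rewrite unfold_in rmorph0 ideal0. Qed.
Fact preimD x y : x \in preim_pred -> y \in preim_pred -> x + y \in preim_pred.
Proof. by rewrite !unfold_in rmorphD => fx fy; apply: idealD. Qed.
Fact preimM a x : x \in preim_pred -> a * x \in preim_pred.
Proof. by rewrite !unfold_in rmorphM => fx; apply: idealMl. Qed.
Definition preim_ideal : ideal R := Ideal preim0 preimD preimM.
End PreimageIdeal.

Section PDTheory.
Variable B : pdRing.
Local Notation J := (pd_ideal B).
Local Notation gamma := (pd_gamma B).
Let gP := pd_gammaP B.

Lemma pd_gamma0 n : gamma n.+1 0 = 0.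
Proof.
by rewrite -{1}(mulr0 0) (divpZ gP) ?ideal0 // expr0n mul0r.
Qed.

Section GradedClosure.
Variable T : nat -> ideal B.
Hypothesis TM : forall m n x y, x \in T m.+1 -> y \in T n.+1 ->
  x * y \in T (m.+1 + n.+1)%N.

(** This is an ideal, so membership of all divided powers in [T] can be checked on generators. It
    serves for the graded family [rel_span] and for the constant family [env_ideal]. [TM] concerns
    positive degrees because the two extreme terms of [divpD] have a factor gamma_0 = 1 and are
    treated apart. *)
Definition pd_closed_pred : {pred B} := fun z =>
  (z \in J) && `[< forall m, gamma m.+1 z \in T m.+1 >].

Fact pd_closed0 : 0 \in pd_closed_pred.
Proof.
rewrite unfold_in ideal0; apply/asboolP => m.
by rewrite pd_gamma0 ideal0.
Qed.
Fact pd_closedD x y : x \in pd_closed_pred -> y \in pd_closed_pred ->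
  x + y \in pd_closed_pred.
Proof.
move=> /andP[Jx /asboolP hx] /andP[Jy /asboolP hy].
rewrite unfold_in idealD //=; apply/asboolP => m.
rewrite (divpD gP) //; apply: ideal_sum => -[i /= him] _.
case: i him => [|i] him; first by rewrite subn0 (divp0 gP) // mul1r.
have [->|im] := eqVneq i m; first by rewrite subnn (divp0 gP) // mulr1.
have him' : (i < m)%N by rewrite ltn_neqAle im.
have [k mE] : exists k, m = (i + k.+1)%N.
  by exists (m - i).-1; rewrite prednK ?subn_gt0 // subnKC // ltnW.
by rewrite mE subSS addKn -addSn; apply: TM.
Qed.
Fact pd_closedM a x : x \in pd_closed_pred -> a * x \in pd_closed_pred.
Proof.
move=> /andP[Jx /asboolP hx]; rewrite unfold_in idealMl //=.
by apply/asboolP => m; rewrite (divpZ gP) // idealMl.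
Qed.
Definition pd_closed : ideal B := Ideal pd_closed0 pd_closedD pd_closedM.
End GradedClosure.
End PDTheory.

Section PDMorphismClosure.
Variables (B C : pdRing) (f : {rmorphism B -> C}).

Definition pd_compat_pred : {pred B} := fun z =>
  [&& z \in pd_ideal B, f z \in pd_ideal C &
   `[< forall n, f (pd_gamma B n z) = pd_gamma C n (f z) >]].
Let gB := pd_gammaP B.
Let gC := pd_gammaP C.

Fact pd_compat0 : 0 \in pd_compat_pred.
Proof.
rewrite unfold_in /pd_compat_pred rmorph0 !ideal0; apply/asboolP => -[|n].
  by rewrite (divp0 gB) ?(divp0 gC) ?rmorph1 // ideal0.
by rewrite !pd_gamma0 rmorph0.
Qed.
Fact pd_compatD x y : x \in pd_compat_pred -> y \in pd_compat_pred ->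
  x + y \in pd_compat_pred.
Proof.
move=> /and3P[Jx Kx /asboolP hx] /and3P[Jy Ky /asboolP hy].
rewrite unfold_in /pd_compat_pred rmorphD !idealD //; apply/asboolP => n.
rewrite (divpD gB) // (divpD gC) // rmorph_sum; apply: eq_bigr => i _.
by rewrite rmorphM hx hy.
Qed.
Fact pd_compatM a x : x \in pd_compat_pred -> a * x \in pd_compat_pred.
Proof.
move=> /and3P[Jx Kx /asboolP hx].
rewrite unfold_in /pd_compat_pred rmorphM !idealMl //; apply/asboolP => n.
by rewrite (divpZ gB) // (divpZ gC) // rmorphM rmorphXn hx.
Qed.
Definition pd_compat : ideal B := Ideal pd_compat0 pd_compatD pd_compatM.

Lemma pd_compat_morphism :
  (forall z, z \in pd_ideal B -> z \in pd_compat) -> pd_morphism f.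
Proof.
move=> h; split=> [x /h|n x /h] /and3P[_ fx /asboolP] //; exact.
Qed.
End PDMorphismClosure.

Section PDTransport.
Variables (S : pdRing) (G : comPzRingType) (j : {rmorphism G -> S}).
Hypothesis j_inj : injective j.
Hypothesis j_gamma : forall n g, j g \in pd_ideal S ->
  exists g', j g' = pd_gamma S n (j g).
Let gP := pd_gammaP S.

Definition transport_ideal : ideal G := preim_ideal j (pd_ideal S).

Definition transport_gamma (n : nat) (g : G) : G :=
  if pselect (exists g', j g' = pd_gamma S n (j g)) is left e
  then projT1 (cid e) else 0.

Lemma transport_gammaE n g : g \in transport_ideal ->
  j (transport_gamma n g) = pd_gamma S n (j g).
Proof.
move=> /(j_gamma n) e; rewrite /transport_gamma.
by case: pselect => // e'; case: (cid e').
Qed.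

Lemma transport_divided_powers : divided_powers transport_ideal transport_gamma.
Proof.
have gE := transport_gammaE.
have Jj x : x \in transport_ideal -> j x \in pd_ideal S by [].
have Jg n x : x \in transport_ideal -> transport_gamma n.+1 x \in transport_ideal.
  move=> Jx; suff: j (transport_gamma n.+1 x) \in pd_ideal S by [].
  by rewrite gE // (divp_in gP).
split=> [x Jx|x Jx|//|n x y Jx Jy|n a x Jx|m n x Jx|m n x Jx]; apply: j_inj.
- by rewrite gE // (divp0 gP) ?rmorph1.
- by rewrite gE // (divp1 gP).
- rewrite gE ?idealD // rmorphD (divpD gP) // rmorph_sum.
  by apply: eq_bigr => i _; rewrite rmorphM !gE.
- by rewrite gE ?idealMl // !rmorphM rmorphXn (divpZ gP) // gE.
- by rewrite rmorphM rmorphMn /= !gE // (divpM gP).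
- by rewrite gE ?Jg // rmorphMn /= !gE // (divp_comp gP).
Qed.

Definition transport_pd : pdRing := PDRing transport_divided_powers.
End PDTransport.

Section PDQuotient.
Variables (B : pdRing) (K : ideal B).
Local Notation J := (pd_ideal B).
Local Notation gamma := (pd_gamma B).
Let gP := pd_gammaP B.
(** [K] is not assumed to lie in [J]: the ideal of the envelope contains the q_f, whose constant
    term is - phi f. *)
Hypothesis K_gamma : forall n z, z \in K -> z \in J -> gamma n.+1 z \in K.

Definition quot_pd_pred : {pred quot_ring K} := fun c =>
  `[< exists2 y, y \in J & c = quot_proj K y >].
Fact quot_pd0 : 0 \in quot_pd_pred.
Proof. by apply/asboolP; exists 0; rewrite ?ideal0 ?raddf0. Qed.
Fact quot_pdD x y : x \in quot_pd_pred -> y \in quot_pd_pred ->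
  x + y \in quot_pd_pred.
Proof.
move=> /asboolP[x' Jx ->] /asboolP[y' Jy ->]; apply/asboolP.
by exists (x' + y'); rewrite ?idealD ?raddfD.
Qed.
Fact quot_pdM a x : x \in quot_pd_pred -> a * x \in quot_pd_pred.
Proof.
move=> /asboolP[x' Jx ->]; have [a' ->] := quot_proj_surj a; apply/asboolP.
by exists (a' * x'); rewrite ?idealMl ?rmorphM.
Qed.
Definition quot_pd_ideal : ideal (quot_ring K) := Ideal quot_pd0 quot_pdD quot_pdM.

Definition quot_pd_gamma (n : nat) (c : quot_ring K) : quot_ring K :=
  if pselect (exists2 y, y \in J & c = quot_proj K y) is left e
  then quot_proj K (gamma n (s2val (cid2 e))) else 0.

(** Independence of the representative: if y' - y lies in [K] and [J], every term of gamma_n(y + (y'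
    - y)) other than gamma_n(y) has a factor gamma_k(y' - y) with k > 0, which [K_gamma] puts in
    [K]. *)
Lemma quot_pd_gammaE n y : y \in J ->
  quot_pd_gamma n (quot_proj K y) = quot_proj K (gamma n y).
Proof.
move=> Jy; rewrite /quot_pd_gamma; case: pselect => [e|[]]; last by exists y.
case: (cid2 e) => y' Jy' /= /esym /quot_projP Kyy; apply/quot_projP.
have Jyy : y' - y \in J by apply: idealB.
have -> : y' = y + (y' - y) by rewrite addrC subrK.
rewrite (divpD gP) // big_ord_recr /= subnn.
rewrite (divp0 gP) // mulr1 addrK; apply: ideal_sum => i _.
by rewrite -[(n - i)%N]prednK ?subn_gt0 // idealMl // K_gamma.
Qed.

Lemma quot_divided_powers : divided_powers quot_pd_ideal quot_pd_gamma.
Proof.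
have E := quot_pd_gammaE.
have In y : y \in J -> quot_proj K y \in quot_pd_ideal.
  by move=> Jy; apply/asboolP; exists y.
have ind (P : quot_ring K -> Prop) : (forall y, y \in J -> P (quot_proj K y)) ->
    forall x, x \in quot_pd_ideal -> P x.
  by move=> h x /asboolP[y Jy ->]; apply: h.
split=> [||n|n|n a|m n|m n].
- by apply: ind => x Jx; rewrite E // (divp0 gP) ?rmorph1.
- by apply: ind => x Jx; rewrite E // (divp1 gP).
- by apply: ind => x Jx; rewrite E // In // (divp_in gP).
- move=> x y; move: x; apply: (ind (fun x => y \in quot_pd_ideal -> _)) => x Jx.
  move: y; apply: ind => y Jy; rewrite -raddfD E ?idealD // (divpD gP) //.
  by rewrite rmorph_sum; apply: eq_bigr => i _; rewrite rmorphM /= !E.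
- apply: ind => x Jx; have [b ->] := quot_proj_surj a.
  transitivity (quot_proj K (gamma n (b * x))).
    by rewrite -quot_pd_gammaE ?idealMl // rmorphM.
  by rewrite (divpZ gP) // rmorphM rmorphXn /= E.
- by apply: ind => x Jx; rewrite !E // -rmorphM (divpM gP) // rmorphMn.
- by apply: ind => x Jx; rewrite !E ?(divp_in gP) // (divp_comp gP) // rmorphMn.
Qed.

Definition quot_pd : pdRing := PDRing quot_divided_powers.
End PDQuotient.

(** * Free divided power algebras *)

Lemma univ_mod_ind (R : comPzRingType) (S : Type)
    (P : forall N : lmodType R, (S -> N) -> Prop) (Q : univ_mod P -> Prop) :
  (forall s, Q (univ_mod_gen P s)) -> (forall x y, Q x -> Q y -> Q (x + y)) ->
  (forall a x, Q x -> Q (a *: x)) -> Q 0 -> forall x, Q x.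
Proof.
move=> Qg QD QZ Q0 x; rewrite -[x]mod_class_repr mod_classE.
elim: (repr x) => //= [t Qt u Qu|t Qt|a t Qt]; first exact: QD.
  by rewrite -scaleN1r; apply: QZ.
exact: QZ.
Qed.

Lemma univ_alg_ind (A : comPzRingType) (S : Type)
    (P : forall C : comPzRingType, (A -> C) -> (S -> C) -> Prop)
    (Q : univ_alg P -> Prop) :
  (forall s, Q (univ_alg_gen P s)) -> (forall a, Q (univ_alg_cst P a)) ->
  (forall x y, Q x -> Q y -> Q (x + y)) ->
  (forall x y, Q x -> Q y -> Q (x * y)) -> forall x, Q x.
Proof.
move=> Qg Qc QD QM x; rewrite -[x]alg_class_repr alg_classE.
elim: (repr x) => //= [t Qt u Qu|t Qt|t Qt u Qu]; [exact: QD| |exact: QM].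
rewrite -mulN1r -(rmorph1 (univ_alg_cst P)) -rmorphN.
exact: QM (Qc _) Qt.
Qed.

Arguments dp_cst : simpl never.

Section DivPowTheory.
Variables (R : comPzRingType) (M : lmodType R).
Implicit Types (m : M).

Lemma dp0 m : dp 0 m = 1.
Proof. by have [h _ _ _] := dp_relP M; apply: h. Qed.
Lemma dpZ n a m : dp n (a *: m) = dp_cst M a ^+ n * dp n m.
Proof. by have [_ h _ _] := dp_relP M; apply: h. Qed.
Lemma dpD n m m' : dp n (m + m') = \sum_(i < n.+1) dp i m * dp (n - i)%N m'.
Proof. by have [_ _ h _] := dp_relP M; apply: h. Qed.
Lemma dpM i k m : dp i m * dp k m = dp (i + k)%N m *+ 'C(i + k, i)%N.
Proof. by have [_ _ _ h] := dp_relP M; apply: h. Qed.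
Lemma dp00 n : dp n.+1 (0 : M) = 0.
Proof. by rewrite -(scale0r 0) dpZ rmorph0 expr0n mul0r. Qed.

Lemma dp1D m m' : dp 1 (m + m') = dp 1 m + dp 1 m'.
Proof. by rewrite dpD big_ord_recl big_ord1 !dp0 mul1r mulr1 addrC. Qed.
Lemma dp1Z a m : dp 1 (a *: m) = dp_cst M a * dp 1 m.
Proof. by rewrite dpZ expr1. Qed.

Section Lift.
Variables (C : comPzRingType) (h : {rmorphism R -> C}) (f : nat * M -> C).
Hypothesis hf : dp_rel h f.
Definition divpow_lift : {rmorphism divpow_alg M -> C} := univ_alg_lift hf.
Lemma divpow_lift_dp n m : divpow_lift (dp n m) = f (n, m).
Proof. exact: univ_alg_liftE. Qed.
Lemma divpow_lift_cst a : divpow_lift (dp_cst M a) = h a.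
Proof. exact: univ_alg_lift_cst. Qed.
End Lift.

Lemma divpow_ind (Q : divpow_alg M -> Prop) :
  (forall n m, Q (dp n m)) -> (forall a, Q (dp_cst M a)) ->
  (forall x y, Q x -> Q y -> Q (x + y)) ->
  (forall x y, Q x -> Q y -> Q (x * y)) -> forall x, Q x.
Proof. by move=> Qg; apply: univ_alg_ind => -[n m]; apply: Qg. Qed.

Lemma divpow_ext (C : comPzRingType) (f g : {rmorphism divpow_alg M -> C}) :
  (forall a, f (dp_cst M a) = g (dp_cst M a)) ->
  (forall n m, f (dp n m) = g (dp n m)) -> f =1 g.
Proof.
move=> fc fg; apply: divpow_ind => // x y fx fy; first by rewrite !rmorphD fx fy.
by rewrite !rmorphM fx fy.
Qed.

End DivPowTheory.

Section FreeModule.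
Variables (A : comPzRingType) (X : Type).

Definition freemod_rel (N : lmodType A) (f : X -> N) := True.
Definition freemod : lmodType A := univ_mod freemod_rel.
Definition freemod_gen (x : X) : freemod := univ_mod_gen freemod_rel x.
Definition freemod_lift (N : lmodType A) (f : X -> N) : {linear freemod -> N} :=
  univ_mod_lift (I : freemod_rel f).

Lemma freemod_liftE (N : lmodType A) (f : X -> N) x :
  freemod_lift f (freemod_gen x) = f x.
Proof. exact: univ_mod_liftE. Qed.

Lemma freemod_ind (Q : freemod -> Prop) :
  (forall x, Q (freemod_gen x)) -> (forall x y, Q x -> Q y -> Q (x + y)) ->
  (forall a x, Q x -> Q (a *: x)) -> Q 0 -> forall x, Q x.
Proof. exact: univ_mod_ind. Qed.

End FreeModule.

Lemma freemod_normal (A : comPzRingType) (X : eqType) (m : freemod A X) :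
  exists s (c : X -> A), uniq s /\ m = \sum_(x <- s) c x *: freemod_gen A x.
Proof.
elim/freemod_ind: m => [x|m m' [s [c [us ->]]] [t [d [ut ->]]]|a m [s [c [us ->]]]|].
- by exists [:: x], (fun=> 1); rewrite big_seq1 scale1r.
- pose r := undup (s ++ t).
  have ext (u : seq X) (b : X -> A) : uniq u -> {subset u <= r} ->
      \sum_(x <- u) b x *: freemod_gen A x =
      \sum_(x <- r) (if x \in u then b x else 0) *: freemod_gen A x.
    move=> uu ur; rewrite [RHS](bigID (mem u)) /= [X in _ + X]big1 ?addr0.
      rewrite -[RHS]big_filter (perm_big (filter (mem u) r)); last first.
        apply: uniq_perm; rewrite ?filter_uniq ?undup_uniq // => x.
        by rewrite mem_filter /=; case: (boolP (x \in u)) => // /ur ->.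
      rewrite !big_seq; apply: eq_bigr => x.
      by rewrite mem_filter /= => /andP[-> _].
    by move=> x /negPf ->; rewrite scale0r.
  exists r, (fun x => (if x \in s then c x else 0) + (if x \in t then d x else 0)).
  split; first exact: undup_uniq.
  rewrite (ext s c) // ?(ext t d) // => [|x|x]; last first.
  + by rewrite mem_undup mem_cat => ->.
  + by rewrite mem_undup mem_cat orbC => ->.
  by rewrite -big_split; apply: eq_bigr => x _; rewrite scalerDl.
- exists s, (fun x => a * c x); split=> //; rewrite scaler_sumr.
  by apply: eq_bigr => x _; rewrite scalerA.
- by exists [::], (fun=> 0); rewrite big_nil.
Qed.

Section ShuffleCst.
Variables (A : comPzRingType) (X : Type).
Local Notation cst := (@shuffle_cst A X).

Fact shuffle_cst_zmod : zmod_morphism cst.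
Proof.
by move=> a b; apply/funext => -[|x w] //; apply/esym/(subrr (0 : A)).
Qed.
HB.instance Definition _ := GRing.isZmodMorphism.Build A (shuffle A X) cst
  shuffle_cst_zmod.
Lemma shuffle_cstE a (f : shuffle A X) w : (cst a * f) w = a * f w.
Proof. exact: shuffle_cstM. Qed.
Fact shuffle_cst_monoid : monoid_morphism cst.
Proof.
split=> // a b; apply/funext => -[|x w] //; rewrite shuffle_cstE.
by rewrite mulr0.
Qed.
HB.instance Definition _ := GRing.isMonoidMorphism.Build A (shuffle A X) cst
  shuffle_cst_monoid.

Lemma shuffle_sumE (T : Type) (r : seq T) (f : T -> shuffle A X) w :
  (\sum_(i <- r) f i) w = \sum_(i <- r) f i w.
Proof.
elim: r => [|i r IHr]; first by rewrite !big_nil.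
by rewrite !big_cons -IHr.
Qed.

End ShuffleCst.

Section FreeDivPow.
Variables (A : comPzRingType) (X : choiceType).
Local Notation F := (freemod A X).
Local Notation e := (freemod_gen A).
Local Notation G := (divpow_alg F).
Local Notation cst := (dp_cst F).
Local Notation scst := (@shuffle_cst A X).

Definition coord (x : X) : {linear F -> A^o} :=
  freemod_lift (fun y => (x == y)%:R : A^o).

Lemma coord_gen x y : coord x (e y) = (x == y)%:R.
Proof. exact: freemod_liftE. Qed.

Definition word1 (m : F) : shuffle A X :=
  fun w => if w is [:: x] then coord x m else 0.

Lemma word1D m m' : word1 (m + m') = word1 m + word1 m'.
Proof.
apply/funext => -[|x [|y w]]; try by apply/esym/(addr0 (0 : A)).
by rewrite /word1 raddfD.
Qed.
Lemma word1Z a m : word1 (a *: m) = scst a * word1 m.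
Proof.
apply/funext => w; rewrite shuffle_cstE.
by case: w => [|x [|y w]] /=; rewrite ?mulr0 // linearZ.
Qed.
Lemma word1_aug m : word1 m \in shuffle_aug A X.
Proof. exact: eqxx. Qed.

Let shP := shuffle_divided_powers A X.

Fact divpow_shuffle_rel :
  dp_rel scst (fun nm => shuffle_gamma nm.1 (word1 nm.2)).
Proof.
split=> [m|n a m|n m m'|i k m] /=.
- by [].
- by rewrite word1Z (divpZ shP) // word1_aug.
- by rewrite word1D (divpD shP) // word1_aug.
- by rewrite (divpM shP) // word1_aug.
Qed.

Definition divpow_shuffle : {rmorphism G -> shuffle A X} :=
  divpow_lift divpow_shuffle_rel.
Local Notation j := divpow_shuffle.

Lemma divpow_shuffle_dp n m : j (dp n m) = shuffle_gamma n (word1 m).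
Proof. exact: divpow_lift_dp. Qed.
Lemma divpow_shuffle_cst a : j (cst a) = scst a.
Proof. exact: divpow_lift_cst. Qed.

(** Words stand for multisets of letters: the value depends on [w] only up to permutation
    ([mon_perm]), and the length of [w] is the degree. *)
Definition mon (w : seq X) : G := \prod_(x <- undup w) dp (count_mem x w) (e x).

Lemma monE s w : uniq s -> {subset w <= s} ->
  mon w = \prod_(x <- s) dp (count_mem x w) (e x).
Proof.
move=> us ws; rewrite [RHS](bigID (mem w)) /= [X in _ * X]big1 ?mulr1.
  rewrite -big_filter /mon; apply: perm_big; apply: uniq_perm.
  - exact: undup_uniq.
  - exact: filter_uniq.
  - move=> x; rewrite mem_undup mem_filter /=.
    by case: (boolP (x \in w)) => // /ws ->.
by move=> x /count_memPn ->; rewrite dp0.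
Qed.

Lemma mon_perm w w' : perm_eq w w' -> mon w = mon w'.
Proof.
move=> ww; rewrite (monE (undup_uniq w') (w := w)); last first.
  by move=> x; rewrite mem_undup (perm_mem ww).
by apply: eq_bigr => x _; rewrite (permP ww).
Qed.

Lemma mon_nil : mon [::] = 1.
Proof. exact: big_nil. Qed.

Lemma mon_nseq n x : mon (nseq n x) = dp n (e x).
Proof.
rewrite (monE (s := [:: x])) // => [|y]; last first.
  by rewrite mem_nseq inE => /andP[].
by rewrite big_seq1 count_nseq /= eqxx mul1n.
Qed.

Lemma monM w v : exists n, mon w * mon v = mon (w ++ v) *+ n.
Proof.
have us := undup_uniq (w ++ v); set s := undup _ in us.
have sub u : {subset u <= w ++ v} -> {subset u <= s}.
  by move=> h x /h; rewrite mem_undup.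
rewrite (monE us (w := w)) ?(monE us (w := v)) ?(monE us (w := w ++ v));
  try by apply: sub => x; rewrite // mem_cat => -> //; rewrite orbT.
rewrite -big_split /=.
elim: s {us sub} => [|x s [n IHs]]; first by exists 1%N; rewrite !big_nil.
exists ('C(count_mem x w + count_mem x v, count_mem x w) * n)%N.
by rewrite !big_cons IHs dpM count_cat mulrnAl mulrnAr -mulrnA mulnC.
Qed.

Definition mon_span (g : G) : Prop :=
  exists s : seq (A * seq X), g = \sum_(p <- s) cst p.1 * mon p.2.

Lemma mon_span_mon a w : mon_span (cst a * mon w).
Proof. by exists [:: (a, w)]; rewrite big_seq1. Qed.

Lemma mon_spanD g g' : mon_span g -> mon_span g' -> mon_span (g + g').
Proof. by move=> [s ->] [t ->]; exists (s ++ t); rewrite big_cat. Qed.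

Lemma mon_span_sum (T : Type) (r : seq T) (f : T -> G) :
  (forall i, mon_span (f i)) -> mon_span (\sum_(i <- r) f i).
Proof.
move=> h; elim: r => [|i r IHr]; first by exists [::]; rewrite !big_nil.
by rewrite big_cons; apply: mon_spanD.
Qed.

Lemma mon_spanM g g' : mon_span g -> mon_span g' -> mon_span (g * g').
Proof.
move=> [s ->] [t ->]; rewrite mulr_suml; apply: mon_span_sum => -[a w].
rewrite mulr_sumr; apply: mon_span_sum => -[b v] /=.
rewrite mulrACA -rmorphM; have [n ->] := monM w v.
rewrite mulrnAr -mulrnAl -rmorphMn; exact: mon_span_mon.
Qed.

Lemma mon_spanT g : mon_span g.
Proof.
have cstS a : mon_span (cst a).
  by rewrite -[cst a]mulr1 -mon_nil; apply: mon_span_mon.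
elim/divpow_ind: g => [n m|a|x y|x y]; [|exact: cstS|exact: mon_spanD|exact: mon_spanM].
elim/freemod_ind: m n => [x|m m' Sm Sm'|a m Sm|] n.
- rewrite -mon_nseq -[mon _]mul1r -(rmorph1 cst); exact: mon_span_mon.
- by rewrite dpD; apply: mon_span_sum => i; apply: mon_spanM.
- by rewrite dpZ -rmorphXn; apply: mon_spanM.
- case: n => [|n]; last by rewrite dp00; exists [::]; rewrite big_nil.
  by rewrite dp0 -(rmorph1 cst).
Qed.

(** One chosen word in each permutation class, so that a list of [canonical_words] indexes distinct
    monomials. *)
Definition canon (w : seq X) : seq X := choose (perm_eq w) w.

Lemma perm_canon w : perm_eq w (canon w).
Proof. exact: (@chooseP _ (perm_eq w) w (perm_refl w)). Qed.

Lemma canonP w v : perm_eq w v -> canon w = canon v.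
Proof.
move=> wv; have e1 : perm_eq w =1 perm_eq v by move=> u; apply/permPl: u.
rewrite /canon (eq_choose e1); apply: choose_id; last exact: perm_refl.
by rewrite perm_sym.
Qed.

Lemma canon_id w : canon (canon w) = canon w.
Proof. by apply/esym/canonP/perm_canon. Qed.

Definition canonical_words (L : seq (seq X)) : bool :=
  uniq L && all (fun v => canon v == v) L.

Lemma canonical_words_perm L v w :
  canonical_words L -> v \in L -> w \in L -> perm_eq v w = (v == w).
Proof.
move=> /andP[_ /allP cL] /cL /eqP vE /cL /eqP wE.
by apply/idP/eqP => [/canonP|->//]; rewrite vE wE.
Qed.

Lemma divpow_normal g : exists L (c : seq X -> A),
  canonical_words L /\ g = \sum_(v <- L) cst (c v) * mon v.
Proof.
have [s ->] := mon_spanT g; elim: s => [|[a w] s [L [c [cL gE]]]].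
  by exists [::], (fun=> 0); rewrite !big_nil.
rewrite big_cons gE /= (mon_perm (perm_canon w)); set v := canon w.
have /andP[uL aL] := cL.
case: (boolP (v \in L)) => [vL|vL].
  exists L, (fun u => c u + (if u == v then a else 0)); split=> //.
  rewrite (big_rem v) //= [RHS](big_rem v) //= eqxx rmorphD mulrDl.
  rewrite [X in _ = X + _]addrC -addrA; congr (_ + (_ + _)).
  rewrite !big_seq; apply: eq_bigr => u; rewrite mem_rem_uniq // inE.
  by case/andP => /negPf -> _; rewrite addr0.
exists (v :: L), (fun u => if u == v then a else c u); split.
  by rewrite /canonical_words /= vL uL aL canon_id eqxx.
rewrite big_cons eqxx; congr (_ + _); rewrite !big_seq; apply: eq_bigr => u uL'.
by case: eqP => // uv; rewrite -uv uL' in vL.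
Qed.

(** Removing the first letter y of [v] applies the derivation D_y, which lowers the exponent of y by
    one and kills the product if this exponent is 0 or y is not in [s]. So one inducts on [v], with
    [c] general. *)
Lemma gen_prod_shuffle s (c : X -> nat) v : uniq s ->
  (\prod_(x <- s) shuffle_gamma (c x) (word1 (e x))) v =
  (all (mem s) v && all (fun x => c x == count_mem x v) s)%:R.
Proof.
have derw x y : shuffle_der y (word1 (e x)) = (y == x)%:R.
  rewrite -(rmorph_nat scst); apply/funext => -[|z w] //.
  by rewrite /shuffle_der /= coord_gen.
have der0 y r (d : X -> nat) : y \notin r ->
    shuffle_der y (\prod_(x <- r) shuffle_gamma (d x) (word1 (e x))) = 0.
  elim: r => [|x r IHr]; first by rewrite big_nil shuffle_der1.
  rewrite inE negb_or => /andP[/negPf yx /IHr h].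
  rewrite big_cons shuffle_derM h mulr0 addr0.
  case: (d x) => [|n]; first by rewrite (_ : shuffle_der y _ = 0) ?mul0r.
  by rewrite shuffle_der_gamma derw yx mulr0 mul0r.
move=> us; elim: v c => [|y v IHv] c /=.
  rewrite -[LHS]/(shuffle_const _) rmorph_prod.
  elim: s {us} => [|x s IHs]; first by rewrite big_nil.
  rewrite big_cons IHs /=; case: (c x) => [|n]; first by rewrite eqxx /= mul1r.
  by rewrite [shuffle_const _]shuffle_gammaS0 mul0r.
rewrite -[LHS]/(shuffle_der y _ v); case: (boolP (y \in s)) => [ys|ys] /=; last first.
  by rewrite der0.
rewrite (big_rem y) //= shuffle_derM der0 ?mulr0 ?addr0; last first.
  by rewrite mem_rem_uniq // inE eqxx.
case cy: (c y) => [|n].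
  rewrite (_ : shuffle_der y _ = 0) // mul0r.
  suff -> : all (fun x => c x == (y == x) + count_mem x v)%N s = false.
    by rewrite andbF.
  by apply/negP => /allP/(_ y ys); rewrite cy eqxx.
rewrite shuffle_der_gamma derw eqxx mulr1.
pose c' x := if x == y then n else c x.
rewrite (_ : _ * _ = \prod_(x <- s) shuffle_gamma (c' x) (word1 (e x))).
  rewrite IHv; congr (_ && _)%:R; apply: eq_all => x; rewrite /c'.
  by rewrite [y == x]eq_sym; case: (eqVneq x y) => [->|_] //; rewrite cy.
rewrite [RHS](big_rem y) //= {1}/c' eqxx; congr (_ * _).
rewrite !big_seq; apply: eq_bigr => x; rewrite mem_rem_uniq // inE /c'.
by case/andP => /negPf ->.
Qed.

Lemma divpow_shuffle_mon w v : j (mon w) v = (perm_eq v w)%:R.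
Proof.
rewrite /mon rmorph_prod.
under eq_bigr => x _ do rewrite divpow_shuffle_dp.
rewrite gen_prod_shuffle ?undup_uniq //; congr ((nat_of_bool _)%:R).
apply/idP/idP => [/andP[/allP vw /allP wc]|vw].
  apply/allP => x; rewrite mem_cat => xvw /=.
  have xw : x \in undup w by case/orP: xvw => [/vw //|]; rewrite mem_undup.
  by rewrite eq_sym; apply: wc xw.
apply/andP; split; apply/allP => x.
  by rewrite (perm_mem vw) /= mem_undup.
by move=> _; rewrite (permP vw).
Qed.

(** Monomials become indicator functions of disjoint permutation classes, so evaluation at [v] reads
    off the coefficient of [mon v]. Injectivity of [j] and freeness of G on the monomials follow. *)
Lemma divpow_shuffle_sum L (c : seq X -> A) v : canonical_words L -> v \in L ->
  j (\sum_(u <- L) cst (c u) * mon u) v = c v.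
Proof.
move=> cL vL; rewrite rmorph_sum shuffle_sumE.
rewrite (bigD1_seq v) //=; last by case/andP: cL.
rewrite rmorphM divpow_shuffle_cst shuffle_cstE divpow_shuffle_mon perm_refl mulr1.
rewrite big_seq_cond big1 ?addr0 // => u /andP[uL uv].
rewrite rmorphM divpow_shuffle_cst shuffle_cstE divpow_shuffle_mon.
by rewrite (canonical_words_perm cL) // eq_sym (negPf uv) mulr0.
Qed.

Lemma divpow_shuffle_inj : injective j.
Proof.
apply: raddf_inj => g; have [L [c [cL ->]]] := divpow_normal g => g0.
rewrite big_seq big1 // => v vL.
by rewrite -(divpow_shuffle_sum c cL vL) g0 rmorph0 mul0r.
Qed.

(** The expansion is allowed over every larger list, so that finitely many elements can share one
    list in [divpow_expand_all]. *)
Lemma divpow_expand g : exists L, canonical_words L /\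
  forall L', canonical_words L' -> {subset L <= L'} ->
  g = \sum_(v <- L') cst (j g v) * mon v.
Proof.
have [L [c [cL gE]]] := divpow_normal g; exists L; split=> // L' cL' sL.
have [/andP[uL aL] /andP[uL' aL']] := (cL, cL').
rewrite (bigID (mem L)) /= [X in _ + X]big_seq_cond [X in _ + X]big1 ?addr0.
  rewrite -big_filter (perm_big L); last first.
    apply: uniq_perm => //; first exact: filter_uniq.
    by move=> v; rewrite mem_filter /= andbC; case: (boolP (v \in L)) => [/sL ->|]; rewrite ?andbF.
  rewrite {1}gE !big_seq; apply: eq_bigr => v vL.
  by rewrite gE divpow_shuffle_sum.
move=> v /andP[vL' vL]; rewrite (_ : j g v = 0) ?rmorph0 ?mul0r //.
rewrite gE rmorph_sum shuffle_sumE big_seq big1 // => u uL0.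
rewrite rmorphM divpow_shuffle_cst shuffle_cstE divpow_shuffle_mon.
rewrite (canonical_words_perm cL' vL' (sL _ uL0)).
by case: eqP => [vu|_]; rewrite ?mulr0 //; rewrite vu uL0 in vL.
Qed.

End FreeDivPow.

Section IdealSpanInd.
Variables (R : comPzRingType) (S : R -> Prop).

(** [P] need not be stable under multiplication, so minimality of the span is applied to the ideal
    of those x all of whose multiples satisfy [P]. *)
Lemma ideal_span_ind (P : R -> Prop) : P 0 -> (forall x y, P x -> P y -> P (x + y)) ->
  (forall a y, S y -> P (a * y)) -> forall x, x \in ideal_span S -> P x.
Proof.
move=> P0 PD PM; pose K : {pred R} := fun x => `[< forall a, P (a * x) >].
have K0 : 0 \in K by apply/asboolP => a; rewrite mulr0.
have KD x y : x \in K -> y \in K -> x + y \in K.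
  by move=> /asboolP hx /asboolP hy; apply/asboolP => a; rewrite mulrDr; apply: PD.
have KM a x : x \in K -> a * x \in K.
  by move=> /asboolP hx; apply/asboolP => b; rewrite mulrA.
move=> x Sx; suff /asboolP/(_ 1) : x \in Ideal K0 KD KM by rewrite mul1r.
by apply: ideal_span_min Sx => y Sy; apply/asboolP => a; apply: PM.
Qed.

End IdealSpanInd.

Section IdealAdd.
Variables (R : comPzRingType) (K L : ideal R).
Definition ideal_add_pred : {pred R} := fun z =>
  `[< exists x y, [/\ x \in K, y \in L & z = x + y] >].
Fact ideal_add0 : 0 \in ideal_add_pred.
Proof. by apply/asboolP; exists 0, 0; rewrite !ideal0 addr0. Qed.
Fact ideal_addD u v : u \in ideal_add_pred -> v \in ideal_add_pred ->
  u + v \in ideal_add_pred.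
Proof.
move=> /asboolP[x [y [Kx Ly ->]]] /asboolP[x' [y' [Kx' Ly' ->]]].
by apply/asboolP; exists (x + x'), (y + y'); rewrite !idealD // addrACA.
Qed.
Fact ideal_addM a u : u \in ideal_add_pred -> a * u \in ideal_add_pred.
Proof.
move=> /asboolP[x [y [Kx Ly ->]]].
by apply/asboolP; exists (a * x), (a * y); rewrite !idealMl // mulrDr.
Qed.
Definition ideal_add := Ideal ideal_add0 ideal_addD ideal_addM.

Lemma ideal_addP z :
  reflect (exists x y, [/\ x \in K, y \in L & z = x + y]) (z \in ideal_add).
Proof. exact: asboolP. Qed.
Lemma ideal_addl x : x \in K -> x \in ideal_add.
Proof. by move=> Kx; apply/ideal_addP; exists x, 0; rewrite ideal0 addr0. Qed.
Lemma ideal_addr x : x \in L -> x \in ideal_add.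
Proof. by move=> Kx; apply/ideal_addP; exists 0, x; rewrite ideal0 add0r. Qed.
End IdealAdd.

(** * Degree filtration and divided powers on the free divided power algebra *)

Section ShuffleFiltration.
Variables (A : comPzRingType) (X : Type).
Implicit Types (f g : shuffle A X).

Definition shuffle_low k f := forall w, (size w < k)%N -> f w = 0.

Lemma shuffle_low_der k x f : shuffle_low k f -> shuffle_low k.-1 (shuffle_der x f).
Proof. by case: k => [|k] fk w // wk; apply: fk. Qed.

Lemma shuffle_lowM k l f g :
  shuffle_low k f -> shuffle_low l g -> shuffle_low (k + l) (f * g).
Proof.
move=> fk gl w; elim: w k l f g fk gl => [|x w IHw] k l f g fk gl wkl.
  rewrite -[LHS]/(f [::] * g [::]).
  by case: k fk wkl => [|k] fk wkl; [rewrite gl ?mulr0|rewrite fk ?mul0r].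
rewrite -[LHS]/((shuffle_der x f * g) w + (f * shuffle_der x g) w).
have fk' := shuffle_low_der x fk; have gl' := shuffle_low_der x gl.
rewrite (IHw k.-1 l) ?(IHw k l.-1) ?addr0 //.
  by move: wkl => /= wkl; lia.
by move: wkl => /= wkl; lia.
Qed.

Lemma shuffle_low_gamma n f : f \in shuffle_aug A X -> shuffle_low n (shuffle_gamma n f).
Proof.
move=> f0; elim: n => [|n IHn] // [|x w] // wn.
rewrite -[LHS]/((shuffle_gamma n f * shuffle_der x f) w).
have low0 : shuffle_low 0 (shuffle_der x f) by [].
by apply: shuffle_lowM IHn low0 _ _; rewrite addn0.
Qed.
End ShuffleFiltration.

Section FreeDivPowPD.
Variables (A : comPzRingType) (X : choiceType).
Local Notation F := (freemod A X).
Local Notation e := (freemod_gen A).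
Local Notation G := (divpow_alg F).
Local Notation cst := (dp_cst F).
Local Notation j := (@divpow_shuffle A X).
Let shP := shuffle_divided_powers A X.

(** To transport divided powers along [j], its image must be stable under them. The elements for
    which this holds form an ideal, and the generators [dp n.+1 m] belong to it by the composition
    rule [divp_comp]. *)
Definition gamma_image_pred : {pred G} := fun g =>
  (j g \in shuffle_aug A X) &&
  `[< forall n, exists g', j g' = shuffle_gamma n (j g) >].
Fact gamma_image0 : 0 \in gamma_image_pred.
Proof.
rewrite unfold_in /gamma_image_pred rmorph0 ideal0; apply/asboolP => -[|n].
  by exists 1; rewrite rmorph1.
by exists 0; rewrite rmorph0; apply/esym/(pd_gamma0 (shuffle_pd A X)).
Qed.
Fact gamma_imageD x y : x \in gamma_image_pred -> y \in gamma_image_pred ->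
  x + y \in gamma_image_pred.
Proof.
move=> /andP[Jx /asboolP hx] /andP[Jy /asboolP hy].
rewrite unfold_in /gamma_image_pred rmorphD idealD //; apply/asboolP => n.
pose gx i := projT1 (cid (hx i)); pose gy i := projT1 (cid (hy i)).
have gxE i : j (gx i) = shuffle_gamma i (j x) by rewrite /gx; case: cid.
have gyE i : j (gy i) = shuffle_gamma i (j y) by rewrite /gy; case: cid.
exists (\sum_(i < n.+1) gx i * gy (n - i)%N).
rewrite (divpD shP) // rmorph_sum; apply: eq_bigr => i _.
by rewrite rmorphM gxE gyE.
Qed.
Fact gamma_imageM a x : x \in gamma_image_pred -> a * x \in gamma_image_pred.
Proof.
move=> /andP[Jx /asboolP hx].
rewrite unfold_in /gamma_image_pred rmorphM idealMl //; apply/asboolP => n.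
have [g gE] := hx n; exists (a ^+ n * g).
by rewrite (divpZ shP) // rmorphM rmorphXn gE.
Qed.
Definition gamma_image : ideal G := Ideal gamma_image0 gamma_imageD gamma_imageM.

Lemma dp_gamma_image n m : dp n.+1 m \in gamma_image.
Proof.
suff: dp n.+1 m \in gamma_image_pred by [].
rewrite unfold_in /gamma_image_pred divpow_shuffle_dp.
rewrite (divp_in shP) ?word1_aug //=; apply/asboolP => k.
exists (dp (k * n.+1)%N m *+ ((k * n.+1)`! %/ (k`! * n.+1`! ^ k))%N).
by rewrite rmorphMn divpow_shuffle_dp (divp_comp shP) ?word1_aug.
Qed.

(** The constant term is the coefficient of the empty word; every other monomial has a factor x^[m]
    with m > 0. *)
Lemma divpow_aug_sub (T : ideal G) : (forall n m, dp n.+1 m \in T) ->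
  forall g, j g [::] = 0 -> g \in T.
Proof.
move=> dT g jg0; have [L [cL gE]] := divpow_expand g; rewrite (gE L) //.
apply: ideal_sum => -[|x v] _.
  by rewrite jg0 rmorph0 mul0r ideal0.
have xv : x \in undup (x :: v) by rewrite mem_undup mem_head.
by rewrite idealMl // /mon (big_rem x) //= eqxx add1n idealMr.
Qed.

Lemma divpow_gamma_ex n g : j g \in pd_ideal (shuffle_pd A X) ->
  exists g', j g' = pd_gamma (shuffle_pd A X) n (j g).
Proof.
move=> /eqP jg0; suff /andP[_ /asboolP] : g \in gamma_image by apply.
exact: divpow_aug_sub dp_gamma_image g jg0.
Qed.

Definition divpow_pd : pdRing :=
  @transport_pd (shuffle_pd A X) G j (@divpow_shuffle_inj A X) divpow_gamma_ex.
Local Notation Gplus := (pd_ideal divpow_pd).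
Local Notation gamma := (pd_gamma divpow_pd).

Lemma divpow_gammaE n g : g \in Gplus -> j (gamma n g) = shuffle_gamma n (j g).
Proof.
exact: (@transport_gammaE (shuffle_pd A X) G j divpow_gamma_ex).
Qed.

Lemma divpow_gammaZ n (a x : G) : x \in Gplus ->
  gamma n (a * x : G) = (a ^+ n * (gamma n x : G) : G).
Proof. exact: (divpZ (pd_gammaP divpow_pd)). Qed.

Lemma dp_in n m : dp n.+1 m \in Gplus.
Proof.
suff: j (dp n.+1 m) \in shuffle_aug A X by [].
by rewrite divpow_shuffle_dp (divp_in shP) ?word1_aug.
Qed.

Lemma gamma_dp k n m : gamma k (dp n.+1 m) =
  dp (k * n.+1)%N m *+ ((k * n.+1)`! %/ (k`! * n.+1`! ^ k))%N.
Proof.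
apply: divpow_shuffle_inj; rewrite divpow_gammaE ?dp_in // rmorphMn.
by rewrite !divpow_shuffle_dp (divp_comp shP) ?word1_aug.
Qed.

Lemma gamma_dp1 k m : gamma k (dp 1 m) = dp k m.
Proof.
apply: divpow_shuffle_inj; rewrite divpow_gammaE ?dp_in // !divpow_shuffle_dp.
by rewrite (divp1 shP) ?word1_aug.
Qed.

Lemma divpow_aug_ind (T : ideal G) : (forall n m, dp n.+1 m \in T) ->
  forall g, g \in Gplus -> g \in T.
Proof. by move=> dT g /eqP; apply: divpow_aug_sub. Qed.

Lemma cst_in a : (cst a \in Gplus) = (a == 0).
Proof.
suff -> : (cst a \in Gplus) = (j (cst a) \in shuffle_aug A X).
  by rewrite divpow_shuffle_cst.
by [].
Qed.

(** The values of [j g] are the coefficients of [g] on monomials, so this says that [g] has degree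
    at least [k]; multiplicativity is then inherited from words. *)
Definition dfilt_pred (k : nat) : {pred G} := fun g => `[< shuffle_low k (j g) >].
Fact dfilt0 k : 0 \in dfilt_pred k.
Proof. by apply/asboolP => w _; rewrite rmorph0. Qed.
Fact dfiltD k x y : x \in dfilt_pred k -> y \in dfilt_pred k ->
  x + y \in dfilt_pred k.
Proof.
move=> /asboolP hx /asboolP hy; apply/asboolP => w wk.
by rewrite rmorphD -[LHS]/(j x w + j y w) hx // hy // addr0.
Qed.
Fact dfiltMl k a x : x \in dfilt_pred k -> a * x \in dfilt_pred k.
Proof.
move=> /asboolP hx; apply/asboolP; rewrite rmorphM -[k]add0n.
exact: shuffle_lowM.
Qed.
Definition dfilt k : ideal G := Ideal (dfilt0 k) (@dfiltD k) (@dfiltMl k).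

Lemma dfiltP k g : reflect (shuffle_low k (j g)) (g \in dfilt k).
Proof. exact: asboolP. Qed.

Lemma dfiltM k l x y : x \in dfilt k -> y \in dfilt l -> x * y \in dfilt (k + l)%N.
Proof.
by move=> /dfiltP hx /dfiltP hy; apply/dfiltP; rewrite rmorphM; apply: shuffle_lowM.
Qed.

Lemma dfilt_sub k l x : (k <= l)%N -> x \in dfilt l -> x \in dfilt k.
Proof.
move=> kl /dfiltP hx; apply/dfiltP => w wk; apply: hx.
exact: leq_trans wk kl.
Qed.

Lemma dfiltT x : x \in dfilt 0.
Proof. exact/dfiltP. Qed.

Lemma gamma_dfilt n x : x \in Gplus -> gamma n x \in dfilt n.
Proof.
by move=> Gx; apply/dfiltP; rewrite divpow_gammaE //; apply: shuffle_low_gamma.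
Qed.

Lemma dp_dfilt n m : dp n m \in dfilt n.
Proof. by rewrite -gamma_dp1 gamma_dfilt ?dp_in. Qed.

Lemma mon_dfilt v : mon A v \in dfilt (size v).
Proof.
apply/dfiltP => w wv; rewrite divpow_shuffle_mon.
by case: (boolP (perm_eq w v)) => // /perm_size wvE; rewrite wvE ltnn in wv.
Qed.

(** With the length of a word written as the sum of its exponents, statements about [mon v] in
    degree [size v] can be proved factor by factor. *)
Lemma sum_count (s v : seq X) : uniq s -> {subset v <= s} ->
  (\sum_(x <- s) count_mem x v)%N = size v.
Proof.
move=> us; elim: v => [|y v IHv] vs; first by rewrite big1.
rewrite /= big_split /= IHv; last by move=> x xv; apply: vs; rewrite inE xv orbT.
rewrite -add1n; congr (_ + _)%N.
rewrite (big_rem y) ?vs ?mem_head //= eqxx big_seq big1 // => x.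
by rewrite mem_rem_uniq // inE => /andP[/negPf xy _]; rewrite eq_sym xy.
Qed.

End FreeDivPowPD.

(** * The ideal of the envelope *)

Section DivPowMap.
Variables (R : comPzRingType) (M N : lmodType R) (eta : {linear M -> N}).
Fact divpow_map_rel : dp_rel (dp_cst N) (fun nm => dp nm.1 (eta nm.2)).
Proof.
split=> [m|n a m|n m m'|i k m] /=.
- exact: dp0.
- by rewrite linearZ dpZ.
- by rewrite raddfD dpD.
- exact: dpM.
Qed.
Definition divpow_map : {rmorphism divpow_alg M -> divpow_alg N} :=
  divpow_lift divpow_map_rel.
Lemma divpow_map_dp n m : divpow_map (dp n m) = dp n (eta m).
Proof. exact: divpow_lift_dp. Qed.
Lemma divpow_map_cst a : divpow_map (dp_cst M a) = dp_cst N a.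
Proof. exact: divpow_lift_cst. Qed.
End DivPowMap.

Section Koszul.
Variables (A : comPzRingType) (M : lmodType A) (phi : {linear M -> A^o}).

(** The image of the second differential of the Koszul complex of [phi]. *)
Inductive koszul : M -> Prop :=
  | Koszul0 : koszul 0
  | KoszulD x y : koszul x -> koszul y -> koszul (x + y)
  | KoszulZ a x : koszul x -> koszul (a *: x)
  | KoszulGen x y : koszul ((phi x : A) *: y - (phi y : A) *: x).

Lemma koszul_ker x : koszul x -> phi x = 0.
Proof.
elim=> [|{}x y _ hx _ hy|a {}x _ hx|{}x y].
- exact: raddf0.
- by rewrite raddfD /= hx hy addr0.
- by rewrite linearZ /= hx scaler0.
- rewrite raddfB /= !linearZ /= scalerN.
  by apply/eqP; rewrite subr_eq0; apply/eqP/mulrC.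
Qed.
End Koszul.

Section Envelope.
Variables (A : comPzRingType) (I : ideal A) (X : choiceType).
Local Notation F := (freemod A X).
Local Notation e := (freemod_gen A).
Local Notation G := (divpow_alg F).
Local Notation cst := (dp_cst F).
Local Notation j := (@divpow_shuffle A X).
Local Notation GP := (divpow_pd A X).
Local Notation gamma := (pd_gamma GP).
Local Notation Gplus := (pd_ideal GP).
Local Notation filt := (@dfilt A X).
Let gP := pd_gammaP GP.
Variable phi : {linear F -> A^o}.

Definition env_rel (f : F) : G := dp 1 f - cst (phi f).
Local Notation q := env_rel.

Lemma env_relD f g : q (f + g) = q f + q g.
Proof. by rewrite /q dp1D raddfD rmorphD /= opprD addrACA. Qed.
Lemma env_relZ a f : q (a *: f) = cst a * q f.
Proof. by rewrite /q dp1Z linearZ mulrBr -rmorphM. Qed.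
Lemma env_rel_ker f : phi f = 0 -> q f = dp 1 f.
Proof. by move=> h; rewrite /q h rmorph0 subr0. Qed.
Lemma env_rel0 : q 0 = 0.
Proof. by rewrite /q dp00 raddf0 rmorph0 subr0. Qed.

(* With P the kernel of phi, this is the part of the ideal of the u^[m] that is
   visibly of degree at least k; k - m.+1 is truncated. *)
Definition dp_span (P : F -> Prop) (k : nat) : ideal G :=
  ideal_span (fun z => exists h m u,
    [/\ P u, h \in filt (k - m.+1) & z = h * dp m.+1 u]).

Lemma dp_span_gen (P : F -> Prop) k h m u :
  P u -> h \in filt (k - m.+1) -> h * dp m.+1 u \in dp_span P k.
Proof. by move=> Pu hk; apply: mem_ideal_span; exists h, m, u. Qed.

Lemma dp_span_ind (P : F -> Prop) k (T : G -> Prop) : T 0 ->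
  (forall x y, T x -> T y -> T (x + y)) ->
  (forall h m u, P u -> h \in filt (k - m.+1) -> T (h * dp m.+1 u)) ->
  forall z, z \in dp_span P k -> T z.
Proof.
move=> T0 TD TM; apply: ideal_span_ind => // a y [h [m [u [Pu hk ->]]]].
by rewrite mulrA; apply: TM => //; apply: idealMl.
Qed.

Lemma dp_spanM (P : F -> Prop) k l h z :
  h \in filt k -> z \in dp_span P l -> h * z \in dp_span P (k + l).
Proof.
move=> hk; move: z; apply: dp_span_ind => [|x y hx hy|g m u Pu gl].
- by rewrite mulr0 ideal0.
- by rewrite mulrDr idealD.
rewrite mulrA; apply: dp_span_gen => //.
by apply: dfilt_sub (dfiltM hk gl); lia.
Qed.

Lemma dp_span_sub (P : F -> Prop) k l z :
  (k <= l)%N -> z \in dp_span P l -> z \in dp_span P k.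
Proof.
move=> kl; move: z; apply: dp_span_ind => [|x y hx hy|g m u Pu gl].
- exact: ideal0.
- exact: idealD.
by apply: dp_span_gen => //; apply: dfilt_sub gl; lia.
Qed.

Lemma dp_span_filt (P : F -> Prop) k z : z \in dp_span P k -> z \in filt k.
Proof.
move: z; apply: dp_span_ind => [|x y hx hy|g m u Pu gl].
- exact: ideal0.
- exact: idealD.
by apply: dfilt_sub (dfiltM gl (dp_dfilt m.+1 u)); lia.
Qed.

Definition ker_pred (u : F) : Prop := phi u = 0.
Local Notation N := (dp_span ker_pred).

(** Only the coefficient counts for the degree, because [q f] has the constant term - phi f; in
    [dp_span] the factor [dp m.+1 u] contributes m + 1. *)
Definition rel_span (k : nat) : ideal G :=
  ideal_span (fun z => exists h f, h \in filt k /\ z = h * q f).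
Local Notation Q := rel_span.

Lemma rel_span_gen k h f : h \in filt k -> h * q f \in Q k.
Proof. by move=> hk; apply: mem_ideal_span; exists h, f. Qed.

Lemma rel_span_ind k (T : G -> Prop) : T 0 ->
  (forall x y, T x -> T y -> T (x + y)) ->
  (forall h f, h \in filt k -> T (h * q f)) ->
  forall z, z \in Q k -> T z.
Proof.
move=> T0 TD TM; apply: ideal_span_ind => // a y [h [f [hk ->]]].
by rewrite mulrA; apply: TM => //; apply: idealMl.
Qed.

Lemma rel_spanM k l h z : h \in filt k -> z \in Q l -> h * z \in Q (k + l)%N.
Proof.
move=> hk; move: z; apply: rel_span_ind => [|x y hx hy|g f gl].
- by rewrite mulr0 ideal0.
- by rewrite mulrDr idealD.
by rewrite mulrA; apply: rel_span_gen; apply: dfiltM.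
Qed.

Lemma rel_span_filt k z : z \in Q k -> z \in filt k.
Proof.
move: z; apply: rel_span_ind => [|x y hx hy|g f gl].
- exact: ideal0.
- exact: idealD.
exact: idealMr.
Qed.

Lemma rel_span_sub k l z : (k <= l)%N -> z \in Q l -> z \in Q k.
Proof.
move=> kl; move: z; apply: rel_span_ind => [|x y hx hy|g f gl].
- exact: ideal0.
- exact: idealD.
by apply: rel_span_gen; apply: dfilt_sub gl.
Qed.

Lemma rel_span_mul k l x y : x \in Q k -> y \in Q l -> x * y \in Q (k + l)%N.
Proof. by move=> /rel_span_filt; apply: rel_spanM. Qed.

(* phi x * y - phi y * x = x q_y - y q_x, and q_y x has divided powers q_y^n x^[n] *)
Lemma koszul_dp_rel u m : koszul phi u -> dp m.+1 u \in Q m.+1.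
Proof.
have QM (a b : nat) (x y : G) : x \in Q a.+1 -> y \in Q b.+1 ->
    x * y \in Q (a.+1 + b.+1)%N by apply: rel_span_mul.
pose T := @pd_closed GP Q QM.
have TP z : z \in T -> forall n, gamma n.+1 z \in Q n.+1.
  by case/andP => _ /asboolP.
have gen x y : q y * dp 1 x \in T.
  suff: q y * dp 1 x \in @pd_closed_pred GP Q by [].
  rewrite unfold_in idealMl ?dp_in //=; apply/asboolP => n.
  change (gamma n.+1 (q y * dp 1 x : G) \in Q n.+1).
  rewrite divpow_gammaZ ?dp_in // gamma_dp1 exprSr mulrAC.
  by apply/rel_span_gen/(@idealMl _ (filt n.+1))/dp_dfilt.
move=> ku; rewrite -gamma_dp1; apply: TP; elim: ku => [|x y _ hx _ hy|a x _ hx|x y].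
- by rewrite dp00 ideal0.
- by rewrite dp1D idealD.
- by rewrite dp1Z idealMl.
rewrite -scaleN1r dp1D !dp1Z.
have -> : cst (phi x) * dp 1 y + cst (-1) * (cst (phi y) * dp 1 x) =
    q y * dp 1 x - q x * dp 1 y.
  rewrite rmorphN rmorph1 /q; ring.
by apply: idealB.
Qed.

Lemma koszul_span_rel k z : z \in dp_span (koszul phi) k -> z \in Q k.
Proof.
move: z; apply: dp_span_ind => [|x y hx hy|g m u Pu gl].
- exact: ideal0.
- exact: idealD.
apply: rel_span_sub (rel_spanM gl (koszul_dp_rel m Pu)); lia.
Qed.

(* eta induces the identity of F / ker phi, so Gamma(eta) - id maps the degree k
   part of the filtration to the ideal generated by the u^[m], phi u = 0. *)
Section Eta.
Variable eta : {linear F -> F}.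
Hypothesis phi_eta : forall f, phi (eta f) = phi f.
Local Notation Geta := (divpow_map eta).

Definition eta_close (k : nat) (g : G) := g \in filt k /\ Geta g - g \in N k.

Lemma eta_close_dp n f : eta_close n (dp n f).
Proof.
split; first exact: dp_dfilt.
rewrite divpow_map_dp (_ : eta f = f + (eta f - f)); last by rewrite addrC subrK.
rewrite dpD big_ord_recr /= subnn dp0 mulr1 addrK; apply: (@ideal_sum _ (N n)) => i _.
have ni : (n - i = (n - i).-1.+1)%N by rewrite prednK // subn_gt0.
rewrite ni; apply: dp_span_gen.
  by rewrite /ker_pred raddfB /= phi_eta subrr.
by rewrite -ni subKn ?dp_dfilt // ltnW.
Qed.

Lemma eta_close_filt k g : eta_close k g -> Geta g \in filt k.
Proof. by move=> [gk /dp_span_filt hN]; rewrite -(subrK g (Geta g)) idealD. Qed.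

(** The difference telescopes as Gamma(eta)x (Gamma(eta)y - y) + y (Gamma(eta)x - x). The first
    product has the right degree because Gamma(eta) preserves the filtration, by
    [eta_close_filt]. *)
Lemma eta_closeM k l x y : eta_close k x -> eta_close l y -> eta_close (k + l) (x * y).
Proof.
move=> cx cy; have fx := eta_close_filt cx; case: cx cy => xk hx [yl hy].
split; first exact: dfiltM.
have -> : Geta (x * y) - x * y = Geta x * (Geta y - y) + y * (Geta x - x).
  by rewrite rmorphM; ring.
by apply: idealD; [|rewrite addnC]; apply: dp_spanM.
Qed.

Lemma eta_close_mon v : eta_close (size v) (mon A v).
Proof.
rewrite -(sum_count (undup_uniq v)); last by move=> x; rewrite mem_undup.
rewrite /mon; elim: (undup v) => [|x s IHs].
  by rewrite !big_nil; split; rewrite ?dfiltT // rmorph1 subrr ideal0.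
by rewrite !big_cons; apply: eta_closeM => //; apply: eta_close_dp.
Qed.

Lemma eta_close_of_filt k g : g \in filt k -> eta_close k g.
Proof.
move=> gk; split=> //; have [L [cL gE]] := divpow_expand g.
have {gE} gE := gE L cL (fun _ h => h).
rewrite {1 2}gE rmorph_sum -sumrB; apply: ideal_sum => v _.
rewrite rmorphM divpow_map_cst -mulrBr.
have [vk|kv] := ltnP (size v) k.
  by have /dfiltP -> := gk; rewrite // rmorph0 mul0r ideal0.
apply: idealMl; apply: dp_span_sub kv _.
by case: (eta_close_mon v).
Qed.
End Eta.

Definition good_eta (us : seq F) (eta : {linear F -> F}) :=
  (forall f, phi (eta f) = phi f) /\ forall u, u \in us -> koszul phi (eta u).

(** The list consists of the u in one expression of [s] as a sum of h u^[m]. A good eta turns such a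
    term into Gamma(eta)h times (eta u)^[m], where eta u is a Koszul relation and Gamma(eta)h
    satisfies the same degree bound as h. *)
Lemma eta_koszul k s : s \in N k -> exists us : seq F,
  (forall u, u \in us -> phi u = 0) /\
  forall eta, good_eta us eta -> divpow_map eta s \in dp_span (koszul phi) k.
Proof.
move: s; apply: dp_span_ind => [|x y [us [kus hus]] [vs [kvs hvs]]|h m u Pu hk].
- by exists [::]; split=> // eta _; rewrite rmorph0 ideal0.
- exists (us ++ vs); split=> [u|eta [ep ek]].
    by rewrite mem_cat => /orP[/kus|/kvs].
  rewrite rmorphD idealD ?hus ?hvs //; split=> // u uv; apply: ek.
    by rewrite mem_cat uv.
  by rewrite mem_cat uv orbT.
- exists [:: u]; split=> [v|eta [ep ek]]; first by rewrite inE => /eqP->.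
  rewrite rmorphM divpow_map_dp; apply: dp_span_gen; first by apply: ek; rewrite inE.
  by apply: eta_close_filt; apply: eta_close_of_filt.
Qed.

Hypothesis phiI : forall f, phi f \in I.
Hypothesis phi_surj : forall a, a \in I -> exists f, phi f = a.
Hypothesis eta_ex : forall us : seq F, (forall u, u \in us -> phi u = 0) ->
  exists eta, good_eta us eta.

Definition base_span (k : nat) : ideal G :=
  ideal_span (fun z => exists a h, [/\ a \in I, h \in filt k & z = cst a * h]).

Lemma base_span_ind k (T : G -> Prop) : T 0 ->
  (forall x y, T x -> T y -> T (x + y)) ->
  (forall a h, a \in I -> h \in filt k -> T (cst a * h)) ->
  forall z, z \in base_span k -> T z.
Proof.
move=> T0 TD TM; apply: ideal_span_ind => // b y [a [h [aI hk ->]]].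
by rewrite mulrCA; apply: TM => //; apply: idealMl.
Qed.

(** Write s = Gamma(eta)s - (Gamma(eta)x - x) - (Gamma(eta)y - y), with x in I times degree >= k and
    y of degree > k. The first term lies in [Q k] and the last in [N k.+1]; what remains is a sum of
    a n with a in I and n in [N k]. *)
Lemma ker_span_base k s : s \in N k ->
  s \in ideal_add (base_span k) (filt k.+1) ->
  s \in ideal_add (Q k) (N k.+1).
Proof.
move=> sN; have [us [kus hus]] := eta_koszul sN.
have [eta geta] := eta_ex kus; have [ep _] := geta.
move=> /ideal_addP[x [y [xI yk sE]]].
have {hus} hs := koszul_span_rel (hus _ geta).
have -> : s = divpow_map eta s - ((divpow_map eta x - x) + (divpow_map eta y - y)).
  by rewrite sE rmorphD; ring.
apply: idealB; first exact: ideal_addl.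
apply: idealD; last first.
  by apply: ideal_addr; case: (eta_close_of_filt ep yk).
move: x xI {sE}; apply: base_span_ind => [|u v hu hv|a h aI hk].
- by rewrite rmorph0 subrr ideal0.
- by rewrite rmorphD opprD addrACA idealD.
rewrite rmorphM divpow_map_cst -mulrBr; set n := _ - h.
have nN : n \in N k by case: (eta_close_of_filt ep hk).
have [f fa] := phi_surj aI.
(* Modulo [Q k], multiplication by a = phi f is multiplication by f^[1], which raises the degree by
   one. *)
have -> : cst a * n = dp 1 f * n - n * q f by rewrite /q fa; ring.
apply: idealB.
  apply: ideal_addr; rewrite -[k.+1]add1n; apply: dp_spanM nN; exact: dp_dfilt.
by apply/ideal_addl/rel_span_gen/(dp_span_filt nN).
Qed.

Lemma canonical_words_cat (L L' : seq (seq X)) :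
  canonical_words L -> canonical_words L' -> canonical_words (undup (L ++ L')).
Proof.
move=> /andP[_ aL] /andP[_ aL']; rewrite /canonical_words undup_uniq.
by apply/allP => v; rewrite mem_undup mem_cat => /orP[/(allP aL)|/(allP aL')].
Qed.

Lemma divpow_expand_all (gs : seq G) : exists L, canonical_words L /\
  forall g, g \in gs -> g = \sum_(v <- L) cst (j g v) * mon A v.
Proof.
suff [L [cL hL]] : exists L, canonical_words L /\ forall L', canonical_words L' ->
    {subset L <= L'} -> forall g, g \in gs -> g = \sum_(v <- L') cst (j g v) * mon A v.
  by exists L; split=> //; apply: hL.
elim: gs => [|g gs [L [cL hL]]]; first by exists [::].
have [L' [cL' hL']] := divpow_expand g.
exists (undup (L ++ L')); split=> [|L'' cL'' sub g']; first exact: canonical_words_cat.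
have subl : {subset L <= L''}.
  by move=> v vL; apply: sub; rewrite mem_undup mem_cat vL.
have subr : {subset L' <= L''}.
  by move=> v vL; apply: sub; rewrite mem_undup mem_cat vL orbT.
by rewrite inE => /orP[/eqP->|]; [apply: hL'|apply: hL].
Qed.

Lemma rel_span_list k z : z \in Q k -> exists s : seq (G * F),
  (forall p, p \in s -> p.1 \in filt k) /\ z = \sum_(p <- s) p.1 * q p.2.
Proof.
move: z; apply: rel_span_ind => [|x y [s [sk ->]] [t [tk ->]]|h f hk].
- by exists [::]; rewrite big_nil.
- exists (s ++ t); rewrite big_cat; split=> // p.
  by rewrite mem_cat => /orP[/sk|/tk].
- by exists [:: (h, f)]; rewrite big_seq1; split=> // p; rewrite inE => /eqP->.
Qed.

(** By linearity of q, all terms with the same monomial merge into a single q; this makes leading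
    coefficients visible in [rel_span_step]. *)
Lemma env_rel_sum (T : Type) (s : seq T) (c : T -> A) (f : T -> F) :
  \sum_(i <- s) cst (c i) * q (f i) = q (\sum_(i <- s) c i *: f i).
Proof.
elim: s => [|i s IHs]; first by rewrite !big_nil env_rel0.
by rewrite !big_cons IHs env_relD env_relZ.
Qed.

(* Written in the basis of monomials, z has leading coefficients phi (f v). *)
Lemma rel_span_step k z : z \in Q k -> z \in filt k.+1 ->
  z \in ideal_add (Q k.+1) (N k.+1).
Proof.
move=> zQ zk; have [s [sk zE]] := rel_span_list zQ.
have [L [cL hL]] := divpow_expand_all [seq p.1 | p <- s].
pose f v := \sum_(p <- s) (j p.1 v : A) *: p.2.
have {}zE : z = \sum_(v <- L) mon A v * q (f v).
  rewrite zE; transitivity (\sum_(p <- s) \sum_(v <- L) mon A v * (cst (j p.1 v) * q p.2)).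
    rewrite !big_seq; apply: eq_bigr => p ps; rewrite {1}(hL p.1) ?map_f //.
    by rewrite mulr_suml; apply: eq_bigr => v _; rewrite mulrA [mon A v * _]mulrC.
  rewrite exchange_big; apply: eq_bigr => v _.
  by rewrite -mulr_sumr env_rel_sum.
have f0 v : (size v < k)%N -> f v = 0.
  move=> vk; rewrite /f big_seq big1 // => p /sk/dfiltP -> //.
  by rewrite scale0r.
have fk v : v \in L -> size v = k -> phi (f v) = 0.
  move=> vL vk; have /dfiltP/(_ v) := zk; rewrite vk ltnSn => /(_ isT).
  have -> : z = \sum_(u <- L) mon A u * dp 1 (f u) +
      \sum_(u <- L) cst (- phi (f u) : A) * mon A u.
    by rewrite zE -big_split; apply: eq_bigr => u _ /=; rewrite /q rmorphN; ring.
  rewrite rmorphD -[LHS]/(j _ v + j _ v) divpow_shuffle_sum //.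
  rewrite (_ : j _ v = 0) ?add0r => [/eqP|].
    by rewrite oppr_eq0 => /eqP.
  rewrite rmorph_sum shuffle_sumE big1 // => u _.
  have [uk|ku] := ltnP (size u) k.
    by rewrite f0 // dp00 mulr0 rmorph0.
  have /dfiltP -> // := dfiltM (mon_dfilt A u) (dp_dfilt 1 (f u)).
  by rewrite vk addn1 ltnS.
rewrite zE big_seq; apply: ideal_sum => v vL.
have [vk|kv|vk] := ltngtP (size v) k.
- by rewrite f0 // env_rel0 mulr0 ideal0.
- apply/ideal_addl/rel_span_gen; exact: dfilt_sub kv (mon_dfilt A v).
- have fv := fk v vL vk; rewrite env_rel_ker //; apply/ideal_addr/dp_span_gen => //.
  by rewrite subn1 /= -vk mon_dfilt.
Qed.

Definition env_ideal : ideal G := ideal_add (Q 0) (N 0).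

(** In z = x + s the leading term of x has coefficients in I, those of - phi f, and z has degree >
    k, so the leading term of s has coefficients in I too. Then [ker_span_base] writes s = y + n,
    and x + y = z - n lies in [Q k] and has degree > k, as [rel_span_step] requires. *)
Lemma env_span_step k z : z \in ideal_add (Q k) (N k) -> z \in filt k.+1 ->
  z \in ideal_add (Q k.+1) (N k.+1).
Proof.
move=> /ideal_addP[x [s [xQ sN zE]]] zk.
have xB : x \in ideal_add (base_span k) (filt k.+1).
  move: x xQ {zE}; apply: rel_span_ind => [|u v hu hv|h f hk].
  - exact: ideal0.
  - exact: idealD.
  rewrite /q mulrBr; apply: idealB.
    by apply/ideal_addr; rewrite -[k.+1]addn1; apply: dfiltM => //; apply: dp_dfilt.
  apply/ideal_addl; rewrite mulrC; apply: mem_ideal_span.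
  by exists (phi f), h.
have sB : s \in ideal_add (base_span k) (filt k.+1).
  have -> : s = z - x by rewrite zE addrC addKr.
  by apply: idealB => //; apply: ideal_addr.
have /ideal_addP[y [n [yQ nN sE]]] := ker_span_base sN sB.
have -> : z = (x + y) + n by rewrite zE sE addrA.
apply: idealD; last exact: ideal_addr.
apply: rel_span_step; first exact: idealD.
have -> : x + y = z - n by rewrite zE sE addrA addrK.
by apply: idealB => //; apply: dp_span_filt nN.
Qed.

Lemma env_ideal_filt k z : z \in env_ideal -> z \in filt k ->
  z \in ideal_add (Q k) (N k).
Proof.
move=> zK; elim: k => [|k IHk] // zk; apply: env_span_step => //.
by apply: IHk; apply: dfilt_sub zk.
Qed.

End Envelope.

(** * Comparison with the associated graded ring *)

Section QuotLift.
Variables (R S : comPzRingType) (K : ideal R) (f : {rmorphism R -> S}).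
Hypothesis fK : forall x, x \in K -> f x = 0.

Definition quot_lift (_ : forall x, x \in K -> f x = 0) (c : quot_ring K) : S :=
  f (repr c).

Lemma quot_liftE x : quot_lift fK (quot_proj K x) = f x.
Proof.
apply/eqP; rewrite -subr_eq0 -rmorphB; apply/eqP/fK; exact: repr_quot_proj.
Qed.

Fact quot_lift_zmod : zmod_morphism (quot_lift fK).
Proof.
move=> x y; have [a ->] := quot_proj_surj x; have [b ->] := quot_proj_surj y.
by rewrite -rmorphB !quot_liftE rmorphB.
Qed.
HB.instance Definition _ := GRing.isZmodMorphism.Build (quot_ring K) S
  (quot_lift fK) quot_lift_zmod.
Fact quot_lift_monoid : monoid_morphism (quot_lift fK).
Proof.
split=> [|x y]; first by rewrite -(rmorph1 (quot_proj K)) quot_liftE rmorph1.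
have [a ->] := quot_proj_surj x; have [b ->] := quot_proj_surj y.
by rewrite -rmorphM !quot_liftE rmorphM.
Qed.
HB.instance Definition _ := GRing.isMonoidMorphism.Build (quot_ring K) S
  (quot_lift fK) quot_lift_monoid.
End QuotLift.

(** * The grading of a divided power algebra *)

Section DivPowGrading.
Variables (R : comPzRingType) (M : lmodType R).
Local Notation D := (divpow_alg M).

Fact cauchy_cst_zmod : zmod_morphism (@cauchy_homog D 0).
Proof.
move=> a b; apply/funext => k; rewrite -[RHS]/(cauchy_homog 0 a k - cauchy_homog 0 b k).
by rewrite /cauchy_homog; case: eqP; rewrite ?subrr.
Qed.
HB.instance Definition _ := GRing.isZmodMorphism.Build D (cauchy D)
  (@cauchy_homog D 0) cauchy_cst_zmod.
Fact cauchy_cst_monoid : monoid_morphism (@cauchy_homog D 0).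
Proof. by split=> // a b; rewrite cauchyM_homog. Qed.
HB.instance Definition _ := GRing.isMonoidMorphism.Build D (cauchy D)
  (@cauchy_homog D 0) cauchy_cst_monoid.

Lemma cauchy_sumE (T : Type) (r : seq T) (P : pred T) (f : T -> cauchy D) n :
  (\sum_(i <- r | P i) f i) n = \sum_(i <- r | P i) f i n.
Proof.
elim: r => [|i r IHr]; first by rewrite !big_nil.
by rewrite !big_cons -IHr; case: (P i).
Qed.

Lemma cauchy_homog_sum n (T : Type) (r : seq T) (f : T -> D) :
  \sum_(i <- r) cauchy_homog n (f i) = cauchy_homog n (\sum_(i <- r) f i).
Proof.
apply/funext => k; rewrite cauchy_sumE /cauchy_homog; case: eqP => // _.
exact: big1.
Qed.

Lemma cauchy_homogMn n (x : D) m :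
  cauchy_homog n (x *+ m) = cauchy_homog n x *+ m.
Proof.
have -> : x *+ m = \sum_(i < m) x by rewrite sumr_const card_ord.
by rewrite -cauchy_homog_sum sumr_const card_ord.
Qed.

Fact divpow_grading_rel : dp_rel (cauchy_homog 0 \o dp_cst M)%FUN
  (fun nm => cauchy_homog nm.1 (dp nm.1 nm.2)).
Proof.
split=> [m|n a m|n m m'|i k m] /=.
- by rewrite dp0.
- by rewrite dpZ -[cauchy_homog 0 _ ^+ n]rmorphXn [RHS]cauchyM_homog.
- rewrite dpD -cauchy_homog_sum; apply: eq_bigr => i _.
  by rewrite cauchyM_homog subnKC // -ltnS.
- by rewrite cauchyM_homog dpM cauchy_homogMn.
Qed.

(** The sequence of homogeneous components. As the algebra is given by generators and relations over
    an arbitrary module, the independence of its graded parts comes from this ring map, which the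
    universal property provides. *)
Definition divpow_grading : {rmorphism D -> cauchy D} :=
  @divpow_lift _ _ _ (@cauchy_homog D 0 \o dp_cst M)%FUN _ divpow_grading_rel.
Local Notation theta := divpow_grading.

Definition graded_elt (n : nat) (u : D) := theta u = cauchy_homog n u.

Lemma graded_elt_cst a : graded_elt 0 (dp_cst M a).
Proof. exact: divpow_lift_cst. Qed.
Lemma graded_elt_dp n (m : M) : graded_elt n (dp n m).
Proof. exact: divpow_lift_dp. Qed.
Lemma graded_eltM k l u v :
  graded_elt k u -> graded_elt l v -> graded_elt (k + l) (u * v).
Proof. by move=> hu hv; rewrite /graded_elt rmorphM hu hv cauchyM_homog. Qed.

Lemma graded_elt_prod (s : seq (nat * M)) :
  graded_elt (sumn [seq p.1 | p <- s]) (\prod_(p <- s) dp p.1 p.2).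
Proof.
elim: s => [|p s IHs]; first by rewrite big_nil -(rmorph1 (dp_cst M)); apply: graded_elt_cst.
by rewrite big_cons; apply: graded_eltM => //; apply: graded_elt_dp.
Qed.

Lemma dp_homog_graded n u : dp_homog n u -> graded_elt n u.
Proof.
move=> [s + ->]; rewrite /graded_elt.
elim: s => [|[a t] s IHs] /=.
  rewrite big_nil rmorph0 => _; apply/funext => k; rewrite /cauchy_homog.
  by case: ifP.
case/andP=> /eqP tn /IHs {}IHs; rewrite big_cons rmorphD IHs /=.
have := graded_eltM (graded_elt_cst a) (graded_elt_prod t).
rewrite add0n tn => ->; apply/funext => k.
set x := _ * _; set y := \sum_(_ <- _) _.
rewrite -[LHS]/(cauchy_homog n x k + cauchy_homog n y k) /cauchy_homog.
by case: ifP; rewrite ?addr0.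
Qed.

Lemma dp_homog_cst a : dp_homog 0 (dp_cst M a).
Proof. by exists [:: (a, [::])]; rewrite // big_seq1 /= big_nil mulr1. Qed.
Lemma dp_homog_dp n (m : M) : dp_homog n (dp n m).
Proof.
exists [:: (1, [:: (n, m)])]; first by rewrite /= addn0 eqxx.
by rewrite !big_seq1 rmorph1 mul1r.
Qed.
Lemma dp_homog0 n : @dp_homog R M n 0.
Proof. by exists [::]; rewrite ?big_nil. Qed.
Lemma dp_homogD n (u v : D) : dp_homog n u -> dp_homog n v -> dp_homog n (u + v).
Proof. by move=> [s hs ->] [t ht ->]; exists (s ++ t); rewrite ?all_cat ?hs // big_cat. Qed.
Lemma dp_homog_sum n (T : Type) (r : seq T) (P : pred T) (f : T -> D) :
  (forall i, P i -> dp_homog n (f i)) -> dp_homog n (\sum_(i <- r | P i) f i).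
Proof.
move=> hf; apply: big_ind => //; first exact: dp_homog0.
exact: dp_homogD.
Qed.
Lemma dp_homogM k l (u v : D) :
  dp_homog k u -> dp_homog l v -> dp_homog (k + l) (u * v).
Proof.
move=> [s hs ->] [t ht ->]; rewrite mulr_suml big_seq.
apply: dp_homog_sum => -[a x] /(allP hs) /= /eqP xk.
rewrite mulr_sumr big_seq; apply: dp_homog_sum => -[b y] /(allP ht) /= /eqP yl.
exists [:: (a * b, x ++ y)]; first by rewrite /= map_cat sumn_cat xk yl eqxx.
by rewrite big_seq1 /= big_cat rmorphM mulrACA.
Qed.

Lemma divpow_decompose (u : D) : exists N (f : nat -> D),
  (forall n, dp_homog n (f n)) /\ u = \sum_(n < N) f n.
Proof.
suff [s [hs ->]] : exists s : seq (nat * D),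
    (forall p, p \in s -> dp_homog p.1 p.2) /\ u = \sum_(p <- s) p.2.
  exists (\max_(p <- s) p.1).+1, (fun n => \sum_(p <- s | p.1 == n) p.2); split=> [n|].
    rewrite big_seq_cond; apply: dp_homog_sum => p /andP[/hs hp /eqP <-] //.
  rewrite (exchange_big_dep predT) //= big_seq [RHS]big_seq; apply: eq_bigr => p ps.
  have pN : (p.1 < (\max_(p <- s) p.1).+1)%N by rewrite ltnS; apply: leq_bigmax_seq.
  by rewrite (big_pred1 (Ordinal pN)) // => i; rewrite -val_eqE eq_sym.
elim/divpow_ind: u => [n m|a|x y [s [hs ->]] [t [ht ->]]|x y [s [hs ->]] [t [ht ->]]].
- exists [:: (n, dp n m)]; rewrite big_seq1; split=> // p.
  by rewrite inE => /eqP->; apply: dp_homog_dp.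
- exists [:: (0%N, dp_cst M a)]; rewrite big_seq1; split=> // p.
  by rewrite inE => /eqP->; apply: dp_homog_cst.
- exists (s ++ t); rewrite big_cat; split=> // p.
  by rewrite mem_cat => /orP[/hs|/ht].
- exists [seq ((p.1 + p'.1)%N, p.2 * p'.2) | p <- s, p' <- t]; split=> [p|].
    by case/allpairsP => -[p1 p2] /= [/hs h1 /ht h2 ->]; apply: dp_homogM.
  rewrite big_allpairs_dep /= mulr_suml; apply: eq_bigr => p _.
  by rewrite mulr_sumr.
Qed.

Definition tfilt_pred (k : nat) : {pred D} := fun u =>
  `[< forall i, (i < k)%N -> theta u i = 0 >].
Fact tfilt0 k : 0 \in tfilt_pred k.
Proof. by apply/asboolP => w _; rewrite rmorph0. Qed.
Fact tfiltD k x y : x \in tfilt_pred k -> y \in tfilt_pred k ->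
  x + y \in tfilt_pred k.
Proof.
move=> /asboolP hx /asboolP hy; apply/asboolP => w wk.
by rewrite rmorphD -[LHS]/(theta x w + theta y w) hx // hy // addr0.
Qed.
Fact tfiltMl k a x : x \in tfilt_pred k -> a * x \in tfilt_pred k.
Proof.
move=> /asboolP hx; apply/asboolP => i ik; rewrite rmorphM.
rewrite -[LHS]/(\sum_(l < i.+1) theta a l * theta x (i - l)%N).
apply: big1 => l _; rewrite hx ?mulr0 //; apply: leq_ltn_trans ik.
exact: leq_subr.
Qed.
Definition tfilt k : ideal D := Ideal (tfilt0 k) (@tfiltD k) (@tfiltMl k).

Lemma graded_tfilt k n u : (k <= n)%N -> graded_elt n u -> u \in tfilt k.
Proof.
move=> kn hu; apply/asboolP => i ik; rewrite hu /cauchy_homog.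
by rewrite ltn_eqF // (leq_trans ik).
Qed.

Lemma graded_tfilt_mul k n u v : graded_elt n u -> v \in tfilt k ->
  v * u \in tfilt (k + n)%N.
Proof.
move=> hu /asboolP hv; apply/asboolP => i ik; rewrite rmorphM.
rewrite -[LHS]/(\sum_(l < i.+1) theta v l * theta u (i - l)%N).
apply: big1 => -[l /= li] _; have [lk|kl] := ltnP l k; first by rewrite hv ?mul0r.
by rewrite hu /cauchy_homog ltn_eqF ?mulr0 //; lia.
Qed.

Lemma graded_tfilt_eq0 n u : graded_elt n u -> u \in tfilt n.+1 -> u = 0.
Proof.
move=> hu /asboolP/(_ n (ltnSn n)); rewrite hu /cauchy_homog eqxx.
by [].
Qed.

End DivPowGrading.

Section Comparison.
Variables (A : comPzRingType) (I : ideal A) (X : choiceType).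
Local Notation F := (freemod A X).
Local Notation e := (freemod_gen A).
Local Notation G := (divpow_alg F).
Local Notation cst := (dp_cst F).
Local Notation j := (@divpow_shuffle A X).
Local Notation GP := (divpow_pd A X).
Local Notation gamma := (pd_gamma GP).
Local Notation Gplus := (pd_ideal GP).
Local Notation filt := (@dfilt A X).
Let gP := pd_gammaP GP.
Variable phi : {linear F -> A^o}.
Hypothesis phiI : forall f, phi f \in I.
Hypothesis phi_surj : forall a, a \in I -> exists f, phi f = a.
Hypothesis eta_ex : forall us : seq F, (forall u, u \in us -> phi u = 0) ->
  exists eta, good_eta phi us eta.

Local Notation q := (env_rel phi).
Local Notation K := (env_ideal phi).

Lemma env_rel_in f : q f \in K.
Proof.
by apply/ideal_addl; rewrite -[q f]mul1r; apply/rel_span_gen/dfiltT.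
Qed.
Lemma dp_ker_in m u : phi u = 0 -> dp m.+1 u \in K.
Proof.
by move=> hu; apply/ideal_addr; rewrite -[dp _ _]mul1r; apply/dp_span_gen/dfiltT.
Qed.

Fact env_closedM (a b : nat) (x y : G) : x \in K -> y \in K -> x * y \in K.
Proof. by move=> _; apply: idealMl. Qed.
Definition env_closed : ideal G := @pd_closed GP (fun=> K) env_closedM.

Lemma env_closed_of z : z \in Gplus -> (forall n, gamma n.+1 z \in K) ->
  z \in env_closed.
Proof.
move=> zp zK; suff: z \in @pd_closed_pred GP (fun=> K) by [].
by rewrite unfold_in zp; apply/asboolP.
Qed.

Lemma env_closed_ker u : phi u = 0 -> dp 1 u \in env_closed.
Proof.
move=> hu; apply: env_closed_of => [|n]; first exact: dp_in.
by rewrite gamma_dp1 dp_ker_in.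
Qed.

Lemma sub_cst_in h : h - cst (j h [::]) \in Gplus.
Proof.
suff: j (h - cst (j h [::])) \in shuffle_aug A X by [].
by rewrite rmorphB divpow_shuffle_cst; apply/eqP/subrr.
Qed.

(* The summand q f is needed because q f lies outside the augmentation ideal
   unless phi f = 0. *)
Lemma env_ideal_split z : z \in K -> exists f z', z' \in env_closed /\ z = q f + z'.
Proof.
move=> /ideal_addP[x [s [xQ sN ->]]].
suff [f [z' [z'K ->]]] : exists f z', z' \in env_closed /\ x = q f + z'.
  exists f, (z' + s); rewrite addrA; split=> //; apply: idealD => //.
  move: s sN; apply: dp_span_ind => [|u v hu hv|h m u Pu _].
  - exact: ideal0.
  - exact: idealD.
  apply: idealMl; apply: env_closed_of => [|n]; first exact: dp_in.
  have -> : gamma n.+1 (dp m.+1 u) = (((n.+1 * m.+1)`! %/ (n.+1`! * m.+1`! ^ n.+1))%N)%:R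
      * dp (n * m.+1 + m).+1 u.
    by rewrite gamma_dp mulr_natl mulSn addnC addnS.
  by apply/idealMl/dp_ker_in.
move: x xQ; apply: rel_span_ind => [|u v [f [u' [hu ->]]] [g [v' [hv ->]]]|h f _].
- by exists 0, 0; rewrite env_rel0 addr0 ideal0.
- by exists (f + g), (u' + v'); rewrite env_relD addrACA idealD.
exists ((j h [::] : A) *: f), ((h - cst (j h [::])) * q f); split; last first.
  by rewrite env_relZ -mulrDl addrC subrK.
rewrite mulrC; apply: env_closed_of => [|n].
  exact: (idealMl _ (sub_cst_in h)).
rewrite divpow_gammaZ ?sub_cst_in // exprS -mulrA mulrC.
by apply/idealMl/env_rel_in.
Qed.

(** In the splitting z = q f + z', vanishing of the constant term of z forces phi f = 0. Then q f =
    f^[1] with f in the kernel, and its divided powers f^[n] are generators of [K]. *)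
Lemma env_gamma n z : z \in K -> z \in Gplus -> gamma n.+1 z \in K.
Proof.
move=> /env_ideal_split[f [z' [z'K zE]]] zp.
suff: z \in env_closed by case/andP => _ /asboolP.
have /andP[z'p _] := z'K.
have qp : q f \in Gplus by have -> : q f = z - z' by [rewrite zE addrK]; apply: idealB.
have f0 : phi f = 0.
  suff: cst (phi f) \in Gplus by rewrite cst_in => /eqP.
  have -> : cst (phi f) = dp 1 f - q f by rewrite /q; ring.
  by apply: idealB qp; apply: dp_in.
by rewrite zE env_rel_ker //; apply: idealD => //; apply: env_closed_ker.
Qed.

Definition env_pd : pdRing := @quot_pd GP K env_gamma.
Local Notation proj := (quot_proj K).

Lemma env_pd_gamma n z : z \in Gplus ->
  pd_gamma env_pd n (proj z) = proj (gamma n z).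
Proof. exact: (@quot_pd_gammaE GP K env_gamma). Qed.

Lemma env_pd_in z : z \in Gplus -> proj z \in pd_ideal env_pd.
Proof.
move=> zp; suff : proj z \in @quot_pd_pred GP K by [].
by apply/asboolP; exists z.
Qed.

Lemma env_pd_inP x : x \in pd_ideal env_pd -> exists2 z, z \in Gplus & x = proj z.
Proof. by move=> /asboolP. Qed.

Lemma proj_cst f : proj (cst (phi f)) = proj (dp 1 f).
Proof.
apply/quot_projP; rewrite -opprB -mulN1r; exact: idealMl (env_rel_in f).
Qed.

Definition env_unit : {rmorphism A -> env_pd} := (proj \o cst)%FUN.

Lemma env_unit_pair : pair_morphism I env_unit.
Proof.
move=> a /phi_surj[f <-]; rewrite [env_unit _]proj_cst.
by apply: env_pd_in; apply: dp_in.
Qed.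

Variables (B : pdRing) (iota : {rmorphism A -> B}).
Hypothesis env : pd_envelope I iota.
Local Notation J := (pd_ideal B).
Local Notation gammaB := (pd_gamma B).
Let bP := pd_gammaP B.
Let IJ : pair_morphism I iota := proj1 env.
Local Notation FB := (pd_filtration B).

Lemma iota_phi f : iota (phi f) \in J.
Proof. exact: IJ. Qed.

Fact divpow_env_rel : dp_rel iota (fun nf => gammaB nf.1 (iota (phi nf.2))).
Proof.
split=> [m|n a m|n m m'|i k m] /=.
- by rewrite (divp0 bP) ?iota_phi.
- by rewrite linearZ rmorphM (divpZ bP) ?iota_phi.
- by rewrite raddfD rmorphD (divpD bP) ?iota_phi.
- by rewrite (divpM bP) ?iota_phi.
Qed.
Definition divpow_env : {rmorphism G -> B} := divpow_lift divpow_env_rel.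

Lemma divpow_env_dp n f : divpow_env (dp n f) = gammaB n (iota (phi f)).
Proof. exact: divpow_lift_dp. Qed.
Lemma divpow_env_cst a : divpow_env (cst a) = iota a.
Proof. exact: divpow_lift_cst. Qed.

Lemma divpow_env_pd : @pd_morphism GP B divpow_env.
Proof.
apply: pd_compat_morphism => z; apply: divpow_aug_ind => n m.
suff: dp n.+1 m \in @pd_compat_pred GP B divpow_env by [].
rewrite unfold_in /pd_compat_pred.
have bd : divpow_env (dp n.+1 m) = gammaB n.+1 (iota (phi m)) by apply: divpow_env_dp.
apply/and3P; split; first exact: dp_in.
  by rewrite [X in X \in _]bd (divp_in bP) ?iota_phi.
apply/asboolP => k; rewrite [X in gammaB k X]bd (divp_comp bP) ?iota_phi //.
by rewrite [gamma _ _]gamma_dp [LHS]rmorphMn /= divpow_env_dp.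
Qed.

Lemma divpow_env_gamma n z : z \in Gplus -> divpow_env (gamma n z) = gammaB n (divpow_env z).
Proof. by case: divpow_env_pd => _; apply. Qed.
Lemma divpow_env_in z : z \in Gplus -> divpow_env z \in J.
Proof. by case: divpow_env_pd => h _; apply: h. Qed.

Lemma divpow_env_ideal z : z \in K -> divpow_env z = 0.
Proof.
move=> /ideal_addP[x [s [xQ sN ->]]]; rewrite rmorphD.
have -> : divpow_env x = 0.
  move: x xQ; apply: rel_span_ind => [|u v hu hv|h f _]; first exact: rmorph0.
    by rewrite rmorphD hu hv addr0.
  rewrite rmorphM rmorphB divpow_env_dp divpow_env_cst (divp1 bP) ?iota_phi //.
  by rewrite subrr mulr0.
rewrite add0r; move: s sN; apply: dp_span_ind => [|u v hu hv|h m u Pu _].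
- exact: rmorph0.
- by rewrite rmorphD hu hv addr0.
by rewrite rmorphM divpow_env_dp Pu rmorph0 pd_gamma0 mulr0.
Qed.

Definition env_to_B : {rmorphism env_pd -> B} := quot_lift divpow_env_ideal.
Lemma env_to_BE z : env_to_B (proj z) = divpow_env z.
Proof. exact: quot_liftE. Qed.

Lemma env_to_B_pd : pd_morphism env_to_B.
Proof.
split=> [x /env_pd_inP[z zp ->]|n x /env_pd_inP[z zp ->]].
  by rewrite env_to_BE divpow_env_in.
by rewrite env_pd_gamma // !env_to_BE divpow_env_gamma.
Qed.

(** The universal property of [B] for the pair morphism to G/K gives g, and its uniqueness part for
    [iota] itself shows that [env_to_B] after g is the identity. The equation for [divpow_env] is
    checked on constants and on the f^[n]. *)
Lemma env_iso : exists g : {rmorphism B -> env_pd},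
  [/\ forall x, x \in J -> g x \in pd_ideal env_pd,
      forall n x, x \in J -> g (gammaB n x) = pd_gamma env_pd n (g x),
      forall z, g (divpow_env z) = proj z & forall b, env_to_B (g b) = b].
Proof.
case: env => _ univ.
have [g [[gJ gg] gi _]] := univ env_pd env_unit env_unit_pair.
have [g0 [_ _ uniq0]] := univ B iota IJ.
exists g; split=> //.
  apply: (divpow_ext (f := (g \o divpow_env)%FUN) (g := proj)) => [a|n m] /=.
    by rewrite divpow_env_cst gi.
  rewrite divpow_env_dp gg ?iota_phi // gi [env_unit _]proj_cst.
  by rewrite env_pd_gamma ?dp_in // gamma_dp1.
move=> b; have [cJ cg] := env_to_B_pd.
have -> : env_to_B (g b) = g0 b.
  apply: (uniq0 (env_to_B \o g)%FUN) => [|a] /=.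
    split=> [x Jx|n x Jx]; first by apply/cJ/gJ.
    transitivity (env_to_B (pd_gamma env_pd n (g x))); last exact: cg (gJ x Jx).
    by rewrite -gg.
  transitivity (env_to_B (env_unit a)); first by rewrite -gi.
  by rewrite -[RHS]divpow_env_cst; apply: env_to_BE.
exact/esym/(uniq0 idfun).
Qed.

(** An element of J lifts to an element w of [Gplus] along g, and gamma_i(w) has degree at least i.
    So a product of divided powers lifts to a product of the expected degree. *)
Lemma env_filt_image b n : b \in FB n -> exists2 z, z \in filt n & b = divpow_env z.
Proof.
have [g [gJ gg gb cg]] := env_iso.
suff h : b \in FB n -> exists2 z, z \in filt n & g b = proj z.
  by move=> /h[z zn gz]; exists z; rewrite // -(cg b) gz env_to_BE.
move: b; apply: ideal_span_ind => [|x y [z zn gx] [w wn gy]|a y [s [sJ ns ->]]].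
- by exists 0; rewrite ?ideal0 ?rmorph0.
- by exists (z + w); rewrite ?idealD // !rmorphD gx gy.
have [a' ga] := quot_proj_surj (g a).
suff [z zn gz] : exists2 z, z \in filt n & g (\prod_(p <- s) gammaB p.1 p.2) = proj z.
  by exists (a' * z); rewrite ?idealMl // !rmorphM ga gz.
suff [z zn gz] : exists2 z, z \in filt (sumn [seq p.1 | p <- s]) &
    g (\prod_(p <- s) gammaB p.1 p.2) = proj z.
  by exists z => //; apply: dfilt_sub zn.
elim: s sJ {ns} => [|[i y'] s IHs] /=.
  by exists 1; rewrite ?dfiltT // big_nil !rmorph1.
case/andP=> Jy /IHs[z zn gz]; have [w wp gw] := env_pd_inP (gJ _ Jy).
exists (gamma i w * z); first by apply: dfiltM => //; apply: gamma_dfilt.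
by rewrite big_cons !rmorphM gz gg // gw env_pd_gamma.
Qed.

Lemma divpow_env_filt_proj z n : divpow_env z \in FB n -> exists2 w, w \in filt n & z - w \in K.
Proof.
move=> /env_filt_image[w wn bE]; exists w => //.
have [g [_ _ gb _]] := env_iso.
by apply/quot_projP; rewrite -!gb bE.
Qed.

Local Notation M := (conormal I).
Local Notation D := (divpow_alg M).

Definition phi_elt (f : F) : ideal_elt I := exist _ (phi f) (phiI f).
Definition phi_class (f : F) : M := conormal_class (phi_elt f).
Local Notation p := phi_class.

Lemma phi_classD f g : p (f + g) = p f + p g.
Proof. by rewrite /p -raddfD; congr conormal_class; apply/val_inj/raddfD. Qed.
Lemma phi_classZ a f : p (a *: f) = quot_proj I a *: p f.
Proof.
rewrite [RHS]conormal_scaleE; congr conormal_class; apply: val_inj.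
by rewrite /= linearZ.
Qed.
Lemma phi_class_surj (m : M) : exists f, m = p f.
Proof.
have [[a aI] ->] := conormal_class_surj m; have [f fa] := phi_surj aI.
by exists f; congr conormal_class; apply: val_inj; rewrite /= fa.
Qed.

Fact divpow_conormal_rel : dp_rel (dp_cst M \o quot_proj I)%FUN (fun nf => dp nf.1 (p nf.2)).
Proof.
split=> [m|n a m|n m m'|i k m] /=.
- exact: dp0.
- by rewrite phi_classZ dpZ.
- by rewrite phi_classD dpD.
- exact: dpM.
Qed.
Definition divpow_conormal : {rmorphism G -> D} :=
  @divpow_lift _ _ _ (dp_cst M \o quot_proj I)%FUN _ divpow_conormal_rel.

Lemma divpow_conormal_dp n f : divpow_conormal (dp n f) = dp n (p f).
Proof. exact: divpow_lift_dp. Qed.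
Lemma divpow_conormal_cst a : divpow_conormal (cst a) = dp_cst M (quot_proj I a).
Proof. exact: divpow_lift_cst. Qed.

Lemma divpow_conormal_mon v : graded_elt (size v) (divpow_conormal (mon A v)).
Proof.
rewrite -(sum_count (undup_uniq v)); last by move=> x; rewrite mem_undup.
rewrite /mon; elim: (undup v) => [|x s IHs].
  by rewrite !big_nil rmorph1 -(rmorph1 (dp_cst M)); apply: graded_elt_cst.
rewrite !big_cons rmorphM divpow_conormal_dp; apply: graded_eltM => //; exact: graded_elt_dp.
Qed.

Lemma divpow_conormal_filt k z : z \in filt k -> divpow_conormal z \in tfilt M k.
Proof.
move=> zk; have [L [cL gE]] := divpow_expand z.
rewrite (gE L cL) // rmorph_sum; apply: ideal_sum => v _; rewrite rmorphM.
have [vk|kv] := ltnP (size v) k.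
  by have /dfiltP -> := zk; rewrite // !rmorph0 mul0r ideal0.
exact/idealMl/(graded_tfilt kv)/divpow_conormal_mon.
Qed.

(** One degree is gained: q_f maps to the first divided power of the class of phi f, since phi f is
    zero in A/I, and u^[m] maps to 0. *)
Lemma divpow_conormal_env k z : z \in K -> z \in filt k -> divpow_conormal z \in tfilt M k.+1.
Proof.
move=> zK zk; have /ideal_addP[x [s [xQ sN ->]]] :=
  env_ideal_filt phiI phi_surj eta_ex zK zk.
rewrite rmorphD; apply: idealD.
  move: x xQ; apply: rel_span_ind => [|u v hu hv|h f hk].
  - by rewrite rmorph0 ideal0.
  - by rewrite rmorphD idealD.
  rewrite rmorphM rmorphB divpow_conormal_dp divpow_conormal_cst.
  have /quot_proj0 -> := phiI f; rewrite rmorph0 subr0 -[k.+1]addn1.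
  by apply: graded_tfilt_mul (divpow_conormal_filt hk); apply: graded_elt_dp.
rewrite (_ : divpow_conormal s = 0) ?ideal0 //.
move: s sN; apply: dp_span_ind => [|u v hu hv|h m u Pu _].
- exact: rmorph0.
- by rewrite rmorphD hu hv addr0.
rewrite rmorphM divpow_conormal_dp (_ : p u = 0) ?dp00 ?mulr0 //.
rewrite -(raddf0 (@conormal_class A I)); congr conormal_class.
exact: val_inj.
Qed.

Local Notation can := (canonical_map IJ).

(** Source and target of the canonical map are compared through G, which maps to Gamma(I/I^2) and to
    [B]. The membership proof is existentially quantified because [gr_class] takes it as an
    argument. *)
Definition lifts (n : nat) (z : G) : Prop :=
  [/\ z \in filt n, dp_homog n (divpow_conormal z) &
      exists h : divpow_env z \in FB n, can (divpow_conormal z) = gr_class h].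

Lemma lifts_cst a : lifts 0 (cst a).
Proof.
split; [exact: dfiltT|by rewrite divpow_conormal_cst; apply: dp_homog_cst|].
exists (filt0T FB (divpow_env (cst a))); rewrite divpow_conormal_cst canonical_map_cst.
by apply: gr_class_irr; rewrite divpow_env_cst.
Qed.

Lemma lifts_dp n f : lifts n (dp n f).
Proof.
have h : divpow_env (dp n f) \in FB n.
  by rewrite divpow_env_dp; apply/gamma_pd_power/iota_phi.
split; [exact: dp_dfilt|by rewrite divpow_conormal_dp; apply: dp_homog_dp|].
exists h; rewrite divpow_conormal_dp canonical_map_dp; apply: gr_class_irr.
by rewrite divpow_env_dp.
Qed.

Lemma lifts0 n : lifts n 0.
Proof.
have h : divpow_env 0 \in FB n by rewrite rmorph0 ideal0.
split; [exact: ideal0|by rewrite rmorph0; apply: dp_homog0|exists h].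
rewrite !rmorph0 -(gr_class0 (ideal0 (FB n))); apply: gr_class_irr.
by rewrite rmorph0.
Qed.

Lemma liftsD n x y : lifts n x -> lifts n y -> lifts n (x + y).
Proof.
move=> [xn xh [hx cx]] [yn yh [hy cy]].
have h : divpow_env (x + y) \in FB n by rewrite rmorphD; apply: idealD.
split; [exact: idealD|by rewrite rmorphD; apply: dp_homogD|exists h].
rewrite [divpow_conormal _]rmorphD [LHS]rmorphD [can (divpow_conormal x)]cx
  [can (divpow_conormal y)]cy gr_classD; apply: gr_class_irr.
by rewrite rmorphD.
Qed.

Lemma liftsM k l x y : lifts k x -> lifts l y -> lifts (k + l) (x * y).
Proof.
move=> [xn xh [hx cx]] [yn yh [hy cy]].
have h : divpow_env (x * y) \in FB (k + l)%N by rewrite rmorphM; apply: filtM.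
split; [exact: dfiltM|by rewrite rmorphM; apply: dp_homogM|exists h].
rewrite [divpow_conormal _]rmorphM [LHS]rmorphM [can (divpow_conormal x)]cx
  [can (divpow_conormal y)]cy gr_classM; apply: gr_class_irr.
by rewrite rmorphM.
Qed.

Lemma lifts_sum n (T : Type) (r : seq T) (P : pred T) (f : T -> G) :
  (forall i, P i -> lifts n (f i)) -> lifts n (\sum_(i <- r | P i) f i).
Proof.
by move=> hf; apply: big_ind => //; [apply: lifts0|apply: liftsD].
Qed.

Lemma lifts_cstM n a x : lifts n x -> lifts n (cst a * x).
Proof. by move=> hx; apply: (liftsM (lifts_cst a) hx). Qed.

Lemma lifts_mon v : lifts (size v) (mon A v).
Proof.
rewrite -(sum_count (undup_uniq v)); last by move=> x; rewrite mem_undup.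
rewrite /mon; elim: (undup v) => [|x s IHs].
  by rewrite !big_nil -(rmorph1 cst); apply: lifts_cst.
by rewrite !big_cons; apply: liftsM => //; apply: lifts_dp.
Qed.

Lemma dp_homog_lift n u : dp_homog n u -> exists2 z, lifts n z & divpow_conormal z = u.
Proof.
move=> [s + ->]; elim: s => [|[r t] s IHs] /=.
  by exists 0; rewrite ?big_nil ?rmorph0 //; apply: lifts0.
case/andP=> /eqP tn /IHs[z hz zE]; have [a ->] := quot_proj_surj r.
suff [w hw wE] : exists2 w, lifts n w & divpow_conormal w = \prod_(p <- t) dp p.1 p.2.
  exists (cst a * w + z); first by apply: liftsD => //; apply: lifts_cstM.
  by rewrite rmorphD rmorphM divpow_conormal_cst wE zE big_cons.
rewrite -tn; elim: t {tn} => [|[i m] t [w hw wE]] /=.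
  by exists 1; rewrite ?big_nil ?rmorph1 // -(rmorph1 cst); apply: lifts_cst.
have [f ->] := phi_class_surj m.
exists (dp i f * w); first by apply: liftsM => //; apply: lifts_dp.
by rewrite big_cons rmorphM divpow_conormal_dp wE.
Qed.

Lemma divpow_env_filt n z : z \in filt n -> divpow_env z \in FB n.
Proof.
move=> zn; have [L [cL gE]] := divpow_expand z.
rewrite (gE L cL) // rmorph_sum; apply: ideal_sum => v _; rewrite rmorphM.
have [vn|nv] := ltnP (size v) n.
  by have /dfiltP -> := zn; rewrite // !rmorph0 mul0r ideal0.
apply: idealMl; have [_ _ [h _]] := lifts_mon v.
rewrite -(subnKC nv) in h.
suff sub k m x : x \in FB (k + m)%N -> x \in FB k by apply: sub h.
move: x; apply: ideal_span_ind => [|a b|a y [s [sJ ks ->]]].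
- exact: (ideal0 (FB k)).
- exact: (@idealD _ (FB k)).
apply: (@idealMl _ (FB k)); apply: mem_ideal_span; exists s; split=> //.
by apply: leq_trans ks; apply: leq_addr.
Qed.

(** A preimage of degree >= n is truncated to its part of degree exactly n; the rest has degree > n
    and dies in the graded piece. *)
Lemma gr_lift n b (h : b \in FB n) : exists2 z, lifts n z & can (divpow_conormal z) = gr_class h.
Proof.
have [z zn bE] := env_filt_image h.
have [L [cL gE]] := divpow_expand z.
have {}gE := gE L cL (fun _ x => x).
pose z0 := \sum_(v <- L | size v == n) cst (j z v) * mon A v.
have hz0 : lifts n z0.
  by apply: lifts_sum => v /eqP <-; apply/lifts_cstM/lifts_mon.
exists z0 => //; have [_ _ [h0 ->]] := hz0; apply/gr_classP.
rewrite bE -rmorphB; apply: divpow_env_filt; rewrite -opprB -mulN1r; apply: idealMl.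
rewrite {1}gE (bigID (fun v => size v == n)) /= addrAC subrr add0r.
apply: (@ideal_sum _ (filt n.+1)) => v vn; have [vn'|nv|nv] := ltngtP (size v) n.
- by have /dfiltP -> := zn; rewrite // rmorph0 mul0r ideal0.
- exact/idealMl/(dfilt_sub nv)/mon_dfilt.
- by rewrite nv eqxx in vn.
Qed.

(** The image of z in [B] also comes from some w of degree > n, so z - w is in [K] and has degree >=
    n. By [divpow_conormal_env] it maps to degree > n, as does w; hence so does z, whose image is
    homogeneous of degree n. *)
Lemma lifts_inj n z b (h : b \in FB n) : lifts n z -> can (divpow_conormal z) = gr_class h ->
  b \in FB n.+1 -> divpow_conormal z = 0.
Proof.
move=> [zn zh [h' ->]] /gr_classP hb bn.
have {bn} /divpow_env_filt_proj[w wn zwK] : divpow_env z \in FB n.+1.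
  by rewrite -(subrK b (divpow_env z)); apply: (@idealD _ (FB n.+1)).
apply: (graded_tfilt_eq0 (dp_homog_graded zh)).
rewrite -(subrK w z) rmorphD; apply: idealD; last exact: divpow_conormal_filt.
apply: divpow_conormal_env => //; apply: idealB => //.
exact: dfilt_sub wn.
Qed.

Lemma gr_class_sum_eq0 N (b : nat -> B) (h : forall n, b n \in FB n) :
  \sum_(n < N) gr_class (h n) = 0 -> forall n, (n < N)%N -> b n \in FB n.+1.
Proof.
pose f n : filt_ring FB := exist _ (cauchy_homog n (b n)) (filt_seq_homog (h n)).
have valE M n : val (\sum_(k < M) f k) n = if (n < M)%N then b n else 0.
  elim: M => [|M IHM]; first by rewrite big_ord0.
  rewrite big_ord_recr -[LHS]/(val (\sum_(k < M) f k) n + cauchy_homog M (b M) n).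
  rewrite IHM /cauchy_homog ltnS [in RHS]leq_eqVlt.
  by case: (ltngtP n M) => [||->]; rewrite ?addr0 ?add0r.
move=> s0 n nN; have : quot_proj (graded_ideal FB) (\sum_(k < N) f k) = 0.
  by rewrite rmorph_sum.
by move=> /quot_proj0/asboolP/(_ n); rewrite valE nN.
Qed.

Lemma gr_decompose (x : graded FB) : exists N (b : nat -> B) (h : forall n, b n \in FB n),
  x = \sum_(n < N) gr_class (h n).
Proof.
have [f ->] := quot_proj_surj x; have [[N fN] fF] := filt_ringP f.
exists N, (val f), fF.
pose g n : filt_ring FB := exist _ (cauchy_homog n (val f n)) (filt_seq_homog (fF n)).
transitivity (quot_proj (graded_ideal FB) (\sum_(n < N) g n)); last exact: rmorph_sum.
congr quot_proj; apply: val_inj; apply/funext => n.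
have -> M : val (\sum_(k < M) g k) n = if (n < M)%N then val f n else 0.
  elim: M => [|M IHM]; first by rewrite big_ord0.
  rewrite big_ord_recr -[LHS]/(val (\sum_(k < M) g k) n + cauchy_homog M (val f M) n).
  rewrite IHM /cauchy_homog ltnS [in RHS]leq_eqVlt.
  by case: (ltngtP n M) => [||->]; rewrite ?addr0 ?add0r.
by case: ltnP => // /fN.
Qed.

Lemma canonical_map_inj : injective can.
Proof.
apply: raddf_inj => u; have [N [f [fh ->]]] := divpow_decompose u.
pose z n := projT1 (cid2 (dp_homog_lift (fh n))).
have zh n : lifts n (z n) by rewrite /z; case: cid2.
have zE n : divpow_conormal (z n) = f n by rewrite /z; case: cid2.
have h n : divpow_env (z n) \in FB n by case: (zh n) => _ _ [].
have ch n : can (f n) = gr_class (h n).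
  by rewrite -zE; case: (zh n) => _ _ [h' ->]; apply: gr_class_irr.
have cs : can (\sum_(n < N) f n) = \sum_(n < N) gr_class (h n).
  transitivity (\sum_(n < N) can (f n)); first exact: (rmorph_sum can).
  exact: eq_bigr.
move=> u0; have s0 := gr_class_sum_eq0 (etrans (esym cs) u0).
apply: big1 => n _; rewrite -zE; apply: (lifts_inj (h := h n)) => //.
  by rewrite zE ch.
exact: s0.
Qed.

Lemma canonical_map_surj x : exists u, can u = x.
Proof.
have [N [b [h ->]]] := gr_decompose x.
pose z n := projT1 (cid2 (gr_lift (h n))).
have zE n : can (divpow_conormal (z n)) = gr_class (h n) by rewrite /z; case: cid2.
exists (\sum_(n < N) divpow_conormal (z n)).
transitivity (\sum_(n < N) can (divpow_conormal (z n))); first exact: (rmorph_sum can).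
by apply: eq_bigr => n _; rewrite zE.
Qed.

Lemma canonical_map_homog n u : dp_homog n u <-> gr_homog n (can u).
Proof.
split=> [/dp_homog_lift[z [_ _ [h cE]] <-]|[b [h cu]]].
  by exists (divpow_env z), h.
(* A homogeneous preimage exists, and injectivity identifies it with u. *)
have [z [_ zh _]] := gr_lift h; rewrite -cu => /canonical_map_inj uE.
by rewrite -uE.
Qed.

Lemma canonical_map_bij : bijective can.
Proof.
pose g x := projT1 (cid (canonical_map_surj x)).
have gE x : can (g x) = x by rewrite /g; case: cid.
by exists g => // u; apply: canonical_map_inj.
Qed.

End Comparison.

(** * The cotangent complex in degrees one and two *)

Section KilledModule.
Variables (A : comPzRingType) (I : ideal A) (M : lmodType A).
Hypothesis kill : forall a (m : M), a \in I -> a *: m = 0.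

(** The proof is a parameter of the type so that the A/I-module structure can be attached to it. *)
Definition killed_mod (_ : forall a (m : M), a \in I -> a *: m = 0) : Type := M.
Local Notation K := (killed_mod kill).
HB.instance Definition _ := GRing.Zmodule.on K.
Definition killed_scale (r : quot_ring I) (m : K) : K := (repr r *: (m : M) : M).

Lemma killed_scaleE a (m : K) : killed_scale (quot_proj I a) m = (a *: (m : M) : M).
Proof.
apply/eqP; rewrite -subr_eq0 -scalerBl; apply/eqP/kill.
exact: repr_quot_proj.
Qed.

Fact killed_scaleA a b v : killed_scale a (killed_scale b v) = killed_scale (a * b) v.
Proof.
have [a' ->] := quot_proj_surj a; have [b' ->] := quot_proj_surj b.
by rewrite -rmorphM !killed_scaleE scalerA.
Qed.
Fact killed_scale1 : left_id 1 killed_scale.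
Proof. by move=> v; rewrite -(rmorph1 (quot_proj I)) killed_scaleE scale1r. Qed.
Fact killed_scaleDr : right_distributive killed_scale +%R.
Proof. by move=> a v w; apply: (scalerDr (repr a) (v : M) w). Qed.
Fact killed_scaleDl v : {morph killed_scale^~ v : a b / a + b}.
Proof.
move=> a b; have [a' ->] := quot_proj_surj a; have [b' ->] := quot_proj_surj b.
by rewrite -raddfD !killed_scaleE scalerDl.
Qed.
HB.instance Definition _ := GRing.Zmodule_isLmodule.Build (quot_ring I) K
  killed_scaleA killed_scale1 killed_scaleDr killed_scaleDl.
End KilledModule.

Section Bar.
Variables (A : comPzRingType) (I : ideal A).
Local Notation R := (quot_ring I).
Local Notation hq := (quot_proj I).
Local Notation P n := (bar hq n).
Local Notation face := (bar_face hq).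
Local Notation aug := (bar_aug hq).
Local Notation bcst := (bar_cst hq).
Local Notation L n := (cotangent hq n).

Definition bar_gen n (y : P n) : P n.+1 := free_gen A y.
Definition bd n (y : P n.+1) : L n := kaehler_d (bcst n.+1) (aug n.+1) y.
Arguments bd : clear implicits.

Lemma face0_gen n y : face n 0 (bar_gen y) = y.
Proof. by case: n y => [|n] y; apply: free_lift_gen. Qed.
Lemma faceS_gen n i y : face n.+1 i.+1 (bar_gen y) = bar_gen (face n i y).
Proof. exact: free_lift_gen. Qed.

Lemma bdD n y z : bd n (y + z) = bd n y + bd n z.
Proof. by have [h _ _] := kaehler_d_derivation (bcst n.+1) (aug n.+1); apply: h. Qed.
Lemma bdM n y z : bd n (y * z) = aug n.+1 y *: bd n z + aug n.+1 z *: bd n y.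
Proof. by have [_ h _] := kaehler_d_derivation (bcst n.+1) (aug n.+1); apply: h. Qed.
Lemma bd_cst n a : bd n (bcst n.+1 a) = 0.
Proof. by have [_ _ h] := kaehler_d_derivation (bcst n.+1) (aug n.+1); apply: h. Qed.

Lemma aug_cst n a : aug n (bcst n a) = hq a.
Proof.
elim: n => [|n IHn] //=; rewrite [X in aug n X](_ : _ = bcst n a) //.
exact: free_lift_cst.
Qed.

Lemma bd_cstM n a y : bd n (bcst n.+1 a * y) = hq a *: bd n y.
Proof. by rewrite bdM bd_cst scaler0 addr0 aug_cst. Qed.

Lemma diff_bd n y : cotangent_diff (bd n.+1 y) =
  \sum_(i < n.+2) (-1) ^+ i *: bd n (face n.+1 i y).
Proof.
by apply: eq_bigr => i _; congr (_ *: _); apply: univ_mod_liftE.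
Qed.

Lemma diff_bd0 y : cotangent_diff (bd 1 y) = bd 0 (face 1 0 y) - bd 0 (face 1 1 y).
Proof.
by rewrite diff_bd 2!big_ord_recl big_ord0 addr0 expr0 scale1r expr1 scaleN1r.
Qed.

Lemma diff_bd1 y : cotangent_diff (bd 2 y) =
  bd 1 (face 2 0 y) - bd 1 (face 2 1 y) + bd 1 (face 2 2 y).
Proof.
rewrite diff_bd 3!big_ord_recl big_ord0 addr0 expr0 scale1r expr1 scaleN1r.
by rewrite sqrrN expr1n scale1r addrA.
Qed.

Lemma diff_bd2 y : cotangent_diff (bd 3 y) =
  bd 2 (face 3 0 y) - bd 2 (face 3 1 y) + bd 2 (face 3 2 y) - bd 2 (face 3 3 y).
Proof.
rewrite diff_bd 4!big_ord_recl big_ord0 addr0 expr0 scale1r expr1 scaleN1r.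
rewrite sqrrN expr1n scale1r (_ : (-1) ^+ _ = -1 :> R); last first.
  by rewrite -signr_odd expr1.
by rewrite scaleN1r !addrA.
Qed.

(** [bar_gen] is an extra degeneracy: the faces of [y] are y, [d_0 y] and [d_1 y], and the
    hypothesis cancels the last ones. The explicit boundaries and the 2-cycle used below all come
    from this formula. *)
Lemma diff_gen_sub (y z : P 2) : face 1 1 y = face 1 1 z ->
  cotangent_diff (bd 2 (bar_gen y) - bd 2 (bar_gen z)) =
  bd 1 y - bd 1 z - (bd 1 (bar_gen (face 1 0 y)) - bd 1 (bar_gen (face 1 0 z))).
Proof.
move=> yz; rewrite [LHS]raddfB /= !diff_bd1 !face0_gen !faceS_gen yz.
by rewrite opprD addrACA subrr addr0 opprD addrACA -opprD.
Qed.

(** Since [P 1] is the free algebra A[A/I], choosing representatives lifts the augmentation to a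
    ring map into A. *)
Definition bar_section : {rmorphism P 1 -> A} :=
  free_lift (idfun : {rmorphism A -> A}) (fun r : R => repr r).

Lemma bar_section_cst a : bar_section (bcst 1 a) = a.
Proof. exact: free_lift_cst. Qed.
Lemma bar_section_gen (r : R) : bar_section (@bar_gen 0 r) = repr r.
Proof. exact: free_lift_gen. Qed.

Lemma bar_section_aug y : hq (bar_section y) = aug 1 y.
Proof.
apply: (@free_alg_ext A R R (hq \o bar_section)%FUN (aug 1)) => [a|r] /=.
  by rewrite [X in hq X](bar_section_cst a) -(aug_cst 1).
rewrite [X in hq X](bar_section_gen r) [RHS](face0_gen (n := 0)).
exact: reprK.
Qed.

(** [P 2] is simplicial degree 1. Through [bar_section], such a y becomes an edge between two
    elements of A that are congruent modulo I. *)
Definition edge_target (y : P 2) : A := bar_section (face 1 0 y).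
Definition edge_source (y : P 2) : A := bar_section (face 1 1 y).

Lemma edge_target_aug y : hq (edge_target y) = aug 2 y.
Proof. by rewrite /edge_target bar_section_aug bar_aug_face. Qed.
Lemma edge_source_aug y : hq (edge_source y) = aug 2 y.
Proof. by rewrite /edge_source bar_section_aug bar_aug_face. Qed.
Lemma edge_in y : edge_target y - edge_source y \in I.
Proof. by apply/quot_projP; rewrite edge_target_aug edge_source_aug. Qed.
Definition edge (y : P 2) : ideal_elt I := exist _ (edge_target y - edge_source y) (edge_in y).

(* The difference of two ring morphisms that agree modulo I is a derivation
   modulo I^2; on H_1 it gives the identification with I/I^2. *)
Definition edge_class (y : P 2) : conormal I := conormal_class (edge y).

Fact edge_class_rel : derivation_rel (bcst 2) (aug 2) edge_class.
Proof.
split=> [y z|y z|a]; rewrite /edge_class.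
- rewrite -raddfD; congr conormal_class; apply: val_inj => /=.
  by rewrite /edge_target /edge_source !rmorphD opprD addrACA.
- rewrite -{1}edge_target_aug -edge_source_aug ![_ *: _]conormal_scaleE -raddfD.
  congr conormal_class; apply: val_inj => /=.
  by rewrite /edge_target /edge_source !rmorphM; ring.
- rewrite -(raddf0 (@conormal_class A I)); congr conormal_class; apply: val_inj => /=.
  by rewrite /edge_target /edge_source !bar_face_cst subrr.
Qed.

Definition cotangent_conormal : {linear L 1 -> conormal I} := univ_mod_lift edge_class_rel.
Lemma cotangent_conormalE y : cotangent_conormal (bd 1 y) = edge_class y.
Proof. exact: univ_mod_liftE. Qed.

Lemma cotangent_conormal_diff (x : L 2) : cotangent_conormal (cotangent_diff x) = 0.
Proof.
elim/univ_mod_ind: x => [y|u v hu hv|a u hu|].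
- rewrite -[univ_mod_gen _ _]/(bd 2 y) diff_bd1 raddfD raddfB /= !cotangent_conormalE.
  rewrite -raddfB -raddfD -(raddf0 (@conormal_class A I)).
  congr conormal_class; apply: val_inj => /=.
  rewrite /edge_target /edge_source (bar_faceC (h := hq) (i := 0) (j := 0)) //.
  rewrite (bar_faceC (h := hq) (i := 0) (j := 1)) //.
  rewrite (bar_faceC (h := hq) (i := 1) (j := 1)) //; ring.
- by rewrite !raddfD /= hu hv addr0.
- by rewrite !linearZ /= hu scaler0.
- by rewrite !raddf0.
Qed.

Local Notation ca a := (bar_gen (bcst 1 a)).

(** For a in I the faces of [a] are the constant a, whose differential is 0, and [0]; subtracting
    the term of 0 cancels the latter. In H_1 this cycle corresponds to the class of a in I/I^2. *)
Definition ideal_cycle (a : A) : L 1 := bd 1 (ca a) - bd 1 (ca 0).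

Lemma face1_ca a : a \in I -> face 1 1 (ca a) = @bar_gen 0 (0 : R).
Proof.
move=> aI; rewrite faceS_gen bar_face_cst; congr (bar_gen _).
exact/quot_proj0.
Qed.

Lemma ideal_cycle_closed a : a \in I -> ideal_cycle a \in @cotangent_cycle A R hq 1.
Proof.
move=> aI; apply/eqP; rewrite /ideal_cycle raddfB /= !diff_bd0 !face0_gen.
by rewrite !face1_ca ?ideal0 // !bd_cst subrr.
Qed.

(** The 2-chain is [[a] + [b]] - [[0] + [0]]: the face d_0 evaluates the inner sums to a + b and 0,
    while d_1 does not distinguish them. *)
Lemma ideal_cycleD a b : a \in I -> b \in I ->
  exists x, cotangent_diff x = ideal_cycle a + ideal_cycle b - ideal_cycle (a + b).
Proof.
move=> aI bI; exists (bd 2 (bar_gen (ca a + ca b)) - bd 2 (bar_gen (ca 0 + ca 0))).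
rewrite diff_gen_sub; last by rewrite !rmorphD !face1_ca ?ideal0.
rewrite !rmorphD !face0_gen -!rmorphD addr0 !bdD /ideal_cycle.
by rewrite opprD addrACA.
Qed.

Lemma ideal_cycleZ t a : a \in I ->
  exists x, cotangent_diff x = hq t *: ideal_cycle a - ideal_cycle (t * a).
Proof.
move=> aI; exists (bd 2 (bar_gen (bcst 2 t * ca a)) - bd 2 (bar_gen (bcst 2 t * ca 0))).
rewrite diff_gen_sub; last by rewrite !rmorphM !face1_ca ?ideal0.
rewrite !rmorphM !face0_gen !bar_face_cst -!rmorphM mulr0 !bd_cstM.
by rewrite scalerBr.
Qed.

Local Notation H1 := (cotangent_homology hq 1).

Definition mk_cycle n (x : L n) (h : x \in @cotangent_cycle A R hq n) : cycle_type hq n :=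
  exist _ x h.

Definition cycle_class n (c : cycle_type hq n) : cotangent_homology hq n :=
  quot_mod_proj (Submodule (@cotangent_boundary_closed A R hq n)) c.

Definition ideal_cycle_class (x : ideal_elt I) : H1 :=
  cycle_class (mk_cycle (ideal_cycle_closed (valP x))).

Lemma cycle_classP n (c d : cycle_type hq n) :
  cycle_class c = cycle_class d <-> exists x, cotangent_diff x = val c - val d.
Proof. by rewrite quot_mod_projP; split=> [/asboolP|h //]; last apply/asboolP. Qed.

Lemma ideal_cycle_classD x y :
  ideal_cycle_class (x + y) = ideal_cycle_class x + ideal_cycle_class y.
Proof.
apply/esym; rewrite /ideal_cycle_class -[LHS]raddfD; apply/cycle_classP.
exact: ideal_cycleD (valP x) (valP y).
Qed.
Lemma ideal_cycle_class0 : ideal_cycle_class 0 = 0.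
Proof.
have h : ideal_cycle_class 0 + ideal_cycle_class 0 = ideal_cycle_class 0 + 0.
  by rewrite -ideal_cycle_classD [RHS]addr0; congr ideal_cycle_class; apply: addr0.
exact: addrI h.
Qed.
Lemma ideal_cycle_classZ t x :
  ideal_cycle_class (ideal_elt_scale t x) = hq t *: ideal_cycle_class x.
Proof.
apply/esym; rewrite [LHS]quot_mod_scaleE; apply/cycle_classP.
exact: ideal_cycleZ (valP x).
Qed.

Definition homology_conormal (m : H1) : conormal I := cotangent_conormal (val (repr m)).

Lemma homology_conormal_class c : homology_conormal (cycle_class c) = cotangent_conormal (val c).
Proof.
have /cycle_classP[x dx] : cycle_class (repr (cycle_class c)) = cycle_class c.
  exact: reprK.
by apply/eqP; rewrite -subr_eq0 -raddfB /= -dx cotangent_conormal_diff.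
Qed.

Lemma homology_conormalD m n :
  homology_conormal (m + n) = homology_conormal m + homology_conormal n.
Proof.
have [c ->] := quot_mod_proj_surj m; have [d ->] := quot_mod_proj_surj n.
rewrite -!/(cycle_class _) -[cycle_class c + _]raddfD !homology_conormal_class.
exact: raddfD.
Qed.
Lemma homology_conormalZ t m : homology_conormal (t *: m) = t *: homology_conormal m.
Proof.
have [c ->] := quot_mod_proj_surj m; rewrite [t *: _]quot_mod_scaleE.
rewrite -!/(cycle_class _) !homology_conormal_class; exact: linearZ.
Qed.

(** Both edges start at the chosen representative of 0 in A/I, which need not be 0; it cancels in
    the difference. *)
Lemma homology_conormal_cycle x : homology_conormal (ideal_cycle_class x) = conormal_class x.
Proof.
rewrite homology_conormal_class /= /ideal_cycle raddfB /= !cotangent_conormalE -raddfB.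
congr conormal_class.
apply: val_inj => /=; rewrite /edge_target /edge_source !face0_gen !face1_ca ?ideal0 ?(valP x) //.
by rewrite !bar_section_cst; ring.
Qed.

End Bar.

(** * Koszul relations from the vanishing of H_2 *)

Section InIM.
Variables (A : comPzRingType) (I : ideal A) (M : lmodType A).
Inductive in_IM : M -> Prop :=
  | InIM0 : in_IM 0
  | InIMD x y : in_IM x -> in_IM y -> in_IM (x + y)
  | InIMgen a x : a \in I -> in_IM (a *: x).
Lemma InIMZ b x : in_IM x -> in_IM (b *: x).
Proof.
elim=> [|{}x y _ hx _ hy|a {}x aI].
- by rewrite scaler0; apply: InIM0.
- by rewrite scalerDr; apply: InIMD.
- by rewrite scalerA mulrC -scalerA; apply: InIMgen.
Qed.
End InIM.

Lemma in_IM_linear (A : comPzRingType) (I : ideal A) (M N : lmodType A)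
    (f : {linear M -> N}) x : in_IM I x -> in_IM I (f x).
Proof.
elim=> [|{}x y _ hx _ hy|a {}x aI].
- by rewrite raddf0; apply: InIM0.
- by rewrite raddfD; apply: InIMD.
- by rewrite linearZ; apply: InIMgen.
Qed.

Section KoszulRing.
Variables (A : comPzRingType) (M : lmodType A) (phi : {linear M -> A^o}).

Definition koszul_pred : {pred M} := fun x => `[< koszul phi x >].
Fact koszul_closed : submod_closed koszul_pred.
Proof.
split=> [|a x y /asboolP kx /asboolP ky]; apply/asboolP; first exact: Koszul0.
by apply: KoszulD => //; apply: KoszulZ.
Qed.
Definition koszul_mod : lmodType A := quot_mod (Submodule koszul_closed).
Definition koszul_proj (x : M) : koszul_mod :=
  quot_mod_proj (Submodule koszul_closed) x.
Local Notation Q := koszul_mod.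
Local Notation pr := koszul_proj.

Lemma koszul_projP x y : pr x = pr y <-> koszul phi (x - y).
Proof. by rewrite quot_mod_projP; split=> [/asboolP|h] //; apply/asboolP. Qed.
Lemma koszul_projD x y : pr (x + y) = pr x + pr y.
Proof. exact: raddfD. Qed.
Lemma koszul_projZ a x : pr (a *: x) = a *: pr x.
Proof. by rewrite [RHS]quot_mod_scaleE. Qed.
Lemma koszul_proj_surj q : exists x, q = pr x.
Proof. exact: quot_mod_proj_surj. Qed.

Definition koszul_phi (q : Q) : A := phi (repr q).
Lemma koszul_phiE x : koszul_phi (pr x) = phi x.
Proof.
apply/eqP; rewrite -subr_eq0; apply/eqP.
have /koszul_projP/koszul_ker : pr (repr (pr x)) = pr x by apply: reprK.
by rewrite raddfB.
Qed.
Fact koszul_phi_linear : linear (koszul_phi : Q -> A^o).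
Proof.
move=> a q r; have [x ->] := koszul_proj_surj q; have [y ->] := koszul_proj_surj r.
by rewrite -koszul_projZ -koszul_projD !koszul_phiE linearP.
Qed.
HB.instance Definition _ := GRing.isLinear.Build A Q A^o *:%R koszul_phi
  koszul_phi_linear.

(** This is what dividing by the Koszul relations achieves; it makes [koszul_mul] commutative
    although its last term is not symmetric. *)
Lemma koszul_phiC q r : koszul_phi q *: r = koszul_phi r *: q.
Proof.
have [x ->] := koszul_proj_surj q; have [y ->] := koszul_proj_surj r.
rewrite !koszul_phiE -!koszul_projZ; apply/koszul_projP; exact: KoszulGen.
Qed.
Lemma koszul_phiD q r : koszul_phi (q + r) = koszul_phi q + koszul_phi r.
Proof. exact: raddfD. Qed.
Lemma koszul_phiB q r : koszul_phi (q - r) = koszul_phi q - koszul_phi r.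
Proof. exact: raddfB. Qed.
Lemma koszul_phi0 : koszul_phi 0 = 0.
Proof. exact: raddf0. Qed.
Lemma koszul_phiZ a q : koszul_phi (a *: q) = a * koszul_phi q.
Proof.
have [x ->] := koszul_proj_surj q.
by rewrite -koszul_projZ !koszul_phiE linearZ.
Qed.

(* The arrows (a, q) : a -> a + phi q of a groupoid in rings with objects A *)
Definition koszul_ring : Type := (A * Q)%type.
HB.instance Definition _ := GRing.Zmodule.on koszul_ring.
Local Notation E := koszul_ring.
(** The second component lifts (a + phi q)(b + phi r) - ab along [koszul_phi], so that sources and
    targets both multiply. *)
Definition koszul_mul (u v : E) : E :=
  (u.1 * v.1, u.1 *: v.2 + v.1 *: u.2 + koszul_phi u.2 *: v.2).

Fact koszul_mulC : commutative koszul_mul.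
Proof.
move=> [a q] [b r]; congr pair => /=; first exact: mulrC.
by rewrite koszul_phiC [X in X + _]addrC.
Qed.
Fact koszul_mulA : associative koszul_mul.
Proof.
move=> [a q] [b r] [c s]; congr pair => /=; first exact: mulrA.
rewrite !koszul_phiD !koszul_phiZ !scalerDr !scalerDl !scalerA.
rewrite ![c * _]mulrC [koszul_phi q * b]mulrC.
by rewrite (AC (3*1*3) (1*(2*4*6)*(3*5*7))).
Qed.
Fact koszul_mul1 : left_id ((1, 0) : E) koszul_mul.
Proof.
move=> [a q]; congr pair => /=; first exact: mul1r.
by rewrite scale1r scaler0 addr0 (raddf0 koszul_phi) scale0r addr0.
Qed.
Fact koszul_mulD : left_distributive koszul_mul +%R.
Proof.
move=> [a q] [b r] [c s]; congr pair => /=; first exact: mulrDl.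
rewrite koszul_phiD !scalerDr !scalerDl.
by rewrite (AC (2*2*2) (1*3*5*(2*4*6))).
Qed.
HB.instance Definition _ := GRing.Zmodule_isComPzRing.Build E
  koszul_mulA koszul_mulC koszul_mul1 koszul_mulD.

Definition koszul_src (u : E) : A := u.1.
Fact koszul_src_zmod : zmod_morphism koszul_src.
Proof. by []. Qed.
HB.instance Definition _ := GRing.isZmodMorphism.Build E A koszul_src koszul_src_zmod.
Fact koszul_src_monoid : monoid_morphism koszul_src.
Proof. by []. Qed.
HB.instance Definition _ := GRing.isMonoidMorphism.Build E A koszul_src
  koszul_src_monoid.

Definition koszul_tgt (u : E) : A := u.1 + koszul_phi u.2.
Fact koszul_tgt_zmod : zmod_morphism koszul_tgt.
Proof.
move=> [a q] [b r]; rewrite /koszul_tgt /= -[in LHS]scaleN1r koszul_phiD koszul_phiZ.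
by rewrite mulN1r opprD addrACA.
Qed.
HB.instance Definition _ := GRing.isZmodMorphism.Build E A koszul_tgt koszul_tgt_zmod.
Fact koszul_tgt_monoid : monoid_morphism koszul_tgt.
Proof.
split=> [|[a q] [b r]]; rewrite /koszul_tgt /=.
  by rewrite (raddf0 koszul_phi) addr0.
by rewrite !koszul_phiD !koszul_phiZ; ring.
Qed.
HB.instance Definition _ := GRing.isMonoidMorphism.Build E A koszul_tgt
  koszul_tgt_monoid.

Definition koszul_unit (a : A) : E := (a, 0).
Fact koszul_unit_zmod : zmod_morphism koszul_unit.
Proof. by move=> a b; congr pair; rewrite subr0. Qed.
HB.instance Definition _ := GRing.isZmodMorphism.Build A E koszul_unit
  koszul_unit_zmod.
Fact koszul_unit_monoid : monoid_morphism koszul_unit.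
Proof.
by split=> // a b; congr pair; rewrite /= !scaler0 !addr0.
Qed.
HB.instance Definition _ := GRing.isMonoidMorphism.Build A E koszul_unit
  koszul_unit_monoid.

Definition koszul_arrow (u : E) : Q := u.2.
Fact koszul_arrow_zmod : zmod_morphism koszul_arrow.
Proof. by []. Qed.
HB.instance Definition _ := GRing.isZmodMorphism.Build E Q koszul_arrow
  koszul_arrow_zmod.

Lemma koszul_phi_arrow u : koszul_phi (koszul_arrow u) = koszul_tgt u - koszul_src u.
Proof. by rewrite /koszul_tgt /koszul_src addrC addKr. Qed.

Lemma koszul_arrowM u v : koszul_arrow (u * v) =
  koszul_tgt u *: koszul_arrow v + koszul_src v *: koszul_arrow u.
Proof. by rewrite /koszul_tgt scalerDl addrAC. Qed.

End KoszulRing.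

Section SecondHomology.
Variables (A : comPzRingType) (I : ideal A).
Local Notation R := (quot_ring I).
Local Notation hq := (quot_proj I).
Local Notation P n := (bar hq n).
Local Notation face := (bar_face hq).
Local Notation aug := (bar_aug hq).
Local Notation bcst := (bar_cst hq).
Local Notation L n := (cotangent hq n).
Local Notation F := (freemod A (ideal_elt I)).
Local Notation e := (freemod_gen A).
Local Notation edge_target := (@edge_target A I).
Local Notation edge_source := (@edge_source A I).
Local Notation edge := (@edge A I).
Local Notation bd := (@bd A I).
Local Notation bar_section := (@bar_section A I).

Definition ideal_phi : {linear F -> A^o} :=
  freemod_lift (fun x : ideal_elt I => val x : A^o).
Local Notation phi := ideal_phi.
Local Notation Q := (koszul_mod phi).
Local Notation pr := (@koszul_proj _ _ phi).
Local Notation E := (koszul_ring phi).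
Local Notation src := (@koszul_src _ _ phi).
Local Notation tgt := (@koszul_tgt _ _ phi).
Local Notation arr := (@koszul_arrow _ _ phi).

Lemma ideal_phi_gen x : phi (e x) = val x.
Proof. exact: freemod_liftE. Qed.

Lemma ideal_phi_in f : phi f \in I.
Proof.
elim/freemod_ind: f => [x|f g hf hg|a f hf|].
- by rewrite ideal_phi_gen; apply: valP.
- by rewrite raddfD; apply: idealD.
- by rewrite linearZ; apply: idealMl.
- by rewrite raddf0; apply: ideal0.
Qed.

Lemma ideal_phi_surj a : a \in I -> exists f, phi f = a.
Proof. by move=> aI; exists (e (exist _ a aI)); rewrite ideal_phi_gen. Qed.

Lemma koszul_ideal_ker a u : a \in I -> phi u = 0 -> koszul phi (a *: u).
Proof.
move=> /ideal_phi_surj[f <-] u0; have := KoszulGen phi f u.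
by rewrite u0 scale0r subr0.
Qed.

(** As [P 2] is free over A, a generator [y] may be sent to any arrow; with this choice source and
    target are the two faces followed by [bar_section]. *)
Definition arrows : {rmorphism P 2 -> E} :=
  free_lift (koszul_unit phi : {rmorphism A -> E})
    (fun y : P 1 => (edge_source (bar_gen y), pr (e (edge (bar_gen y)))) : E).

Lemma arrows_cst a : arrows (bcst 2 a) = koszul_unit phi a.
Proof. exact: free_lift_cst. Qed.
Lemma arrows_gen (y : P 1) :
  arrows (bar_gen y) = (edge_source (bar_gen y), pr (e (edge (bar_gen y)))).
Proof. exact: free_lift_gen. Qed.

Lemma src_arrows y : src (arrows y) = edge_source y.
Proof.
apply: (@free_alg_ext A (P 1) A (src \o arrows)%FUN (bar_section \o face 1 1)%FUN) => [a|z].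
  change (src (arrows (bcst 2 a)) = bar_section (face 1 1 (bcst 2 a))).
  by rewrite arrows_cst bar_face_cst bar_section_cst.
change (src (arrows (bar_gen z)) = edge_source (bar_gen z)).
by rewrite arrows_gen.
Qed.

Lemma tgt_arrows y : tgt (arrows y) = edge_target y.
Proof.
apply: (@free_alg_ext A (P 1) A (tgt \o arrows)%FUN (bar_section \o face 1 0)%FUN) => [a|z].
  change (tgt (arrows (bcst 2 a)) = bar_section (face 1 0 (bcst 2 a))).
  by rewrite arrows_cst bar_face_cst bar_section_cst /koszul_tgt koszul_phi0 addr0.
change (tgt (arrows (bar_gen z)) = edge_target (bar_gen z)).
rewrite arrows_gen /koszul_tgt [X in _ + X]koszul_phiE ideal_phi_gen.
by rewrite [LHS]addrC subrK.
Qed.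

Definition arrow (y : P 2) : Q := arr (arrows y).
Lemma arrowD y z : arrow (y + z) = arrow y + arrow z.
Proof. by rewrite /arrow rmorphD raddfD. Qed.
Lemma arrow_phi y : koszul_phi (arrow y) = edge_target y - edge_source y.
Proof. by rewrite /arrow koszul_phi_arrow src_arrows tgt_arrows. Qed.
Lemma arrowM y z : arrow (y * z) = edge_target y *: arrow z + edge_source z *: arrow y.
Proof. by rewrite /arrow rmorphM koszul_arrowM src_arrows tgt_arrows. Qed.
Lemma arrow_cst a : arrow (bcst 2 a) = 0.
Proof. by rewrite /arrow arrows_cst. Qed.
Lemma arrow_gen (y : P 1) : arrow (bar_gen y) = pr (e (edge (bar_gen y))).
Proof. by rewrite /arrow arrows_gen. Qed.

Lemma arrow_cstM a y : arrow (bcst 2 a * y) = a *: arrow y.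
Proof.
rewrite arrowM arrow_cst scaler0 addr0; congr (_ *: _).
by rewrite /edge_target bar_face_cst bar_section_cst.
Qed.

(* H_1 of the Koszul complex *)
Definition loops : Type := {v : Q | koszul_phi v == 0}.
HB.instance Definition _ := SubChoice.on loops.
Fact loops_closed : submod_closed (fun v : Q => koszul_phi v == 0).
Proof.
split=> [|a v w /eqP hv /eqP hw]; first by apply/eqP; exact: koszul_phi0.
by apply/eqP; rewrite koszul_phiD koszul_phiZ hv hw mulr0 addr0.
Qed.
HB.instance Definition _ := GRing.SubChoice_isSubLmodule.Build A Q
  (fun v : Q => koszul_phi v == 0) loops loops_closed.

Lemma loops_kill a (v : loops) : a \in I -> a *: v = 0.
Proof.
move=> /ideal_phi_surj[f <-]; apply: val_inj.
rewrite linearZ /= -(koszul_phiE phi) koszul_phiC.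
by have /eqP -> := valP v; rewrite scale0r.
Qed.
Local Notation W := (killed_mod loops_kill).

Definition vertex0 (z : P 3) : A := edge_target (face 2 0 z).
Definition vertex1 (z : P 3) : A := edge_source (face 2 0 z).
Definition vertex2 (z : P 3) : A := edge_source (face 2 1 z).
Lemma edge_target_1 z : edge_target (face 2 1 z) = vertex0 z.
Proof. by rewrite /vertex0 /edge_target (bar_faceC (h := hq) (i := 0) (j := 0)). Qed.
Lemma edge_target_2 z : edge_target (face 2 2 z) = vertex1 z.
Proof. by rewrite /vertex1 /edge_target (bar_faceC (h := hq) (i := 0) (j := 1)). Qed.
Lemma edge_source_2 z : edge_source (face 2 2 z) = vertex2 z.
Proof. by rewrite /vertex2 /edge_source (bar_faceC (h := hq) (i := 1) (j := 1)). Qed.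

(* The defect of arrows from being a map of simplicial rings to the nerve of the
   groupoid; it is a derivation because phi q *: r = phi r *: q. *)
Definition triangle (z : P 3) : Q :=
  arrow (face 2 0 z) - arrow (face 2 1 z) + arrow (face 2 2 z).
Lemma triangle_loop z : koszul_phi (triangle z) == 0.
Proof.
rewrite /triangle koszul_phiD koszul_phiB !arrow_phi.
apply/eqP; rewrite edge_target_1 edge_target_2 edge_source_2.
by rewrite -!/(vertex0 _) -!/(vertex1 _) -!/(vertex2 _); ring.
Qed.

Definition triangle_loops (z : P 3) : W := (exist _ (triangle z) (triangle_loop z) : loops).

Lemma triangleM y z : triangle (y * z) =
  vertex0 y *: triangle z + vertex2 z *: triangle y.
Proof.
rewrite /triangle !rmorphM !arrowM edge_target_1 edge_target_2 edge_source_2.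
rewrite -!/(vertex0 _) -!/(vertex1 _) -!/(vertex2 _).
set a0 := arrow (face 2 0 y); set b0 := arrow (face 2 0 z).
set a1 := arrow (face 2 1 y); set b1 := arrow (face 2 1 z).
set a2 := arrow (face 2 2 y); set b2 := arrow (face 2 2 z).
(* Compared with the claim, face 0 carries [vertex1 z] instead of [vertex2 z] and face 2 carries
   [vertex1 y] instead of [vertex0 y]. These two errors compensate each other. *)
have h : (vertex0 y - vertex1 y) *: b2 = (vertex1 z - vertex2 z) *: a0.
  have -> : vertex0 y - vertex1 y = koszul_phi a0 by rewrite arrow_phi.
  have -> : vertex1 z - vertex2 z = koszul_phi b2 by rewrite arrow_phi edge_target_2 edge_source_2.
  exact: koszul_phiC.
have h1 : vertex1 y *: b2 = vertex0 y *: b2 - (vertex0 y - vertex1 y) *: b2.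
  by rewrite scalerBl opprB addrC subrK.
have h2 : vertex1 z *: a0 = vertex2 z *: a0 + (vertex1 z - vertex2 z) *: a0.
  by rewrite scalerBl addrC subrK.
rewrite h1 h2 h !scalerDr !scalerN opprD.
by rewrite [LHS](AC ((1*2)*2*(2*1))%AC (1*4*6*(2*5*8)*(3*7))%AC) /= subrr addr0.
Qed.

Lemma triangleD y z : triangle (y + z) = triangle y + triangle z.
Proof.
rewrite /triangle !rmorphD !arrowD opprD.
by rewrite [LHS](AC (2*2*2)%AC ((1*3*5)*(2*4*6))%AC).
Qed.

Fact triangle_rel : derivation_rel (bcst 3) (aug 3) triangle_loops.
Proof.
split=> [y z|y z|a].
- by apply: (val_inj : injective (val : loops -> Q)); apply: triangleD.
- have augE (w : P 3) i : aug 3 w = hq (edge_target (face 2 i w)).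
    by rewrite edge_target_aug bar_aug_face.
  have augE1 (w : P 3) i : aug 3 w = hq (edge_source (face 2 i w)).
    by rewrite edge_source_aug bar_aug_face.
  (* All vertices agree modulo I, which kills the loops, so the scalars may be computed at the
     vertices that occur in [triangleM]. *)
  rewrite (augE y 0%N) (augE1 z 1%N) [X in _ = X + _]killed_scaleE [X in _ = _ + X]killed_scaleE.
  apply: (val_inj : injective (val : loops -> Q)); exact: triangleM.
- apply: (val_inj : injective (val : loops -> Q)) => /=.
  by rewrite /triangle !bar_face_cst !arrow_cst subrr addr0.
Qed.

Definition cotangent_loops : {linear L 2 -> W} := univ_mod_lift triangle_rel.
Lemma cotangent_loopsE y : cotangent_loops (bd y) = triangle_loops y.
Proof. exact: univ_mod_liftE. Qed.

Lemma triangle_boundary (z : P 4) :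
  triangle (face 3 0 z) - triangle (face 3 1 z) + triangle (face 3 2 z)
    - triangle (face 3 3 z) = 0.
Proof.
rewrite /triangle.
rewrite (bar_faceC (h := hq) (n := 2) (i := 0) (j := 0)) //.
rewrite (bar_faceC (h := hq) (n := 2) (i := 0) (j := 1)) //.
rewrite (bar_faceC (h := hq) (n := 2) (i := 0) (j := 2)) //.
rewrite (bar_faceC (h := hq) (n := 2) (i := 1) (j := 1)) //.
rewrite (bar_faceC (h := hq) (n := 2) (i := 1) (j := 2)) //.
rewrite (bar_faceC (h := hq) (n := 2) (i := 2) (j := 2)) //.
rewrite !opprD !opprK.
rewrite [LHS](AC (3*3*3*3)%AC ((1*4)*(2*7)*(3*10)*(5*8)*(6*11)*(9*12))%AC).
by rewrite /= !subrr !addNr !addr0.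
Qed.

Lemma cotangent_loops_diff (x : L 3) : cotangent_loops (cotangent_diff x) = 0.
Proof.
elim/univ_mod_ind: x => [y|u v hu hv|a u hu|].
- rewrite -[univ_mod_gen _ _]/(bd y) diff_bd2 raddfB raddfD raddfB /= !cotangent_loopsE.
  apply: (val_inj : injective (val : loops -> Q)); exact: triangle_boundary.
- by rewrite !raddfD /= hu hv addr0.
- by rewrite !linearZ /= hu scaler0.
- by rewrite !raddf0.
Qed.

Lemma in_IM_list (f : F) : in_IM I f -> exists s : seq (A * ideal_elt I),
  (forall p, p \in s -> p.1 \in I) /\ f = \sum_(p <- s) p.1 *: e p.2.
Proof.
elim=> [|x y _ [s [hs ->]] _ [t [ht ->]]|a x aI].
- by exists [::]; rewrite big_nil.
- exists (s ++ t); rewrite big_cat; split=> // p.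
  by rewrite mem_cat => /orP[/hs|/ht].
have [s [c [_ ->]]] := freemod_normal x.
exists [seq (a * c x, x) | x <- s]; split=> [p /mapP[y _ ->]|]; first exact: idealMr.
by rewrite big_map scaler_sumr; apply: eq_bigr => y _; rewrite scalerA.
Qed.

Local Notation ca a := (bar_gen (bcst 1 a)).

(** A relation sum a_i x_i = 0 with a_i in I yields a 2-cycle. It is a boundary by hypothesis, so
    [cotangent_loops] vanishes on it, and its value there is the class of u modulo Koszul relations,
    up to elements of I ker(phi). *)
Lemma second_homology_koszul (u : F) :
  (forall x : cotangent_homology hq 2, x = 0) ->
  phi u = 0 -> in_IM I u -> koszul phi u.
Proof.
move=> H2 u0 /in_IM_list[s [sI uE]].
(* The chains y = sum a_i [x_i] and y' = sum a_i [0] have the same two faces, the d_0 faces because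
   sum a_i x_i = 0. Both have zero differential since the a_i vanish in A/I, so [y] - [y'] gives a
   cycle. *)
pose y := \sum_(p <- s) bcst 2 p.1 * ca (val p.2).
pose y' := \sum_(p <- s) bcst 2 p.1 * ca 0.
have f1 : face 1 1 y = face 1 1 y'.
  rewrite /y /y' !rmorph_sum; apply: eq_bigr => p _; rewrite !rmorphM; congr (_ * _).
  by rewrite !face1_ca ?ideal0 //; apply: valP.
have bd0 (z : ideal_elt I -> P 1) : bd (\sum_(p <- s) bcst 2 p.1 * bar_gen (z p.2)) = 0.
  rewrite big_seq; apply: (@big_ind _ (fun t => bd t = 0)) => [|t t' ht ht'|p ps].
  - by rewrite -(rmorph0 (bcst 2)) bd_cst.
  - by rewrite bdD ht ht' addr0.
  by rewrite bd_cstM (_ : hq p.1 = 0) ?scale0r //; apply/quot_proj0/sI.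
have f0 (z : ideal_elt I -> A) : \sum_(p <- s) p.1 * z p.2 = 0 ->
    face 1 0 (\sum_(p <- s) bcst 2 p.1 * ca (z p.2)) = bcst 1 0.
  move=> <-; rewrite !rmorph_sum; apply: eq_bigr => p _.
  by rewrite rmorphM bar_face_cst face0_gen -rmorphM.
have fy : face 1 0 y = face 1 0 y'.
  rewrite (f0 (fun x => val x)) ?(f0 (fun=> 0)) //.
    by rewrite big1 // => p _; rewrite mulr0.
  transitivity (\sum_(p <- s) (phi (p.1 *: e p.2) : A)).
    by apply: eq_bigr => p _; rewrite linearZ /= ideal_phi_gen.
  by rewrite -[RHS]u0 uE; apply/esym/(raddf_sum phi).
pose c := bd (bar_gen y) - bd (bar_gen y').
have cz : cotangent_diff c = 0.
  rewrite diff_gen_sub // fy subrr subr0.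
  have -> : bd y = 0 by apply: (bd0 (fun x => bcst 1 (val x))).
  have -> : bd y' = 0 by apply: (bd0 (fun=> bcst 1 0)).
  exact: subrr.
have cc : c \in @cotangent_cycle A R hq 2 by apply/eqP.
have /cycle_classP[x dx] : cycle_class (mk_cycle cc) = cycle_class 0.
  by rewrite [LHS]H2 [RHS]H2.
have tc : cotangent_loops c = 0 by rewrite -[c]subr0 -[c - 0]dx cotangent_loops_diff.
have {tc} : triangle (bar_gen y) = triangle (bar_gen y').
  have : triangle_loops (bar_gen y) - triangle_loops (bar_gen y') = 0.
    by rewrite -!cotangent_loopsE -raddfB.
  by move=> /eqP; rewrite subr_eq0 => /eqP/(congr1 (val : loops -> Q)).
rewrite /triangle !face0_gen !faceS_gen fy f1 => /addIr/addIr.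
have arr_sum (z : ideal_elt I -> P 1) :
    arrow (\sum_(p <- s) bcst 2 p.1 * bar_gen (z p.2)) =
    pr (\sum_(p <- s) p.1 *: e (edge (bar_gen (z p.2)))).
  elim: (s) => [|p t IHt].
    by rewrite !big_nil -(rmorph0 (bcst 2)) arrow_cst; apply/esym/raddf0.
  rewrite !big_cons arrowD arrow_cstM arrow_gen IHt.
  by rewrite koszul_projD koszul_projZ.
rewrite /y /y' (arr_sum (fun x => bcst 1 (val x))) (arr_sum (fun=> bcst 1 0)).
move=> /koszul_projP; rewrite -sumrB => k1.
(* The edges start at the representative r of 0, so [S] involves the generators of x - r and of -r
   instead of x. The correction is a sum of a_i w_i with phi w_i = 0, and such terms are Koszul
   because a_i is in I. *)
rewrite uE; set S := \sum_(p <- s) _ in k1.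
rewrite -[X in koszul _ X](subrK S) -[X in _ + X]opprK.
apply: KoszulD; last by rewrite opprK.
rewrite /S -sumrB big_seq; apply: (@big_ind _ (koszul phi)) => [|a b|p ps].
- exact: Koszul0.
- exact: KoszulD.
rewrite -!scalerBr; apply: koszul_ideal_ker; first exact: sI.
rewrite !raddfB /= !ideal_phi_gen /= /edge_target /edge_source.
rewrite !face0_gen !face1_ca ?ideal0 ?(valP p.2) //.
by rewrite !bar_section_cst; ring.
Qed.

End SecondHomology.

Arguments ideal_phi : simpl never.

(** * Endomorphisms of F from the flatness of H_1 *)

Section IdealModule.
Variables (R : comPzRingType) (K : ideal R).
Definition ideal_module : Type := {x : R^o | x \in K}.
HB.instance Definition _ := SubChoice.on ideal_module.
Fact ideal_module_closed : submod_closed (fun x : R^o => x \in K).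
Proof.
split=> [|a x y Kx Ky]; first exact: (ideal0 K).
by apply: (@idealD _ K) => //; apply: (@idealMl _ K).
Qed.
HB.instance Definition _ := GRing.SubChoice_isSubLmodule.Build R R^o
  (fun x : R^o => x \in K) ideal_module ideal_module_closed.
Definition ideal_module_val (x : ideal_module) : R^o := val x.
Fact ideal_module_val_linear : linear ideal_module_val.
Proof. by []. Qed.
HB.instance Definition _ := GRing.isLinear.Build R ideal_module R^o *:%R
  ideal_module_val ideal_module_val_linear.
Lemma ideal_module_valZ a (x : ideal_module) : val (a *: x) = a * (val x : R) :> R.
Proof. by []. Qed.
Lemma ideal_module_valD (x y : ideal_module) : val (x + y) = (val x : R) + val y :> R.
Proof. by []. Qed.
Lemma ideal_module_val_inj : injective ideal_module_val.
Proof. exact: val_inj. Qed.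
End IdealModule.

Section TensorTheory.
Variables (R : comPzRingType) (M N : lmodType R).
Lemma tensor_mkDl (m m' : M) (n : N) : tensor_mk (m + m') n = tensor_mk m n + tensor_mk m' n.
Proof. by have [h _ _ _] := tensor_mk_bilinear M N; apply: h. Qed.
Lemma tensor_mkZl a (m : M) (n : N) : tensor_mk (a *: m) n = a *: tensor_mk m n.
Proof. by have [_ _ h _] := tensor_mk_bilinear M N; apply: h. Qed.
Lemma tensor_mkZr a (m : M) (n : N) : tensor_mk m (a *: n) = a *: tensor_mk m n.
Proof. by have [_ _ _ h] := tensor_mk_bilinear M N; apply: h. Qed.
Lemma tensor_mk0l (n : N) : tensor_mk (0 : M) n = 0.
Proof. by rewrite -(scale0r (0 : M)) tensor_mkZl scale0r. Qed.
End TensorTheory.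

Section Flatness.
Variables (A : comPzRingType) (I : ideal A).
Local Notation R := (quot_ring I).
Local Notation hq := (quot_proj I).
Local Notation X := (ideal_elt I).
Local Notation F := (freemod A X).
Local Notation e := (freemod_gen A).
Local Notation phi := (@ideal_phi A I).
Local Notation H1 := (cotangent_homology hq 1).

Section Relation.
Variables (s : seq X) (c : X -> A).
Hypothesis us : uniq s.

(* a U + I F, where U = ker phi and a is the ideal of the coefficients c *)
Definition rel_sub_pred : {pred F} := fun f =>
  `[< exists v : X -> F, (forall x, phi (v x) = 0) /\
      in_IM I (f - \sum_(x <- s) c x *: v x) >].
Fact rel_sub_closed : submod_closed rel_sub_pred.
Proof.
split=> [|a f g /asboolP[v [v0 hv]] /asboolP[w [w0 hw]]]; apply/asboolP.
  exists (fun=> 0); split=> [x|]; first exact: raddf0.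
  by rewrite sub0r big1 ?oppr0; [apply: InIM0|move=> x _; rewrite scaler0].
exists (fun x => a *: v x + w x); split=> [x|].
  by rewrite linearP v0 w0 scaler0 addr0.
have -> : \sum_(x <- s) c x *: (a *: v x + w x) =
    a *: (\sum_(x <- s) c x *: v x) + \sum_(x <- s) c x *: w x.
  rewrite scaler_sumr -big_split; apply: eq_bigr => x _ /=.
  by rewrite scalerDr !scalerA mulrC.
rewrite opprD addrACA -scalerBr; apply: InIMD => //; exact: InIMZ.
Qed.
Definition rel_sub : submodule F := Submodule rel_sub_closed.
HB.instance Definition _ := GRing.isSubmodClosed.Build A F rel_sub_pred rel_sub_closed.

Lemma rel_sub_IM f : in_IM I f -> f \in rel_sub_pred.
Proof.
move=> hf; apply/asboolP; exists (fun=> 0); split=> [x|]; first exact: raddf0.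
by rewrite big1 ?subr0 // => x _; rewrite scaler0.
Qed.

Lemma rel_sub_gen x u : x \in s -> phi u = 0 -> c x *: u \in rel_sub_pred.
Proof.
move=> xs u0; apply/asboolP; exists (fun y => if y == x then u else 0); split=> [y|].
  by case: ifP => // _; apply: raddf0.
rewrite (big_rem x) //= eqxx big_seq big1 ?addr0 ?subrr; first exact: InIM0.
by move=> y; rewrite mem_rem_uniq // inE => /andP[/negPf-> _]; rewrite scaler0.
Qed.

Definition coeff_ideal : ideal R := ideal_span (fun r => exists2 x, x \in s & r = hq (c x)).

Lemma ideal_sqr_lift z : z \in ideal_sqr I -> exists2 w : F, in_IM I w & phi w = z.
Proof.
move: z; apply: ideal_span_ind => [|x y [v hv <-] [w hw <-]|a z [x [y [xI yI ->]]]].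
- by exists 0; [apply: InIM0|apply: raddf0].
- by exists (v + w); [apply: InIMD|apply: raddfD].
exists ((a * x) *: e (exist _ y yI)); first exact/InIMgen/idealMl.
by rewrite linearZ /= ideal_phi_gen /=; apply/esym/mulrA.
Qed.

Lemma rel_sub_coeff a u : hq a \in coeff_ideal -> phi u = 0 -> a *: u \in rel_sub_pred.
Proof.
suff gen r : r \in coeff_ideal ->
    forall a u, hq a = r -> phi u = 0 -> a *: u \in rel_sub_pred.
  by move=> aK; exact: gen aK a u erefl.
move: r => {a u}.
have modI a b u : hq a = hq b -> b *: u \in rel_sub_pred -> a *: u \in rel_sub_pred.
  move=> /quot_projP abI hb; rewrite -(subrK b a) scalerDl; apply: rpredD => //.
  by apply: rel_sub_IM; apply: InIMgen.
apply: ideal_span_ind => [|r t hr ht|t r [x xs ->]] a u aE u0.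
- apply: (modI a 0) => //; first by rewrite aE rmorph0.
  by rewrite scale0r rpred0.
- have [b rE] := quot_proj_surj r; have [d tE] := quot_proj_surj t.
  apply: (modI a (b + d)); first by rewrite aE rE tE rmorphD.
  by rewrite scalerDl; apply: rpredD; [apply: hr|apply: ht].
- have [b tE] := quot_proj_surj t.
  apply: (modI a (b * c x)); first by rewrite aE tE rmorphM.
  by rewrite -scalerA rpredZ // rel_sub_gen.
Qed.

(** Since I^2 = phi(I F), subtracting an element of I F from w makes it an element of the kernel of
    phi. *)
Lemma rel_sub_key a w : hq a \in coeff_ideal -> phi w \in ideal_sqr I ->
  a *: w \in rel_sub_pred.
Proof.
move=> aK /ideal_sqr_lift[w' w'I w'E].
rewrite -(subrK w' w) scalerDr; apply: rpredD.
  by apply: rel_sub_coeff; rewrite // raddfB /= w'E subrr.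
exact/rel_sub_IM/InIMZ.
Qed.

Local Notation QF := (quot_mod rel_sub).
Local Notation qp := (quot_mod_proj rel_sub).

Lemma rel_quot_kill a (m : QF) : a \in I -> a *: m = 0.
Proof.
move=> aI; have [f ->] := quot_mod_proj_surj m.
rewrite [LHS]quot_mod_scaleE -(raddf0 qp); apply/quot_mod_projP.
by rewrite subr0; apply: rel_sub_IM; apply: InIMgen.
Qed.
Local Notation KQ := (killed_mod rel_quot_kill).
Local Notation N := (ideal_module coeff_ideal).

Definition cycle_lift (m : H1) : F := e (repr (homology_conormal m)).

Lemma cycle_lift_phi m :
  conormal_class (exist _ (phi (cycle_lift m)) (ideal_phi_in (cycle_lift m)) : X) =
  homology_conormal m.
Proof.
rewrite -[RHS](reprK (homology_conormal m)) -/(conormal_class _); congr conormal_class.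
by apply: val_inj; rewrite /= ideal_phi_gen.
Qed.

Lemma cycle_lift_sub m f :
  conormal_class (exist _ (phi f) (ideal_phi_in f) : X) = homology_conormal m ->
  phi (cycle_lift m - f) \in ideal_sqr I.
Proof.
by rewrite -cycle_lift_phi raddfB => /esym/conormal_classP.
Qed.

(** Multiply a lift of the class in I/I^2 to F by a representative of the scalar. Two lifts differ
    by some w with phi w in I^2, so [rel_sub_key] makes the result independent of the choices, and
    hence bilinear, although [cycle_lift] is not additive. Restricting the scalars to [coeff_ideal]
    is essential here. *)
Definition rel_pairing (mr : H1 * N) : KQ := qp (repr (val mr.2 : R) *: cycle_lift mr.1).

Lemma rel_pairing_eq (m : H1) (r : N) a f : hq a = val r ->
  conormal_class (exist _ (phi f) (ideal_phi_in f) : X) = homology_conormal m ->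
  rel_pairing (m, r) = qp (a *: f).
Proof.
move=> ar fm; apply/quot_mod_projP => /=.
have -> : repr (val r : R) *: cycle_lift m - a *: f =
    (repr (val r : R) - a) *: cycle_lift m + a *: (cycle_lift m - f).
  by rewrite scalerBl scalerBr addrA subrK.
apply: rpredD.
  apply/rel_sub_IM/InIMgen; rewrite -ar; exact: repr_quot_proj.
apply: rel_sub_key; last exact: cycle_lift_sub.
by rewrite ar; apply: valP r.
Qed.

Fact rel_pairing_bilinear : bilinear_rel rel_pairing.
Proof.
have classD f g : conormal_class (exist _ (phi (f + g)) (ideal_phi_in (f + g)) : X) =
    conormal_class (exist _ (phi f) (ideal_phi_in f) : X) +
    conormal_class (exist _ (phi g) (ideal_phi_in g) : X).
  rewrite -raddfD; congr conormal_class; apply: val_inj; by rewrite /= raddfD.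
have classZ a f : conormal_class (exist _ (phi (a *: f)) (ideal_phi_in (a *: f)) : X) =
    hq a *: conormal_class (exist _ (phi f) (ideal_phi_in f) : X).
  rewrite [RHS]conormal_scaleE; congr conormal_class; apply: val_inj; by rewrite /= linearZ.
have rE (r : N) : hq (repr (val r : R)) = val r by apply: reprK.
split=> [m m' r|m r r'|a m r|a m r].
- rewrite (rel_pairing_eq (rE r) (f := cycle_lift m + cycle_lift m')).
    by rewrite scalerDr raddfD.
  by rewrite classD !cycle_lift_phi homology_conormalD.
- rewrite (rel_pairing_eq (a := repr (val r : R) + repr (val r' : R)) _ (cycle_lift_phi m)).
    by rewrite scalerDl raddfD.
  rewrite rmorphD [RHS]ideal_module_valD.
  by congr (_ + _); apply: rE.
- have [b ->] := quot_proj_surj a.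
  rewrite (rel_pairing_eq (rE r) (f := b *: cycle_lift m)).
    rewrite [RHS]killed_scaleE [RHS]quot_mod_scaleE; congr (qp _).
    by rewrite !scalerA mulrC.
  by rewrite classZ cycle_lift_phi homology_conormalZ.
- have [b ->] := quot_proj_surj a.
  rewrite (rel_pairing_eq (a := b * repr (val r : R)) _ (cycle_lift_phi m)).
    by rewrite [RHS]killed_scaleE [RHS]quot_mod_scaleE scalerA.
  rewrite rmorphM [RHS]ideal_module_valZ.
  by congr (_ * _); apply: rE.
Qed.

Definition coeff_elt x (xs : x \in s) : N :=
  exist _ (hq (c x) : R^o) (mem_ideal_span (ex_intro2 _ _ x xs erefl)).

(* Flatness for the inclusion of the ideal of the coefficients c x turns the relation
   between the classes of the x into a vanishing tensor, to be read in F / (a U + I F). *)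
Lemma flat_relation : flat H1 -> phi (\sum_(x <- s) c x *: e x) = 0 ->
  \sum_(x <- s) c x *: e x \in rel_sub_pred.
Proof.
move=> flatH u0.
pose n x : N := if pselect (x \in s) is left xs then coeff_elt xs else 0.
have nE x : x \in s -> val (n x) = hq (c x).
  by move=> xs; rewrite /n; case: pselect.
pose xi := \sum_(x <- s) tensor_mk (ideal_cycle_class x) (n x).
pose i : {linear N -> R^o} := @ideal_module_val R coeff_ideal.
have xi0 : xi = 0.
  apply: (flatH N R^o i (@ideal_module_val_inj _ _)); rewrite raddf0 raddf_sum.
  have -> : \sum_(x <- s) tensor_map H1 i (tensor_mk (ideal_cycle_class x) (n x)) =
      \sum_(x <- s) tensor_mk (ideal_cycle_class (ideal_elt_scale (c x) x)) (1 : R^o).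
    rewrite !big_seq; apply: eq_bigr => x xs.
    transitivity (tensor_mk (ideal_cycle_class x) (i (n x))); first exact: univ_mod_liftE.
    rewrite ideal_cycle_classZ tensor_mkZl -tensor_mkZr; congr tensor_mk.
    by rewrite [LHS]nE //; apply/esym/mulr1.
  have hs : exists y : X, val y = phi (\sum_(x <- s) c x *: e x) /\
      \sum_(x <- s) tensor_mk (ideal_cycle_class (ideal_elt_scale (c x) x)) (1 : R^o) =
      tensor_mk (ideal_cycle_class y) (1 : R^o).
    elim: (s) => [|x t [y [yE tE]]].
      exists 0; split; first by rewrite big_nil; apply/esym/raddf0.
      by rewrite big_nil ideal_cycle_class0 tensor_mk0l.
    exists (ideal_elt_scale (c x) x + y); split.
      by rewrite big_cons linearP /= yE ideal_phi_gen.
    by rewrite big_cons tE ideal_cycle_classD tensor_mkDl.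
  have [y [yE ->]] := hs.
  have -> : y = 0 by apply: val_inj; rewrite yE u0.
  by rewrite ideal_cycle_class0 tensor_mk0l.
have : univ_mod_lift rel_pairing_bilinear xi = 0 by rewrite xi0 raddf0.
have -> : univ_mod_lift rel_pairing_bilinear xi = qp (\sum_(x <- s) c x *: e x).
  rewrite raddf_sum [RHS]raddf_sum !big_seq; apply: eq_bigr => x xs.
  transitivity (rel_pairing (ideal_cycle_class x, n x)); first exact: univ_mod_liftE.
  apply: rel_pairing_eq; first by rewrite nE.
  rewrite homology_conormal_cycle; congr conormal_class; apply: val_inj => /=.
  exact: ideal_phi_gen.
by rewrite -(raddf0 qp) => /quot_mod_projP; rewrite subr0.
Qed.

End Relation.

(** If u is the sum of the c_x e_x, [flat_relation] gives v_x in ker(phi) with u congruent to the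
    sum of the c_x v_x modulo I F. Sending e_x to e_x - v_x preserves phi and moves u into I F. *)
Lemma flat_retraction (u : F) : flat H1 -> phi u = 0 ->
  exists eta : {linear F -> F}, (forall f, phi (eta f) = phi f) /\ in_IM I (eta u).
Proof.
move=> flatH u0; have [s [c [us uE]]] := freemod_normal u.
have /asboolP[v [v0 hv]] : u \in rel_sub_pred s c.
  by rewrite uE; apply: flat_relation; rewrite // -uE.
pose w (x : X) : F := if x \in s then v x else 0.
have w0 x : phi (w x) = 0 by rewrite /w; case: ifP => // _; apply: raddf0.
exists (freemod_lift (fun x : X => e x - w x)); split=> [f|].
  elim/freemod_ind: f => [x|f g hf hg|a f hf|]; rewrite ?freemod_liftE.
  - by rewrite [LHS]raddfB [X in _ - X]w0 subr0; apply: ideal_phi_gen.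
  - by rewrite !raddfD /= hf hg.
  - by rewrite !linearZ /= hf.
  - by rewrite !raddf0.
rewrite {1}uE raddf_sum (_ : \sum_(x <- s) _ = u - \sum_(x <- s) c x *: v x) //.
rewrite uE -sumrB !big_seq; apply: eq_bigr => x xs.
transitivity (c x *: (e x - w x)); last by rewrite scalerBr /w xs.
pose h : {linear F -> F} := freemod_lift (fun x : X => e x - w x).
have hZ a f : h (a *: f) = a *: h f by apply: linearZ.
by rewrite -[e x - w x](freemod_liftE (fun x : X => e x - w x)); apply: hZ.
Qed.

(** The new vector is treated after applying the eta already found, and the two maps are composed;
    earlier vectors stay in I F because linear maps preserve it. *)
Lemma flat_retraction_seq (us : seq F) : flat H1 -> (forall u, u \in us -> phi u = 0) ->
  exists eta : {linear F -> F}, (forall f, phi (eta f) = phi f) /\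
    forall u, u \in us -> in_IM I (eta u).
Proof.
move=> flatH; elim: us => [|u us IHus] us0.
  by exists (idfun : {linear F -> F}).
have [|eta [ep ei]] := IHus; first by move=> v vus; apply: us0; rewrite inE vus orbT.
have u0 : phi (eta u) = 0 by rewrite ep us0 // mem_head.
have [eta' [ep' ei']] := flat_retraction flatH u0.
exists (eta' \o eta)%FUN; split=> [f|v] /=; first by rewrite ep' ep.
by rewrite inE => /orP[/eqP->|/ei] //; apply: in_IM_linear.
Qed.

Lemma quasiregular_good_eta (us : seq F) : quasiregular I ->
  (forall u, u \in us -> phi u = 0) -> exists eta, good_eta phi us eta.
Proof.
move=> [H0 flatH] us0; have [eta [ep ei]] := flat_retraction_seq flatH us0.
exists eta; split=> // u uus; apply: second_homology_koszul; last exact: ei.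
  exact: H0.
by rewrite ep us0.
Qed.

End Flatness.

Theorem mainTheorem14 (A : comPzRingType) (I : ideal A) (B : pdRing)
    (iota : {rmorphism A -> B})
    (qI : quasiregular I) (env : pd_envelope I iota) :
  (forall (n : nat) (u : divpow_alg (conormal I)),
     dp_homog n u <-> gr_homog n (canonical_map (proj1 env) u)) /\
  bijective (canonical_map (proj1 env)).
Proof.
have eta_ex us := @quasiregular_good_eta A I us qI.
split; first exact: (canonical_map_homog (@ideal_phi_in A I) (@ideal_phi_surj A I) eta_ex).
exact: (canonical_map_bij (@ideal_phi_in A I) (@ideal_phi_surj A I) eta_ex).
Qed.
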